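(* Let $\{B^H(t): t\in[0,1]\}$ be a $d$-dimensional fractional Brownian motion with Hurst index $H\in(0,1)$. Let $f:[0,1]\to\mathbb{R}^d$ be a bounded Borel measurable function and let $E\subset(0,1]$ be a Borel set. Then for all $x\in\mathbb{R}^d$ there is a finite constant $\mathbf{c}_1\ge1$ such that $$\mathbf{c}_1^{-1}\,\mathcal{C}_{\rho_H,d}(Gr_E(f))\le\mathbb{P}\{\exists\, t\in E: (B^H+f)(t)=x\}\le\mathbf{c}_1\,\mathcal{H}^d_{\rho_H}(Gr_E(f)).$$
   Context: A $d$-dimensional fractional Brownian motion of Hurst index $H\in(0,1)$ is $B^H=(B^H_1,\dots,B^H_d)$ with independent components, each a real-valued centered Gaussian process with continuous paths and covariance $\mathbb{E}(B^H_i(s)B^H_i(t))=\frac12(|t|^{2H}+|s|^{2H}-|t-s|^{2H})$, defined on a complete probability space. $Gr_E(f)=\{(t,f(t)): t\in E\}$ is the graph of $f$ over $E$. The parabolic metric on $\mathbb{R}_+\times\mathbb{R}^d$ is $\rho_H((s,x),(t,y))=\max\{|t-s|^H,\|x-y\|\}$, with $\|\cdot\|$ the Euclidean norm. For $\beta>0$ and $A\subset\mathbb{R}_+\times\mathbb{R}^d$, $$\mathcal{H}^\beta_{\rho_H}(A)=\lim_{\delta\to0}\inf\Big\{\sum_{n=1}^\infty(2r_n)^\beta: A\subseteq\bigcup_{n=1}^\infty B_{\rho_H}(r_n),\ r_n\le\delta\Big\},$$ where $B_{\rho_H}(r)$ denotes an open ball of radius $r$ in $(\mathbb{R}_+\times\mathbb{R}^d,\rho_H)$.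 The Bessel–Riesz type capacity of order $\alpha>0$ is $$\mathcal{C}_{\rho_H,\alpha}(A)=\Big[\inf_{\mu\in\mathcal{P}(A)}\iint\rho_H(u,v)^{-\alpha}\,\mu(du)\mu(dv)\Big]^{-1},$$ where $\mathcal{P}(A)$ is the family of probability measures carried by $A$ (and $0^{-\alpha}=+\infty$). *)

(* Defs.v *)
From HB Require Import structures.
From mathcomp Require Import all_boot all_order all_algebra.
From mathcomp Require Import all_classical all_reals all_analysis.
Set Implicit Arguments.
Unset Strict Implicit.
Unset Printing Implicit Defensive.
Import Order.TTheory GRing.Theory Num.Theory.
Import numFieldTopology.Exports numFieldNormedType.Exports.
Local Open Scope classical_set_scope.
Local Open Scope ring_scope.

(* R^d with its Borel sigma-algebra *)
Definition borel_rV (R : realType) (d : nat) :=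
  g_sigma_algebraType (@open 'rV[R]_d).

(* the library norm on 'rV[R]_d is the sup norm, hence this definition *)
Definition enorm (R : realType) (d : nat) (x : 'rV[R]_d) : R :=
  Num.sqrt (\sum_(i < d) x 0 i ^+ 2).

(* [normal_prob m 0] is the uniform law on [0, 1], so the degenerate case has
   to be treated apart *)
Definition gaussian_law (R : realType) (m s : R) (A : set R) : \bar R :=
  if s == 0 then \d_m A else normal_prob m s A.

Section fractional_brownian_motion.
Context (R : realType) (dT : measure_display) (T : measurableType dT).
Variable P : probability T R.

Definition gaussian_process (I : set R) (X : R -> T -> R) : Prop :=
  (forall t, I t -> measurable_fun setT (X t)) /\
  (forall (n : nat) (t a : 'I_n -> R), (forall k, I (t k)) ->
    exists m s : R, forall A : set R, measurable A ->
      pushforward P (fun w => \sum_(k < n) a k * X (t k) w) A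
      = gaussian_law m s A).

Definition fbm_cov (H s t : R) : R :=
  2^-1 * (`|t| `^ (2 * H) + `|s| `^ (2 * H) - `|t - s| `^ (2 * H)).

Definition fbm1 (H : R) (I : set R) (X : R -> T -> R) : Prop :=
  [/\ gaussian_process I X,
      forall t, I t -> ('E_P[X t] = 0)%E,
      forall s t, I s -> I t ->
        ('E_P[fun w => (X s w * X t w)%R] = (fbm_cov H s t)%:E)%E
    & forall w, {within I, continuous (fun t => X t w)}].

Definition process_sigma (I : set R) (X : R -> T -> R) : set (set T) :=
  <<s \bigcup_(t in I) preimage_set_system setT (X t) measurable >>.

(* As each A i may be taken to be setT, the product rule for the full family
   includes the one for its subfamilies. *)
Definition independent_processes (d : nat) (I : set R)
    (B : 'I_d -> R -> T -> R) : Prop :=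
  forall A : 'I_d -> set T, (forall i, process_sigma I (B i) (A i)) ->
    (P (\bigcap_(i in [set: 'I_d]) A i) = \prod_(i < d) P (A i))%E.

(* d-dimensional fractional Brownian motion with time set I *)
Definition fbm (d : nat) (H : R) (I : set R) (B : 'I_d -> R -> T -> R) : Prop :=
  (forall i, fbm1 H I (B i)) /\ independent_processes I B.

End fractional_brownian_motion.

Section parabolic_metric.
Context (R : realType) (d : nat).
Implicit Types (H : R) (u v : R * 'rV[R]_d) (A : set (R * 'rV[R]_d)).

Definition graph_on (E : set R) (f : R -> 'rV[R]_d) : set (R * 'rV[R]_d) :=
  [set (t, f t) | t in E].

Definition rho H u v : R :=
  Num.max (`|u.1 - v.1| `^ H) (enorm (u.2 - v.2)).

(* The metric space is R_+ x R^d, encoded as the part of R x R^d with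
   nonnegative time. *)
Definition rho_ball H u (r : R) : set (R * 'rV[R]_d) :=
  [set v | 0 <= v.1 /\ rho H u v < r].

Definition hausdorff_pre H (beta delta : R) A : \bar R :=
  ereal_inf [set z | exists (c : nat -> R * 'rV[R]_d) (r : nat -> R),
    [/\ forall n, 0 <= (c n).1,
        forall n, 0 < r n <= delta,
        A `<=` \bigcup_n rho_ball H (c n) (r n)
      & z = (\sum_(0 <= n <oo) ((2 * r n) `^ beta)%:E)%E]].

Definition hausdorff H (beta : R) A : \bar R :=
  lim (hausdorff_pre H beta delta A @[delta --> 0^'+]).

(* extended inverse: 0^-1 = +oo and +oo^-1 = 0 *)
Definition riesz_kernel H (alpha : R) u v : \bar R :=
  (((rho H u v `^ alpha)%R)%:E^-1)%E.

Definition energy H (alpha : R)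
    (mu : probability (R * borel_rV R d)%type R) : \bar R :=
  (\int[mu]_u \int[mu]_v riesz_kernel H alpha u v)%E.

(* ereal_inf set0 = +oo, so the capacity is 0 when A carries no probability *)
Definition capacity H (alpha : R) A : \bar R :=
  ((ereal_inf [set energy H alpha mu |
     mu in [set mu : probability (R * borel_rV R d)%type R |
              mu.-negligible (~` A)]])^-1)%E.

End parabolic_metric.

(* Main.v *)
Require Import Defs.
From HB Require Import structures.
From mathcomp Require Import all_boot all_order all_algebra.
From mathcomp Require Import all_classical all_reals all_analysis.
From mathcomp Require Import measurable_realfun.
From mathcomp Require Import ring lra.
Set Implicit Arguments.
Unset Strict Implicit.
Unset Printing Implicit Defensive.
Import Order.TTheory GRing.Theory Num.Theory.
Import numFieldTopology.Exports numFieldNormedType.Exports.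
Local Open Scope classical_set_scope.
Local Open Scope ring_scope.

(** The constant may depend on the point, the drift and the time set, so the
   two inequalities amount to three facts about the hitting event
   [N = {w | exists t in E, B_t w + f t = x}]: it is measurable; it is null
   when the Hausdorff measure of the graph vanishes; and if the capacity of the
   graph is positive, then that capacity is finite and [P N > 0]. A positive
   finite quantity on either side is absorbed by the constant.

   Measurability. [N] is the projection of a measurable subset of a product,
   hence in general only an analytic set. Choquet's argument shows that an
   analytic set is exhausted from inside by compact sets, up to arbitrarily
   small outer probability ([analytic_hits_approx]); hitting a compact set is
   measurable because paths are continuous, and completeness of [P] does the
   rest ([measurable_hitting_event]). The same approximation, with the random
   set replaced by a single deterministic point, gives the inner regularity of
   measures on space-time ([inner_regular]).

   Null sets. For times bounded away from [0], the path comes within [r] of a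
   given point during a time [2 r^(1/H)] with probability of order [r^d]
   ([fbm_hit]). For one coordinate this is a chaining argument over dyadic
   times ([fbm1_hit]), in which the event of a large increment is always taken
   together with the event of being near the target, so that the factor [r] is
   kept at each scale; the coordinates are then multiplied by independence. A
   parabolic ball of radius [r] is exactly such a time-space window, so a
   cover of the graph bounds the probability of [N] by its [d]-dimensional sum
   ([hausdorff_null_hit]).

   Positive capacity. Let [mu] be carried by the graph with finite energy, and
   restrict it to a compact set [K] at times bounded away from [0]. The random
   variable [Z_e = mu {(t, y) in K | B_t is in the box of radius e around
   x - y}] has mean at least of order [e^d]. Its second moment is the double
   [mu]-integral of a two-time probability, which is at most of order
   [e^(2d) rho^-d] ([fbm_two_point]). The Paley-Zygmund inequality
   bounds [P (Z_e > 0)] from below uniformly in [e] ([second_moment_bound]),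
   and letting [e] tend to [0] over the compact set [K] produces a hitting time
   ([capacity_pos_hit]).

   Both probability estimates rest on two properties of the one-dimensional
   covariance on [[a, 1]]: the regression coefficient of [X_t] on [X_s] is
   within a multiple of [|t - s|^H] of [1], and the residual variance is
   comparable to [|t - s|^(2H)] ([fbm_reg_close], [fbm_cvar_ge]). The regression
   residual is uncorrelated with [X_s]; joint laws are only known
   through those of linear combinations, so independence is used in the form of
   exact formulas for the expectations of Gaussian-shaped functions, obtained
   from the characteristic function ([gaussian_pair_bump2]). *)

(** * Integrals against the normal density *)

Section gaussian_integrals.
Context {R : realType}.
Notation mu := (@lebesgue_measure R).
Implicit Types m s u th x : R.

(** The fundamental theorem of calculus on [[-n, n]], with dominated convergence. *)
Lemma integral_derive_eq0 (F f : R -> R) :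
  (forall x, is_derive x 1 F (f x)) -> continuous f ->
  mu.-integrable setT (EFin \o f) ->
  F n%:R @[n --> \oo] --> 0 -> F (- n%:R) @[n --> \oo] --> 0 ->
  \int[mu]_x f x = 0.
Proof.
move=> dF cf intf F1 F2.
have cF : continuous F.
  by move=> x; apply/differentiable_continuous/derivable1_diffP; case: (dF x).
pose fn (n : nat) := (EFin \o f) \_ `[- n.+1%:R, n.+1%:R].
have cv : (\int[mu]_x fn n x)%E @[n --> \oo] --> (\int[mu]_x (EFin \o f) x)%E.
  apply: (@dominated_cvg _ _ _ mu _ _ _ _ (fun x => `|(f x)%:E|)%E) => //.
  - move=> n; apply: (measurable_restrictT (EFin \o f) (measurable_itv `[- n.+1%:R, n.+1%:R])).1.
    by apply: measurable_funTS; exact: measurable_int intf.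
  - move=> x _; apply: cvg_near_cst.
    near=> n; rewrite /fn patchE ifT// inE/= in_itv/=.
    rewrite -ler_norml; apply: le_trans (_ : n%:R <= _); last by rewrite ler_nat.
    by near: n; exact: nbhs_infty_ger.
  - exact: integrable_abse.
  - move=> n x _; rewrite /fn patchE; case: ifP => //=; rewrite normr0 lee_fin//.
have E n : (\int[mu]_x fn n x = (F n.+1%:R - F (- n.+1%:R))%:E)%E.
  rewrite -integral_mkcond.
  rewrite (@continuous_FTC2 _ f F (- n.+1%:R) n.+1%:R)//.
  - by rewrite gtrN.
  - exact: continuous_subspaceT.
  - split.
    + by move=> x _; case: (dF x).
    + exact/cvg_at_right_filter/cF.
    + exact/cvg_at_left_filter/cF.
  - by move=> x _; rewrite derive1E; apply: derive_val.
have cv0 : (\int[mu]_x fn n x)%E @[n --> \oo] --> 0%:E.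
  under eq_fun do rewrite E.
  apply: cvg_EFin; first exact: nearW.
  rewrite -[X in _ --> X](subr0 0); apply: cvgB.
  - by move: F1; rewrite -(cvg_shiftS (fun n => F n%:R)).
  - by move: F2; rewrite -(cvg_shiftS (fun n => F (- n%:R))).
by rewrite /Rintegral (cvg_unique _ cv cv0).
Unshelve. all: by end_near. Qed.

Lemma normal_fun_double m s x : s != 0 ->
  normal_fun m s x = normal_fun m (2 * s) x ^+ 4.
Proof.
by move=> s0; rewrite /normal_fun -expRM_natl; congr expR; field.
Qed.

Lemma normal_peak_double s : s != 0 -> normal_peak s = 2 * normal_peak (2 * s).
Proof.
move=> s0; rewrite /normal_peak.
have -> : (2 * s) ^+ 2 * pi *+ 2 = 2 ^+ 2 * (s ^+ 2 * pi *+ 2) by ring.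
rewrite sqrtrM ?sqr_ge0// sqrtr_sqr ger0_norm// invfM mulrA divff ?mul1r//.
Qed.

(** Doubling the standard deviation trades decay for room: a polynomial factor
   in front of the narrow density is absorbed by the wider one. *)
Lemma normal_pdf_double m s x : s != 0 ->
  (1 + (x - m) ^+ 2) * normal_pdf m s x <= (2 + 16 * s ^+ 2) * normal_pdf m (2 * s) x.
Proof.
move=> s0; have s20 : 2 * s != 0 by rewrite mulf_neq0.
rewrite !normal_pdfE// normal_peak_double// normal_fun_double//.
set p := normal_peak _; set e := normal_fun _ _ _.
have p0 : 0 <= p by exact: normal_peak_ge0.
pose z := (x - m) ^+ 2 / (8 * s ^+ 2).
have s2 : 0 < s ^+ 2 by rewrite exprn_even_gt0.
have z0 : 0 <= z by rewrite divr_ge0 ?sqr_ge0// mulr_ge0// ltW.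
have eE : e = expR (- z) by rewrite /e /normal_fun /z; congr expR; field.
have xz : (x - m) ^+ 2 = 8 * s ^+ 2 * z by rewrite /z; field.
have e0 : 0 < e by rewrite eE expR_gt0.
have e1 : e <= 1 by rewrite eE -expR0 ler_expR oppr_le0.
have ze : z * e <= 1.
  rewrite eE expRN ler_pdivrMr ?expR_gt0// mul1r.
  by apply: le_trans (expR_ge1Dx z); rewrite lerDr.
have e3 : e ^+ 3 <= 1 by rewrite exprn_ile1// ltW.
have h1 : e ^+ 4 <= e by rewrite exprS ler_piMr// ltW.
have h2 : z * e ^+ 4 <= e.
  have -> : z * e ^+ 4 = (z * e) * (e ^+ 3) by ring.
  apply: (@le_trans _ _ (1 * e ^+ 3)); first by rewrite ler_wpM2r// exprn_ge0// ltW.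
  by rewrite mul1r exprS ler_piMr ?(ltW e0)// exprn_ile1// ltW.
have h : (1 + (x - m) ^+ 2) * e ^+ 4 <= (1 + 8 * s ^+ 2) * e.
  have h3 : 8 * s ^+ 2 * (z * e ^+ 4) <= 8 * s ^+ 2 * e.
    by rewrite ler_wpM2l// mulr_ge0// ltW.
  by rewrite xz; lra.
have : 2 * p * ((1 + (x - m) ^+ 2) * e ^+ 4) <= 2 * p * ((1 + 8 * s ^+ 2) * e).
  by rewrite ler_wpM2l// mulr_ge0.
lra.
Qed.

Lemma normal_pdf_cvg0 m s : s != 0 ->
  normal_pdf m s n%:R @[n --> \oo] --> 0 /\ normal_pdf m s (- n%:R) @[n --> \oo] --> 0.
Proof.
move=> s0; have s2 : 0 < (s ^+ 2 *+ 2)^-1.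
  by rewrite invr_gt0 pmulrn_lgt0// exprn_even_gt0.
have key c : expR (- (((n%:R + c) ^+ 2) * (s ^+ 2 *+ 2)^-1)) @[n --> \oo] --> 0.
  have c1 : n%:R + c @[n --> \oo] --> +oo := cvg_comp _ _ cvgr_idn (cvg_addrr c).
  have c2 : (n%:R + c) ^+ 2 @[n --> \oo] --> +oo := cvg_comp _ _ c1 cvgr_expr2.
  have c3 : x * (s ^+ 2 *+ 2)^-1 @[x --> +oo] --> +oo by apply: gt0_cvgMly => //; exact: cvg_id.
  have c4 := cvg_comp (fun n => (n%:R + c) ^+ 2) (fun x : R => x * (s ^+ 2 *+ 2)^-1) c2 c3.
  exact: (cvg_comp _ (fun x : R => expR (- x)) c4 (@cvgr_expR R)).
split; rewrite normal_pdfE//; rewrite -[X in _ --> X](mulr0 (normal_peak s));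
  apply: cvgM; [exact: cvg_cst| |exact: cvg_cst|]; rewrite /normal_fun.
- under eq_fun do rewrite mulNr; exact: key.
- under eq_fun do rewrite mulNr -opprD sqrrN; exact: key.
Qed.

Lemma integral_derive_normal m s C (F f : R -> R) : s != 0 ->
  (forall x, is_derive x 1 F (f x)) -> continuous f ->
  (forall x, `|F x| <= C * ((1 + (x - m) ^+ 2) * normal_pdf m s x)) ->
  (forall x, `|f x| <= C * ((1 + (x - m) ^+ 2) * normal_pdf m s x)) ->
  \int[mu]_x f x = 0.
Proof.
move=> s0 dF cf Fb fb; have s20 : 2 * s != 0 by rewrite mulf_neq0.
have C0 : 0 <= C.
  have := fb m; rewrite subrr expr0n addr0 mul1r => /(le_trans (normr_ge0 _)).
  rewrite pmulr_lge0// normal_pdfE// mulr_gt0 ?expR_gt0//.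
  exact: normal_peak_gt0.
pose D := C * (2 + 16 * s ^+ 2).
have b x : C * ((1 + (x - m) ^+ 2) * normal_pdf m s x) <= D * normal_pdf m (2 * s) x.
  by rewrite /D -mulrA ler_wpM2l// normal_pdf_double.
have [c1 c2] := normal_pdf_cvg0 m s20.
have cv (y : nat -> R) : normal_pdf m (2 * s) (y n) @[n --> \oo] --> 0 ->
    F (y n) @[n --> \oo] --> 0.
  move=> cy; apply: norm_cvg0.
  apply: (@squeeze_cvgr _ _ _ _ (cst 0) (fun n => D * normal_pdf m (2 * s) (y n))).
  - by apply: nearW => n; rewrite normr_ge0/= (le_trans (Fb _)).
  - exact: cvg_cst.
  - by rewrite -[X in _ --> X](mulr0 D); apply: cvgM => //; exact: cvg_cst.
apply: (@integral_derive_eq0 F f) => //; [|exact: cv|exact: cv].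
apply: (@le_integrable _ _ _ mu _ _ _ (fun x => (D * normal_pdf m (2 * s) x)%:E)) => //.
- by apply/measurable_EFinP; exact: continuous_measurable_fun.
- move=> x _; rewrite /= lee_fin (le_trans (fb x))// (le_trans (b x))//.
  exact: ler_norm.
- under eq_fun do rewrite EFinM.
  by apply: integrableZl => //; exact: integrable_normal_pdf.
Qed.

Lemma is_derive_normal_pdf m s x : s != 0 ->
  is_derive x 1 (normal_pdf m s) (- ((x - m) / s ^+ 2) * normal_pdf m s x).
Proof.
move=> s0; rewrite normal_pdfE//.
have -> : (fun y => normal_peak s * normal_fun m s y) =
   (fun y => normal_peak s * expR ((fun y => - (y - m) ^+ 2 / (s ^+ 2 *+ 2)) y)) by [].
apply: is_derive_eq.
by rewrite /GRing.scale/= /normal_fun; field.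
Qed.

Lemma continuous_mul_normal_pdf m s (f : R -> R) : s != 0 -> continuous f ->
  continuous (fun x => f x * normal_pdf m s x).
Proof. by move=> s0 cf x; apply: cvgM; [exact: cf|exact: continuous_normal_pdf]. Qed.

Lemma integrable_mul_normal_pdf m s C (f : R -> R) : s != 0 ->
  measurable_fun setT f -> (forall x, `|f x| <= C * (1 + (x - m) ^+ 2)) ->
  mu.-integrable setT (fun x => (f x * normal_pdf m s x)%:E).
Proof.
move=> s0 mf fb; have s20 : 2 * s != 0 by rewrite mulf_neq0.
have C0 : 0 <= C.
  have := fb m; rewrite subrr expr0n addr0 mulr1.
  exact: le_trans.
pose D := C * (2 + 16 * s ^+ 2).
apply: (@le_integrable _ _ _ mu _ _ _ (fun x => (D * normal_pdf m (2 * s) x)%:E)) => //.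
- by apply/measurable_EFinP; apply: measurable_funM => //; exact: measurable_normal_pdf.
- move=> x _; rewrite /= lee_fin normrM (ger0_norm (normal_pdf_ge0 _ _ _)).
  apply: le_trans (ler_norm _).
  apply: (@le_trans _ _ (C * (1 + (x - m) ^+ 2) * normal_pdf m s x)).
    by rewrite ler_wpM2r// normal_pdf_ge0.
  by rewrite /D -!mulrA ler_wpM2l// normal_pdf_double.
- under eq_fun do rewrite EFinM.
  by apply: integrableZl => //; exact: integrable_normal_pdf.
Qed.

Let ler_norm_1sqr (y : R) : `|y| <= 1 + y ^+ 2.
Proof. by have := sqr_ge0 (y - 1); have := sqr_ge0 (y + 1); rewrite ler_norml; lra. Qed.

Lemma integral_normal_mean m s : s != 0 -> \int[mu]_x ((x - m) * normal_pdf m s x) = 0.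
Proof.
move=> s0.
have s2 : 0 < s ^+ 2 by rewrite exprn_even_gt0.
have cid : continuous (fun x => x - m) by move=> x; apply: cvgB; [exact: cvg_id|exact: cvg_cst].
have p0 x := normal_pdf_ge0 m s x.
apply: (@integral_derive_normal m s (1 + s ^+ 2) (fun x => - s ^+ 2 * normal_pdf m s x) (fun x => (x - m) * normal_pdf m s x)).
- exact: s0.
- move=> x; have := is_derive_normal_pdf m x s0 => ?.
  by apply: is_derive_eq; rewrite /GRing.scale/=; field.
- exact: continuous_mul_normal_pdf.
- move=> x; rewrite normrM (ger0_norm (p0 x)) mulrA ler_wpM2r//.
  rewrite normrN ger0_norm ?(ltW s2)//.
  by have := mulr_ge0 (ltW s2) (sqr_ge0 (x - m)); have := sqr_ge0 (x - m); nra.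
- move=> x; rewrite normrM (ger0_norm (p0 x)) mulrA ler_wpM2r//.
  apply: (le_trans (ler_norm_1sqr (x - m))).
  by rewrite ler_peMl ?addr_ge0 ?sqr_ge0// lerDl ltW.
Qed.

Lemma integral_normal_var m s : s != 0 ->
  \int[mu]_x ((x - m) ^+ 2 * normal_pdf m s x) = s ^+ 2.
Proof.
move=> s0.
have s2 : 0 < s ^+ 2 by rewrite exprn_even_gt0.
have cid : continuous (fun x => x - m) by move=> x; apply: cvgB; [exact: cvg_id|exact: cvg_cst].
have p0 x := normal_pdf_ge0 m s x.
have msq : measurable_fun setT (fun x : R => (x - m) ^+ 2).
  by apply: measurable_funX; exact: measurable_funB.
have I0 : \int[mu]_x ((s ^+ 2 - (x - m) ^+ 2) * normal_pdf m s x) = 0.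
  apply: (@integral_derive_normal m s (1 + s ^+ 2) (fun x => s ^+ 2 * ((x - m) * normal_pdf m s x)) (fun x => (s ^+ 2 - (x - m) ^+ 2) * normal_pdf m s x)).
  - exact: s0.
  - move=> x; have := is_derive_normal_pdf m x s0 => ?.
    by apply: is_derive_eq; rewrite /GRing.scale/=; field.
  - apply: continuous_mul_normal_pdf => // x; apply: cvgB; first exact: cvg_cst.
    under eq_fun do rewrite expr2; rewrite expr2.
    by apply: cvgM; exact: cid.
  - move=> x; rewrite normrM (ger0_norm (ltW s2)) normrM (ger0_norm (p0 x)) mulrA [leRHS]mulrA ler_wpM2r//.
    by apply: ler_pM => //; lra.
  - move=> x; rewrite normrM (ger0_norm (p0 x)) mulrA ler_wpM2r//.
    have := mulr_ge0 (ltW s2) (sqr_ge0 (x - m)); have := sqr_ge0 (x - m).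
    by move: s2; move: (s ^+ 2) ((x - m) ^+ 2) => a b; rewrite ler_norml; lra.
move: I0; under eq_Rintegral do rewrite mulrBl.
rewrite RintegralB//=; last 2 first.
- apply: (@integrable_mul_normal_pdf m s (s ^+ 2)) => // x.
  by rewrite ger0_norm ?(ltW s2)// ler_peMr ?(ltW s2)// lerDl sqr_ge0.
- apply: (@integrable_mul_normal_pdf m s 1) => // x.
  by rewrite ger0_norm ?sqr_ge0// mul1r lerDr.
rewrite RintegralZl//; last exact: integrable_normal_pdf.
rewrite {1}/Rintegral integral_normal_pdf/= mulr1 => /eqP.
by rewrite subr_eq0 => /eqP.
Qed.

(** As a function of [u], the left side solves the differential equation
   [G' = - s^2 u G], by differentiation under the integral and an integration
   by parts. *)
Lemma integral_normal_cos s th u : s != 0 ->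
  \int[mu]_x (cos (u * x + th) * normal_pdf 0 s x) = cos th * expR (- (u * s) ^+ 2 / 2).
Proof.
move=> s0.
have s2 : 0 < s ^+ 2 by rewrite exprn_even_gt0.
have p0 x := normal_pdf_ge0 0 s x.
have caff v : continuous (fun x : R => v * x + th).
  move=> x; apply: cvgD; last exact: cvg_cst.
  by apply: cvgM; [exact: cvg_cst|exact: cvg_id].
have ccos v : continuous (fun x : R => cos (v * x + th)).
  by move=> x; apply: (cvg_comp (fun x => v * x + th) cos); [exact: caff|exact: continuous_cos].
have csin v : continuous (fun x : R => sin (v * x + th)).
  by move=> x; apply: (cvg_comp (fun x => v * x + th) sin); [exact: caff|exact: continuous_sin].
have cosb v : `|cos v| <= 1 :> R by rewrite ler_norml cos_geN1 cos_le1.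
have sinb v : `|sin v| <= 1 :> R by rewrite ler_norml sin_geN1 sin_le1.
have icos v : mu.-integrable setT (fun x => (cos (v * x + th) * normal_pdf 0 s x)%:E).
  apply: (@integrable_mul_normal_pdf 0 s 1) => //.
    exact: continuous_measurable_fun.
  by move=> x; rewrite (le_trans (cosb _))// mul1r lerDl sqr_ge0.
have isin v : mu.-integrable setT (fun x => (x * sin (v * x + th) * normal_pdf 0 s x)%:E).
  apply: (@integrable_mul_normal_pdf 0 s 1) => //.
    by apply: measurable_funM => //; exact: continuous_measurable_fun.
  move=> x; rewrite normrM mul1r subr0 (le_trans _ (ler_norm_1sqr x))//.
  by rewrite ler_piMr.
pose G v := \int[mu]_x (cos (v * x + th) * normal_pdf 0 s x).
pose f v x := cos (v * x + th) * normal_pdf 0 s x.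
have df (v x : R) : is_derive v 1 (fun v => f v x) (- x * sin (v * x + th) * normal_pdf 0 s x).
  rewrite /f; apply: is_derive_eq; rewrite /GRing.scale/=; ring.
have p1 v x : partial1of2 f v x = - x * sin (v * x + th) * normal_pdf 0 s x.
  by rewrite partial1of2E; apply: derive_val.
have Gder (v : R) : is_derive v 1 G (- \int[mu]_x (x * sin (v * x + th) * normal_pdf 0 s x)).
  have iG : mu.-integrable setT (EFin \o (fun x => (1 + x ^+ 2) * normal_pdf 0 s x)).
    apply: (@integrable_mul_normal_pdf 0 s 1) => //.
    + by apply: measurable_funD => //; exact: measurable_funX.
    + by move=> x; rewrite subr0 mul1r ger0_norm// addr_ge0 ?sqr_ge0.
  have G0 x : 0 <= (1 + x ^+ 2) * normal_pdf 0 s x.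
    by rewrite mulr_ge0// addr_ge0// sqr_ge0.
  have iv : `]v - 1, v + 1[%classic v by rewrite /= in_itv/=; apply/andP; split; lra.
  have Gub (x y : R) : `]v - 1, v + 1[%classic x -> setT y -> `|partial1of2 f x y| <= (1 + y ^+ 2) * normal_pdf 0 s y.
    move=> _ _; rewrite p1 normrM (ger0_norm (p0 y)) ler_wpM2r// normrM normrN.
    by rewrite (le_trans _ (ler_norm_1sqr y))// ler_piMr.
  have dd (x y : R) : `]v - 1, v + 1[%classic x -> setT y -> derivable (f ^~ y) x 1.
    by move=> _ _; case: (df x y).
  apply: DeriveDef.
    exact: (@derivable_under_integral R _ _ mu f setT measurableT v (v - 1) (v + 1) iv (fun x _ => icos x) dd _ G0 iG Gub).
  rewrite -derive1E.
  rewrite (@differentiation_under_integral R _ _ mu f setT measurableT v (v - 1) (v + 1) iv (fun x _ => icos x) dd _ G0 iG Gub).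
  transitivity (\int[mu]_x (-1 * (x * sin (v * x + th) * normal_pdf 0 s x))).
    by apply: eq_Rintegral => x _; rewrite p1; ring.
  exact: etrans (RintegralZl (-1) measurableT (isin v)) (mulN1r _).
have ode v : \int[mu]_x (x * sin (v * x + th) * normal_pdf 0 s x) = v * s ^+ 2 * G v.
  have I0 : \int[mu]_x ((v * s ^+ 2 * cos (v * x + th) - x * sin (v * x + th)) * normal_pdf 0 s x) = 0.
    apply: (@integral_derive_normal 0 s (1 + s ^+ 2 + `|v| * s ^+ 2) (fun x => s ^+ 2 * (sin (v * x + th) * normal_pdf 0 s x))
      (fun x => (v * s ^+ 2 * cos (v * x + th) - x * sin (v * x + th)) * normal_pdf 0 s x)).
    - exact: s0.
    - move=> x; have := is_derive_normal_pdf 0 x s0 => ?.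
      by apply: is_derive_eq; rewrite /GRing.scale/=; field.
    - apply: continuous_mul_normal_pdf => // x; apply: cvgB.
        by apply: cvgM; [exact: cvg_cst|exact: ccos].
      by apply: cvgM; [exact: cvg_id|exact: csin].
    - move=> x; rewrite normrM (ger0_norm (ltW s2)) normrM (ger0_norm (p0 x)) mulrA [leRHS]mulrA ler_wpM2r//.
      have vs := mulr_ge0 (normr_ge0 v) (ltW s2).
      apply: ler_pM => //; [lra|lra|].
      by rewrite (le_trans (sinb _))// lerDl sqr_ge0.
    - move=> x; rewrite normrM (ger0_norm (p0 x)) mulrA ler_wpM2r//.
      rewrite (le_trans (ler_normB _ _))// normrM normrM (ger0_norm (ltW s2)) normrM subr0.
      have vs := mulr_ge0 (normr_ge0 v) (ltW s2).
      have h1 : `|v| * s ^+ 2 * `|cos (v * x + th)| <= `|v| * s ^+ 2 * (1 + x ^+ 2).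
        by rewrite ler_wpM2l// (le_trans (cosb _))// lerDl sqr_ge0.
      have h2 : `|x| * `|sin (v * x + th)| <= 1 + x ^+ 2.
        by rewrite (le_trans _ (ler_norm_1sqr x))// ler_piMr.
      have h3 : 0 <= s ^+ 2 * (1 + x ^+ 2) by rewrite mulr_ge0 ?(ltW s2)// addr_ge0// sqr_ge0.
      by rewrite mulrDl mulrDl mul1r; lra.
  have ic : mu.-integrable setT (fun x => (v * s ^+ 2 * (cos (v * x + th) * normal_pdf 0 s x))%:E).
    by under eq_fun do rewrite EFinM; exact: integrableZl.
  apply/esym/eqP; rewrite -subr_eq0 -{2}I0; apply/eqP.
  transitivity (\int[mu]_x (v * s ^+ 2 * (cos (v * x + th) * normal_pdf 0 s x) -
                            x * sin (v * x + th) * normal_pdf 0 s x)); last first.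
    by apply: eq_Rintegral => x _; ring.
  apply/esym; apply: (etrans (RintegralB measurableT ic (isin v))).
  by congr (_ - _); exact: (RintegralZl _ measurableT (icos v)).
have der (v : R) : is_derive v 1 (fun v => expR ((v * s) ^+ 2 / 2) * G v) 0.
  have := Gder v => ?.
  by apply: is_derive_eq; rewrite ode /GRing.scale/=; field.
have := @is_derive_0_is_cst R _ u 0 der.
rewrite mul0r expr0n/= mul0r expR0 mul1r mulNr expRN.
have -> : G 0 = cos th.
  rewrite /G; under eq_Rintegral do rewrite mul0r add0r.
  rewrite RintegralZl//; last exact: integrable_normal_pdf.
  by rewrite /Rintegral integral_normal_pdf/= mulr1.
by move=> <-; rewrite mulrC mulKf// gt_eqF ?expR_gt0.
Qed.

End gaussian_integrals.

(** * Centered Gaussian variables *)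

Lemma measurable_cosR (R : realType) : measurable_fun setT (@cos R).
Proof. by apply: continuous_measurable_fun; exact: continuous_cos. Qed.

Section norm_events.
Context {R : realType} d (T : measurableType d) (g : T -> R) (r : R).
Hypothesis mg : measurable_fun setT g.

Let mng : measurable_fun setT (fun w => `|g w|).
Proof. exact: (measurableT_comp (@normr_measurable _ setT)). Qed.

Lemma measurable_norm_le : measurable [set w | `|g w| <= r].
Proof.
rewrite (_ : [set w | _] = (fun w => `|g w|) @^-1` `]-oo, r]).
  by rewrite -[X in measurable X]setTI; exact: mng.
by apply/seteqP; split=> w /=; rewrite in_itv.
Qed.

Lemma measurable_norm_lt : measurable [set w | `|g w| < r].
Proof.
rewrite (_ : [set w | _] = (fun w => `|g w|) @^-1` `]-oo, r[).
  by rewrite -[X in measurable X]setTI; exact: mng.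
by apply/seteqP; split=> w /=; rewrite in_itv.
Qed.

Lemma measurable_norm_ge : measurable [set w | r <= `|g w|].
Proof.
rewrite (_ : [set w | _] = (fun w => `|g w|) @^-1` `[r, +oo[).
  by rewrite -[X in measurable X]setTI; exact: mng.
by apply/seteqP; split=> w /=; rewrite in_itv/= andbT.
Qed.

End norm_events.

Section transfer.
Context {R : realType}.
Notation mu := (@lebesgue_measure R).

Lemma ge0_integral_normal_prob (m s : R) (f : R -> \bar R) :
  measurable_fun setT f -> (forall x, 0 <= f x)%E ->
  (\int[normal_prob m s]_x f x = \int[mu]_x (f x * (normal_pdf m s x)%:E))%E.
Proof.
move=> mf f0; have dom := @normal_prob_dominates R m s.
rewrite -(Radon_Nikodym_SigmaFinite.change_of_variables dom)//.
have mRN : measurable_fun setT (Radon_Nikodym_SigmaFinite.f (normal_prob m s) mu).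
  exact: measurable_int (Radon_Nikodym_SigmaFinite.f_integrable dom).
have mpdf : measurable_fun setT (fun x => (normal_pdf m s x)%:E).
  exact: measurable_int (integrable_normal_pdf m s).
apply: ge0_ae_eq_integral => //.
- exact: emeasurable_funM.
- exact: emeasurable_funM.
- by move=> x _; rewrite mule_ge0 ?Radon_Nikodym_SigmaFinite.f_ge0.
- by move=> x _; rewrite mule_ge0 ?lee_fin ?normal_pdf_ge0.
- apply: ae_eqe_mul2l; apply: integral_ae_eq => //.
  + exact: Radon_Nikodym_SigmaFinite.f_integrable.
  + by move=> E _ mE; rewrite -Radon_Nikodym_SigmaFinite.f_integral.
Qed.

Lemma integral_normal_prob (m s : R) (f : R -> \bar R) :
  measurable_fun setT f ->
  (\int[normal_prob m s]_x f x = \int[mu]_x (f x * (normal_pdf m s x)%:E))%E.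
Proof.
move=> mf; rewrite [LHS]integralE [RHS]integralE; congr (_ - _)%E.
- rewrite ge0_integral_normal_prob//; last exact: measurable_funepos.
  by apply: eq_integral => x _; rewrite !funeposE maxe_pMl ?mul0e// lee_fin normal_pdf_ge0.
- rewrite ge0_integral_normal_prob//; last exact: measurable_funeneg.
  by apply: eq_integral => x _; rewrite !funenegE maxe_pMl ?mul0e ?muleN ?mulNe// lee_fin normal_pdf_ge0.
Qed.

Context d (T : measurableType d) (P : probability T R).

(** The change of variables along [U] is stated for an arbitrary measure [nu]
   that agrees with the law of [U], so that Dirac and normal laws are covered. *)
Lemma integral_same_law d' (T' : measurableType d') (nu : {measure set T' -> \bar R})
  (U : T -> T') (f : T' -> \bar R) :
  measurable_fun setT U ->
  (forall A, measurable A -> P (U @^-1` A) = nu A) ->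
  measurable_fun setT f ->
  (\int[P]_w f (U w) = \int[nu]_x f x)%E.
Proof.
move=> mU law mf.
have ge0 (g : T' -> \bar R) : measurable_fun setT g -> (forall x, 0 <= g x)%E ->
    (\int[P]_w g (U w) = \int[nu]_x g x)%E.
  move=> mg g0; rewrite -[LHS](ge0_integral_pushforward mU P measurableT mg)//.
  by apply: eq_measure_integral => A mA _; exact: law.
rewrite [LHS]integralE [RHS]integralE; congr (_ - _)%E.
- rewrite -ge0//; first by apply: eq_integral => w _; rewrite !funeposE.
  exact: measurable_funepos.
- rewrite -ge0//; first by apply: eq_integral => w _; rewrite !funenegE.
  exact: measurable_funeneg.
Qed.

End transfer.

Section bounded_integrals.
Context {R : realType} d (T : measurableType d) (P : probability T R).

Lemma integrable_bounded (f : T -> R) (M : R) : measurable_fun setT f ->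
  (forall x, `|f x| <= M) -> P.-integrable setT (EFin \o f).
Proof.
move=> mf fM.
apply: (@le_integrable _ _ _ P _ _ _ (EFin \o cst M)) => //.
- exact/measurable_EFinP.
- by move=> x _ /=; rewrite lee_fin (le_trans (fM x))// ler_norm.
- exact: finite_measure_integrable_cst.
Qed.

Lemma EFin_Rintegral (f : T -> R) : P.-integrable setT (EFin \o f) ->
  (\int[P]_x f x)%:E = (\int[P]_x (f x)%:E)%E.
Proof. by move=> fi; rewrite /Rintegral fineK// integrable_fin_num. Qed.

End bounded_integrals.

Lemma bounded_Fubini (R : realType) d1 d2 (T1 : measurableType d1) (T2 : measurableType d2)
  (P1 : probability T1 R) (P2 : probability T2 R) (f : T1 * T2 -> R) (M : R) :
  measurable_fun setT f -> (forall z, `|f z| <= M) ->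
  \int[P1]_x (\int[P2]_y f (x, y)) = \int[P2]_y (\int[P1]_x f (x, y)).
Proof.
move=> mf fM.
have fi : (P1 \x P2)%E.-integrable setT (EFin \o f).
  exact: (@integrable_bounded _ _ _ (P1 \x P2)%E _ M).
have m1 x : measurable_fun setT (fun y => f (x, y)) by apply: (measurableT_comp mf).
have m2 y : measurable_fun setT (fun x => f (x, y)) by apply: (measurableT_comp mf).
rewrite {1}/Rintegral [in RHS]/Rintegral; congr fine.
transitivity (\int[P1]_x \int[P2]_y (EFin \o f) (x, y))%E.
  by apply: eq_integral => x _; rewrite EFin_Rintegral//; exact: (integrable_bounded P2 (m1 x)).
rewrite (Fubini fi); apply: eq_integral => y _.
by rewrite -EFin_Rintegral//; exact: (integrable_bounded P1 (m2 y)).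
Qed.

Section centered_gaussian.
Context {R : realType} d (T : measurableType d) (P : probability T R).
Notation mu := (@lebesgue_measure R).

Definition centered_gaussian (U : T -> R) (v : R) : Prop :=
  [/\ measurable_fun setT U, 0 <= v &
      forall A, measurable A -> P (U @^-1` A) = gaussian_law 0 (Num.sqrt v) A].

Lemma normal_pdf_norm (m s : R) : normal_pdf m `|s| = normal_pdf m s.
Proof.
apply/funext => x; rewrite /normal_pdf normr_eq0 /normal_peak /normal_fun.
by rewrite real_normK ?num_real.
Qed.

Lemma gaussian_law_norm (m s : R) A : gaussian_law m `|s| A = gaussian_law m s A.
Proof. by rewrite /gaussian_law normr_eq0 /normal_prob normal_pdf_norm. Qed.

(** A Gaussian law is determined by its first two moments. *)
Lemma centered_gaussianP (U : T -> R) (m s v : R) : measurable_fun setT U ->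
  (forall A, measurable A -> P (U @^-1` A) = gaussian_law m s A) ->
  (\int[P]_w (U w)%:E = 0)%E -> (\int[P]_w (U w ^+ 2)%:E = v%:E)%E ->
  centered_gaussian U v.
Proof.
move=> mU law EU EU2.
have mid : measurable_fun setT (fun x : R => x%:E) by exact/measurable_EFinP.
have msq : measurable_fun setT (fun x : R => (x ^+ 2)%:E).
  by apply/measurable_EFinP; exact: measurable_funX.
suff [m0 v0] : m = 0 /\ v = s ^+ 2.
  split; first exact: mU.
    by rewrite v0 sqr_ge0.
  move=> A mA.
  rewrite (law A mA).
  rewrite m0.
  rewrite v0.
  rewrite sqrtr_sqr.
  rewrite gaussian_law_norm.
  reflexivity.
have [s0|s0] := eqVneq s 0.
  have ld A : measurable A -> P (U @^-1` A) = \d_m A.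
    by move=> mA; rewrite law// /gaussian_law s0 eqxx.
  move: EU EU2; rewrite (integral_same_law (nu := \d_m) mU ld mid) (integral_same_law (nu := \d_m) mU ld msq).
  rewrite !integral_dirac//= !diracT !mul1e => -[m0] -[<-].
  by rewrite m0 s0 expr0n.
have ld A : measurable A -> P (U @^-1` A) = normal_prob m s A.
  by move=> mA; rewrite law// /gaussian_law (negbTE s0).
move: EU EU2; rewrite (integral_same_law (nu := normal_prob m s) mU ld mid) (integral_same_law (nu := normal_prob m s) mU ld msq).
rewrite !integral_normal_prob//.
have i1 : mu.-integrable setT (fun x => ((x - m) * normal_pdf m s x)%:E).
  apply: (@integrable_mul_normal_pdf _ m s 1) => //; first exact: measurable_funB.
  move=> x; have := sqr_ge0 (x - m - 1); have := sqr_ge0 (x - m + 1).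
  by rewrite mul1r ler_norml; lra.
have i2 : mu.-integrable setT (fun x => ((x - m) ^+ 2 * normal_pdf m s x)%:E).
  apply: (@integrable_mul_normal_pdf _ m s 1) => //.
    by apply: measurable_funX; exact: measurable_funB.
  by move=> x; rewrite mul1r ger0_norm ?sqr_ge0// lerDr.
have i0 : mu.-integrable setT (fun x => (m * normal_pdf m s x)%:E).
  under eq_fun do rewrite EFinM.
  by apply: integrableZl => //; exact: integrable_normal_pdf.
have I1 : (\int[mu]_x ((x - m) * normal_pdf m s x)%:E = 0)%E.
  rewrite -[LHS]fineK ?integrable_fin_num//; congr (_%:E).
  exact: integral_normal_mean.
have I2 : (\int[mu]_x ((x - m) ^+ 2 * normal_pdf m s x)%:E = (s ^+ 2)%:E)%E.
  rewrite -[LHS]fineK ?integrable_fin_num//; congr (_%:E).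
  exact: integral_normal_var.
have -> : (\int[mu]_x (x%:E * (normal_pdf m s x)%:E) = m%:E)%E.
  transitivity (\int[mu]_x (((x - m) * normal_pdf m s x)%:E + (m * normal_pdf m s x)%:E))%E.
    by apply: eq_integral => x _; rewrite -EFinM -EFinD; congr EFin; ring.
  rewrite integralD// I1 add0e.
  under eq_integral do rewrite EFinM.
  by rewrite integralZl ?integral_normal_pdf ?mule1//; exact: integrable_normal_pdf.
move=> [m0] EU2; split=> //.
apply: EFin_inj; rewrite -I2 -EU2; apply: eq_integral => x _.
by rewrite m0 subr0 EFinM.
Qed.

Lemma centered_gaussian_cos (U : T -> R) v (u th : R) : centered_gaussian U v ->
  \int[P]_w cos (u * U w + th) = cos th * expR (- (u ^+ 2 * v) / 2).
Proof.
move=> [mU v0 law].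
have mc : measurable_fun setT (fun x : R => (cos (u * x + th))%:E).
  apply/measurable_EFinP; apply: (measurableT_comp (@measurable_cosR R)).
  by apply: measurable_funD => //; exact: measurable_funM.
rewrite /Rintegral; have [sv|sv] := eqVneq (Num.sqrt v) 0.
  have ld A : measurable A -> P (U @^-1` A) = \d_(0:R) A.
    by move=> mA; rewrite law// /gaussian_law sv eqxx.
  have ve : v = 0.
    by apply/eqP; rewrite eq_le v0 andbT -sqrtr_eq0; apply/eqP.
  rewrite (integral_same_law (nu := \d_(0:R)) mU ld mc) integral_dirac//=.
  rewrite indicT mul1r.
  by rewrite ve !mulr0 oppr0 mul0r expR0 mulr1 add0r.
have ld A : measurable A -> P (U @^-1` A) = normal_prob 0 (Num.sqrt v) A.
  by move=> mA; rewrite law// /gaussian_law (negbTE sv).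
rewrite (integral_same_law (nu := normal_prob 0 (Num.sqrt v)) mU ld mc).
rewrite integral_normal_prob//.
by have := integral_normal_cos th u sv; rewrite exprMn sqr_sqrtr// => <-.
Qed.

(** The density is bounded below on [[- Z - 1, Z + 1]], uniformly in variances
   between [v0] and [1]. *)
Lemma centered_gaussian_interval (v0 Z : R) : 0 < v0 -> 0 <= Z ->
  exists2 c : R, 0 < c & forall (U : T -> R) (v z e : R),
    centered_gaussian U v -> v0 <= v <= 1 -> `|z| <= Z -> 0 < e <= 1 ->
    ((c * e)%:E <= P [set w | (`|U w - z| <= e)%R])%E.
Proof.
move=> v00 Z0.
pose c := normal_peak 1 * expR (- (Z + 1) ^+ 2 / (v0 *+ 2)) :> R.
have c0 : 0 < c by rewrite mulr_gt0 ?expR_gt0// normal_peak_gt0// oner_neq0.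
exists c => // U v z e [mU _ law] /andP[v0v v1] zZ /andP[e0 e1].
have vp : 0 < v by exact: lt_le_trans v0v.
have sv : Num.sqrt v != 0 by rewrite gt_eqF// sqrtr_gt0.
have -> : [set w | `|U w - z| <= e] = U @^-1` `[z - e, z + e].
  by apply/seteqP; split=> w /=; rewrite in_itv/= ler_distl.
rewrite law// /gaussian_law (negbTE sv) /normal_prob.
set I := [set` _].
apply: (@le_trans _ _ (\int[mu]_(x in I) (c%:E))%E); rewrite {}/I.
  rewrite integral_cst//= lebesgue_measure_itv/= lte_fin.
  have -> : z - e < z + e by lra.
  rewrite -EFinD -EFinM lee_fin ler_wpM2l ?(ltW c0)//; lra.
apply: ge0_le_integral => //.
- by move=> x _; rewrite lee_fin ltW.
- by apply: measurable_funTS; exact: measurable_int (integrable_normal_pdf 0 (Num.sqrt v)).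
move=> x /=; rewrite in_itv/= => /andP[x1 x2]; rewrite lee_fin normal_pdfE//.
rewrite /c ler_pM ?expR_ge0 ?normal_peak_ge0//.
  rewrite /normal_peak lef_pV2 ?posrE ?sqrtr_gt0 ?mulrn_wgt0 ?mulr_gt0 ?pi_gt0 ?exprn_gt0 ?sqrtr_gt0//.
  by rewrite ler_sqrt ?mulrn_wge0 ?mulr_ge0 ?pi_ge0// lerMn2r/= ler_wpM2r ?pi_ge0// sqr_sqrtr ?(ltW vp)// expr1n.
rewrite /normal_fun ler_expR subr0 sqr_sqrtr ?(ltW vp)// !mulNr lerN2.
rewrite ler_pM ?sqr_ge0// ?invr_ge0 ?mulrn_wge0 ?(ltW vp)//.
  rewrite -(real_normK (num_real x)) lerXn2r ?nnegrE ?addr_ge0//.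
  by move: zZ; rewrite !ler_norml => /andP[? ?]; apply/andP; split; lra.
by rewrite lef_pV2 ?posrE ?mulrn_wgt0// lerMn2r.
Qed.

(** [y^m <= m! exp y] with [y = x^2 / (3 v)], and [exp y] times the density is
   at most twice the density of the doubled standard deviation. *)
Lemma centered_gaussian_moment (U : T -> R) v m : centered_gaussian U v -> 0 < v ->
  (\int[P]_w (U w ^+ 2) ^+ m <= 2 * m`!%:R * (3 * v) ^+ m) /\
  P.-integrable setT (fun w => ((U w ^+ 2) ^+ m)%:E).
Proof.
move=> [mU _ law] v0.
have s0 : 0 < Num.sqrt v by rewrite sqrtr_gt0.
have sv : Num.sqrt v != 0 by rewrite gt_eqF.
set s := Num.sqrt v in s0 sv law *.
have s2 : s ^+ 2 = v by rewrite sqr_sqrtr// ltW.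
have s20 : 2 * s != 0 by rewrite mulf_neq0.
have ld A : measurable A -> P (U @^-1` A) = normal_prob 0 s A.
  by move=> mA; rewrite law// /gaussian_law (negbTE sv).
have mc : measurable_fun setT (fun x : R => ((x ^+ 2) ^+ m)%:E).
  by apply/measurable_EFinP; do 2 apply: measurable_funX.
have nn (x : R) : 0 <= (x ^+ 2) ^+ m by rewrite exprn_ge0// sqr_ge0.
have I : (\int[P]_w ((U w ^+ 2) ^+ m)%:E <= (2 * m`!%:R * (3 * v) ^+ m)%:E)%E.
  rewrite (integral_same_law (nu := normal_prob 0 s) mU ld mc).
  rewrite ge0_integral_normal_prob//.
  have c0 : 0 <= 2 * m`!%:R * (3 * v) ^+ m :> R.
    by rewrite mulr_ge0 ?exprn_ge0 ?mulr_ge0// ltW.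
  apply: (@le_trans _ _ (\int[mu]_x ((2 * m`!%:R * (3 * v) ^+ m)%:E * (normal_pdf 0 (2 * s) x)%:E))%E); last first.
    rewrite ge0_integralZl//.
    - by rewrite integral_normal_pdf mule1.
    - exact: measurable_int (integrable_normal_pdf 0 (2 * s)).
    - by move=> x _; rewrite lee_fin normal_pdf_ge0.
  apply: ge0_le_integral => //.
  - by move=> x _; rewrite mule_ge0 ?lee_fin ?normal_pdf_ge0.
  - by apply: emeasurable_funM => //; exact: measurable_int (integrable_normal_pdf 0 s).
  - by apply: emeasurable_funM => //; exact: measurable_int (integrable_normal_pdf 0 (2 * s)).
  move=> x _; rewrite -!EFinM lee_fin !normal_pdfE// (normal_peak_double sv).
  pose y := x ^+ 2 / (3 * v).
  have y0 : 0 <= y by rewrite divr_ge0 ?sqr_ge0// mulr_ge0// ltW.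
  have -> : (x ^+ 2) ^+ m = (3 * v) ^+ m * y ^+ m.
    by rewrite -exprMn; congr (_ ^+ _); rewrite /y; field; rewrite gt_eqF.
  have ym : y ^+ m <= m`!%:R * expR y.
    case: m {mc nn c0} => [|m].
      by rewrite expr0 mul1r -[leLHS]addr0 (le_trans _ (expR_ge1Dx y))// lerD2l.
    rewrite mulrC -ler_pdivrMr ?ltr0n ?fact_gt0//.
    by apply: le_trans (expR_ge1Dxn m y0); rewrite lerDr.
  have yn : expR y * normal_fun 0 s x <= normal_fun 0 (2 * s) x.
    rewrite /normal_fun -expRD ler_expR subr0 exprMn s2 /y.
    have -> : - x ^+ 2 / (2 ^+ 2 * v *+ 2) = (- (1/8) * (x ^+ 2 / v)) by field; rewrite gt_eqF.
    have -> : x ^+ 2 / (3 * v) + - x ^+ 2 / (v *+ 2) = (- (1/6) * (x ^+ 2 / v)) by field; rewrite gt_eqF.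
    by rewrite ler_wpM2r ?divr_ge0 ?sqr_ge0 ?(ltW v0)//; lra.
  have p0 := normal_peak_ge0 (2 * s).
  have := ler_wpM2l (normal_peak_ge0 (2 * s)) (ler_wpM2l (ler0n R m`!) yn).
  have := ler_wpM2r (normal_fun_ge0 0 s x) ym.
  move=> /(ler_wpM2l (normal_peak_ge0 (2 * s))) h1 h2.
  have h3 := le_trans h1; have {h1 h2 h3} := le_trans h1 (le_trans _ h2).
  rewrite -!mulrA => /(_ (lexx _)) h.
  have c3 : 0 <= 2 * (3 * v) ^+ m by rewrite mulr_ge0// exprn_ge0// mulr_ge0// ltW.
  by have := ler_wpM2l c3 h; lra.
have mi : measurable_fun setT (fun w => ((U w ^+ 2) ^+ m)%:E).
  by apply/measurable_EFinP; do 2 apply: measurable_funX.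
have fi : P.-integrable setT (fun w => ((U w ^+ 2) ^+ m)%:E).
  apply/integrableP; split => //.
  under eq_integral do rewrite gee0_abs ?lee_fin//.
  exact: le_lt_trans I (ltry _).
split => //.
by rewrite -lee_fin EFin_Rintegral.
Qed.

End centered_gaussian.

(** * Uncorrelated Gaussian pairs *)

Section gaussian_bump.
Context {R : realType}.
Notation mu := (@lebesgue_measure R).

(** Smooth substitute for the indicator function of an interval of radius
   [c^(-1/2)]. *)
Definition bump (c x : R) : R := expR (- (c * x ^+ 2) / 2).

Lemma bump_gt0 c x : 0 < bump c x. Proof. exact: expR_gt0. Qed.

Lemma bump_le1 c x : 0 <= c -> bump c x <= 1.
Proof.
by move=> c0; rewrite -expR0 ler_expR mulNr oppr_le0 divr_ge0// mulr_ge0 ?sqr_ge0.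
Qed.

Lemma bump0 x : bump 0 x = 1.
Proof. by rewrite /bump mul0r oppr0 mul0r expR0. Qed.

Lemma bumpM c c' x : bump c x * bump c' x = bump (c + c') x.
Proof. by rewrite /bump -expRD; congr expR; field. Qed.

Lemma measurable_bump c : measurable_fun setT (bump c).
Proof.
apply: measurableT_comp => //; apply: measurable_funM => //.
by apply: measurableT_comp => //; apply: measurable_funM => //; exact: measurable_funX.
Qed.

(** The expectation of [bump c (U - a)] for a centered Gaussian [U] of
   variance [p]. *)
Definition bump_mean (p c a : R) : R :=
  (Num.sqrt (1 + p * c))^-1 * bump (c / (1 + p * c)) a.

Lemma Rintegral_normal_prob (m s : R) (f : R -> R) : measurable_fun setT f ->
  \int[normal_prob m s]_x f x = \int[mu]_x (f x * normal_pdf m s x).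
Proof. by move=> mf; rewrite /Rintegral integral_normal_prob//; exact/measurable_EFinP. Qed.

Lemma integral_normal_prob_cos (s u th : R) : s != 0 ->
  \int[normal_prob 0 s]_v cos (u * v + th) = cos th * expR (- (u * s) ^+ 2 / 2).
Proof.
move=> s0; rewrite -integral_normal_cos// Rintegral_normal_prob//.
apply: (measurableT_comp (@measurable_cosR R)).
by apply: measurable_funD => //; exact: measurable_funM.
Qed.

(** A bump is the characteristic function of a Gaussian, which turns
   expectations of bumps into integrals of characteristic functions. *)
Lemma bump_cosE c x : 0 < c ->
  bump c x = \int[normal_prob 0 (Num.sqrt c)]_v cos (v * x).
Proof.
move=> c0; have s0 : Num.sqrt c != 0 by rewrite gt_eqF// sqrtr_gt0.
have := integral_normal_prob_cos x 0 s0.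
rewrite cos0 mul1r exprMn sqr_sqrtr ?(ltW c0)// /bump [c * _]mulrC => <-.
by apply: eq_Rintegral => v _; rewrite addr0 mulrC.
Qed.

Lemma bump_meanE p c a : 0 <= p -> 0 < c ->
  \int[normal_prob 0 (Num.sqrt c)]_v (cos (v * a) * expR (- (v ^+ 2 * p) / 2)) =
  bump_mean p c a.
Proof.
move=> p0 c0; have s0 : Num.sqrt c != 0 by rewrite gt_eqF// sqrtr_gt0.
have d0 : 0 < 1 + p * c by rewrite ltr_pwDl// mulr_ge0// ltW.
pose t := Num.sqrt (c / (1 + p * c)).
have ct : 0 < c / (1 + p * c) by rewrite divr_gt0.
have t0 : t != 0 by rewrite gt_eqF// sqrtr_gt0.
have t2 : t ^+ 2 = c / (1 + p * c) by rewrite sqr_sqrtr// ltW.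
have pk : normal_peak (Num.sqrt c) = (Num.sqrt (1 + p * c))^-1 * normal_peak t.
  rewrite /normal_peak t2 sqr_sqrtr ?(ltW c0)//.
  have -> : c * pi *+ 2 = (1 + p * c) * (c / (1 + p * c) * pi *+ 2).
    by field; rewrite gt_eqF.
  by rewrite sqrtrM ?(ltW d0)// invfM.
have fn v : normal_fun 0 (Num.sqrt c) v * expR (- (v ^+ 2 * p) / 2) = normal_fun 0 t v.
  rewrite /normal_fun t2 sqr_sqrtr ?(ltW c0)// -expRD subr0; congr expR.
  by field; rewrite !gt_eqF.
rewrite /bump_mean; have := integral_normal_prob_cos a 0 t0.
rewrite cos0 mul1r exprMn t2 /bump [_ / _ * _]mulrC => <-.
have mc : measurable_fun setT (fun v : R => cos (a * v + 0)).
  apply: (measurableT_comp (@measurable_cosR R)).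
  by apply: measurable_funD => //; exact: measurable_funM.
have me : measurable_fun setT (fun v : R => cos (v * a) * expR (- (v ^+ 2 * p) / 2)).
  apply: measurable_funM.
    by apply: (measurableT_comp (@measurable_cosR R)); exact: measurable_funM.
  apply: measurableT_comp => //; apply: measurable_funM => //; apply: measurableT_comp => //.
  by apply: measurable_funM => //; exact: measurable_funX.
have it : mu.-integrable setT (fun v => (cos (a * v + 0) * normal_pdf 0 t v)%:E).
  apply: (@integrable_mul_normal_pdf _ 0 t 1) => // v.
  have b : `|cos (a * v + 0)| <= 1 by rewrite ler_norml cos_geN1 cos_le1.
  by rewrite mul1r (le_trans b)// lerDl sqr_ge0.
rewrite (Rintegral_normal_prob _ _ me) (Rintegral_normal_prob _ _ mc).
apply: esym; apply: (etrans (esym (RintegralZl _ measurableT it))).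
apply: eq_Rintegral => v _; rewrite !normal_pdfE// pk -fn addr0 [a * v]mulrC.
ring.
Qed.

End gaussian_bump.

Section gaussian_pair.
Context {R : realType} d (T : measurableType d) (P : probability T R).

(** Two centered variables with variances [p] and [q] are jointly Gaussian and
   uncorrelated exactly when every linear combination has this characteristic
   function. *)
Definition gaussian_pair (U V : T -> R) (p q : R) : Prop :=
  [/\ measurable_fun setT U, measurable_fun setT V, 0 <= p, 0 <= q &
   forall a b th, \int[P]_w cos (a * U w + b * V w + th) =
     cos th * expR (- (a ^+ 2 * p + b ^+ 2 * q) / 2)].

Lemma gaussian_pairC U V p q : gaussian_pair U V p q -> gaussian_pair V U q p.
Proof.
move=> [mU mV p0 q0 h]; split => // a b th.
rewrite [a ^+ 2 * _ + _]addrC -h; apply: eq_Rintegral => w _.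
by rewrite [b * _ + _]addrC.
Qed.

Let measurable_cosT (g : T -> R) : measurable_fun setT g -> measurable_fun setT (fun w => cos (g w)).
Proof. by move=> mg; exact: (measurableT_comp (@measurable_cosR R)). Qed.

Lemma integral_mul_bump (h U : T -> R) (M c a : R) : 0 < c ->
  measurable_fun setT h -> (forall w, `|h w| <= M) -> measurable_fun setT U ->
  \int[P]_w (h w * bump c (U w - a)) =
  \int[normal_prob 0 (Num.sqrt c)]_v (\int[P]_w (h w * cos (v * (U w - a)))).
Proof.
move=> c0 mh hM mU; pose N := normal_prob 0 (Num.sqrt c).
pose f (z : T * R) := h z.1 * cos (z.2 * (U z.1 - a)).
have mf : measurable_fun setT f.
  apply: measurable_funM; first exact: (measurableT_comp mh).
  apply: (measurableT_comp (@measurable_cosR R)).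
  apply: measurable_funM => //; apply: measurable_funB => //.
  exact: (measurableT_comp mU).
have fM z : `|f z| <= M.
  rewrite normrM -[leRHS]mulr1 ler_pM// ler_norml cos_geN1 cos_le1//.
rewrite -(@bounded_Fubini _ _ _ _ _ P N f M mf fM).
apply: eq_Rintegral => w _; rewrite bump_cosE// /f/= RintegralZl//.
apply: (@integrable_bounded _ _ _ N _ 1).
  by apply: (measurableT_comp (@measurable_cosR R)); exact: measurable_funM.
by move=> v; rewrite ler_norml cos_geN1 cos_le1.
Qed.

Lemma gaussian_pair_cos U V p q (a b u v : R) : gaussian_pair U V p q ->
  \int[P]_w (cos (v * (V w - b)) * cos (u * (U w - a))) =
  cos (u * a) * expR (- (u ^+ 2 * p) / 2) * (cos (v * b) * expR (- (v ^+ 2 * q) / 2)).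
Proof.
move=> [mU mV p0 q0 h].
have H1 := h u v (- (u * a) - v * b).
have H2 := h u (- v) (- (u * a) + v * b).
have ic a' b' th : P.-integrable setT (EFin \o (fun w => cos (a' * U w + b' * V w + th))).
  apply: (@integrable_bounded _ _ _ _ _ 1).
    apply: measurable_cosT; apply: measurable_funD => //.
    by apply: measurable_funD; exact: measurable_funM.
  by move=> w; rewrite ler_norml cos_geN1 cos_le1.
transitivity (\int[P]_w (2^-1 * (cos (u * U w + v * V w + (- (u * a) - v * b)) +
                       cos (u * U w + (- v) * V w + (- (u * a) + v * b))))).
  apply: eq_Rintegral => w _.
  have -> : u * U w + v * V w + (- (u * a) - v * b) = u * (U w - a) + v * (V w - b) by ring.
  have -> : u * U w + - v * V w + (- (u * a) + v * b) = u * (U w - a) - v * (V w - b) by ring.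
  by rewrite cosD cosB; field.
rewrite RintegralZl//; last first.
  by have := integrableD measurableT (ic u v (- (u * a) - v * b)) (ic u (- v) (- (u * a) + v * b)).
rewrite RintegralD// H1 H2 sqrrN.
have -> : - (u * a) - v * b = - (u * a + v * b) by ring.
have -> : - (u * a) + v * b = - (u * a - v * b) by ring.
rewrite !cosN cosD cosB.
have -> : - (u ^+ 2 * p + v ^+ 2 * q) / 2 = - (u ^+ 2 * p) / 2 + - (v ^+ 2 * q) / 2 by field.
by rewrite expRD; field.
Qed.

Lemma gaussian_pair_bump1 U V p q (a c : R) : gaussian_pair U V p q -> 0 <= c ->
  \int[P]_w bump c (U w - a) = bump_mean p c a.
Proof.
move=> UV; rewrite le_eqVlt => /predU1P[<-|c0].
  under eq_Rintegral do rewrite bump0.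
  rewrite Rintegral_cst//= [P _]probability_setT/= /bump_mean mul0r bump0 mulr0 addr0.
  by rewrite sqrtr1 invr1.
have [mU mV p0 q0 _] := UV.
transitivity (\int[P]_w (cst 1 w * bump c (U w - a))).
  by apply: eq_Rintegral => w _; rewrite mul1r.
rewrite (@integral_mul_bump _ _ 1)//; last by move=> w; rewrite normr1.
rewrite -bump_meanE//; apply: eq_Rintegral => v _.
have := gaussian_pair_cos a 0 v 0 UV.
rewrite mul0r cos0 expr0n/= mul0r oppr0 mul0r expR0 !mulr1 => <-.
by apply: eq_Rintegral => w _; rewrite mul0r cos0.
Qed.

(** The joint expectation factorizes, which is how the independence of
   uncorrelated Gaussian variables enters. *)
Lemma gaussian_pair_bump2 U V p q (a b c c' : R) : gaussian_pair U V p q ->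
  0 < c -> 0 <= c' ->
  \int[P]_w (bump c' (V w - b) * bump c (U w - a)) = bump_mean p c a * bump_mean q c' b.
Proof.
move=> UV c0; rewrite le_eqVlt => /predU1P[<-|c'0].
  have -> : bump_mean q 0 b = 1.
    by rewrite /bump_mean mul0r bump0 mulr0 addr0 sqrtr1 invr1 mulr1.
  rewrite mulr1 -(gaussian_pair_bump1 a UV (ltW c0)).
  by apply: eq_Rintegral => w _; rewrite bump0 mul1r.
have [mU mV p0 q0 _] := UV.
have mVb : measurable_fun setT (fun w => bump c' (V w - b)).
  by apply: (measurableT_comp (measurable_bump c')); exact: measurable_funB.
rewrite (@integral_mul_bump _ _ 1)//; last first.
  by move=> w; rewrite ger0_norm ?(ltW (bump_gt0 _ _))// bump_le1// ltW.
rewrite -(bump_meanE a p0 c0).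
have key u : \int[P]_w (bump c' (V w - b) * cos (u * (U w - a))) =
   bump_mean q c' b * (cos (u * a) * expR (- (u ^+ 2 * p) / 2)).
  under eq_Rintegral do rewrite mulrC.
  rewrite (@integral_mul_bump _ _ 1)//; last 2 first.
  - apply: measurable_cosT; apply: measurable_funM => //; exact: measurable_funB.
  - by move=> w; rewrite ler_norml cos_geN1 cos_le1.
  rewrite -(bump_meanE b q0 c'0) mulrC -RintegralZl//; last first.
    apply: (@integrable_bounded _ _ _ (normal_prob 0 (Num.sqrt c')) _ 1).
      apply: measurable_funM.
        by apply: (measurableT_comp (@measurable_cosR R)); exact: measurable_funM.
      apply: measurableT_comp => //; apply: measurable_funM => //; apply: measurableT_comp => //.
      by apply: measurable_funM => //; exact: measurable_funX.
    move=> v; rewrite normrM -[leRHS]mul1r ler_pM//.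
      by rewrite ler_norml cos_geN1 cos_le1.
    by rewrite ger0_norm ?expR_ge0// -expR0 ler_expR mulNr oppr_le0 divr_ge0// mulr_ge0 ?sqr_ge0.
  apply: eq_Rintegral => v _; rewrite -(gaussian_pair_cos a b u v UV).
  by apply: eq_Rintegral => w _; rewrite mulrC.
under eq_Rintegral do rewrite key.
rewrite RintegralZl// 1?mulrC//.
apply: (@integrable_bounded _ _ _ (normal_prob 0 (Num.sqrt c)) _ 1).
  apply: measurable_funM.
    by apply: (measurableT_comp (@measurable_cosR R)); exact: measurable_funM.
  apply: measurableT_comp => //; apply: measurable_funM => //; apply: measurableT_comp => //.
  by apply: measurable_funM => //; exact: measurable_funX.
move=> v; rewrite normrM -[leRHS]mul1r ler_pM//.
  by rewrite ler_norml cos_geN1 cos_le1.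
by rewrite ger0_norm ?expR_ge0// -expR0 ler_expR mulNr oppr_le0 divr_ge0// mulr_ge0 ?sqr_ge0.
Qed.

End gaussian_pair.

Section pair_probabilities.
Context {R : realType} d (T : measurableType d) (P : probability T R).

(** Markov's inequality, for a bounded function that dominates the event. *)
Lemma probability_le_Rintegral (S : set T) (f : T -> R) (M C : R) :
  measurable S -> measurable_fun setT f -> (forall w, 0 <= f w <= M) -> 0 <= C ->
  (forall w, S w -> 1 <= C * f w) ->
  (P S <= (C * \int[P]_w f w)%:E)%E.
Proof.
move=> mS mf fM C0 SC.
have fi : P.-integrable setT (EFin \o f).
  by apply: (integrable_bounded P mf (M := M)) => w; have /andP[? ?] := fM w; rewrite ger0_norm.
rewrite EFinM EFin_Rintegral//.
have -> : (P S = \int[P]_w (\1_S w)%:E)%E by rewrite integral_indic// setIT.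
rewrite -ge0_integralZl//; last 2 first.
- exact/measurable_EFinP.
- by move=> w _; rewrite lee_fin; have /andP[] := fM w.
apply: ge0_le_integral => //.
- exact/measurable_EFinP/measurable_indic.
- by apply: emeasurable_funM => //; exact/measurable_EFinP.
move=> w _; rewrite -EFinM lee_fin indicE; have [wS|_] := boolP (w \in S).
  by apply: SC; rewrite inE in wS.
by rewrite mulr_ge0//; have /andP[] := fM w.
Qed.

Lemma expR_half_ge : (2:R)^-1 <= expR (- 2^-1).
Proof. by apply: le_trans (expR_ge1Dx _); lra. Qed.

Lemma expR_half_le : expR (- (2:R)^-1) <= 2 / 3.
Proof.
have h : (3:R) / 2 <= expR 2^-1 by apply: le_trans (expR_ge1Dx _); lra.
rewrite expRN (_ : 2 / 3 = (3 / 2)^-1); last by field.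
by rewrite lef_pV2 ?posrE ?expR_gt0//; lra.
Qed.

Lemma bump_ball (e x : R) : 0 < e -> `|x| <= e -> 1 <= 2 * bump (e ^- 2) x.
Proof.
move=> e0 xe; have : expR (- 2^-1) <= bump (e ^- 2) x.
  rewrite /bump ler_expR mulNr lerN2 ler_pdivrMr// mulVf//.
  rewrite mulrC ler_pdivrMr ?exprn_gt0// mul1r -(real_normK (num_real x)).
  by rewrite lerXn2r ?nnegrE// ltW.
have := expR_half_ge; lra.
Qed.

Lemma bump_tail (l x : R) m : 0 < l -> l <= `|x| -> 1 <= 3 ^+ m * (1 - bump (l ^- 2) x) ^+ m.
Proof.
move=> l0 xl; have h : bump (l ^- 2) x <= expR (- 2^-1).
  rewrite /bump ler_expR mulNr lerN2 ler_pdivlMr// mulVf//.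
  rewrite mulrC ler_pdivlMr ?exprn_gt0// mul1r -(real_normK (num_real x)).
  by rewrite lerXn2r ?nnegrE// ltW.
by rewrite -exprMn exprn_ege1//; have := expR_half_le; lra.
Qed.

Lemma gaussian_pair_ball U V p q (a b e h : R) : gaussian_pair P U V p q ->
  0 < e -> 0 < h ->
  (P [set w | (`|U w - a| <= e /\ `|V w - b| <= h)%R] <=
   (4 * (bump_mean p (e ^- 2) a * bump_mean q (h ^- 2) b))%:E)%E.
Proof.
move=> UV e0 h0; have [mU mV p0 q0 _] := UV.
have c0 (r : R) : 0 < r -> 0 < r ^- 2 by move=> r0; rewrite invr_gt0 exprn_gt0.
rewrite -(gaussian_pair_bump2 a b UV (c0 _ e0) (ltW (c0 _ h0))).
apply: (@probability_le_Rintegral _ _ 1) => //.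
- by apply: measurableI; apply: measurable_norm_le; exact: measurable_funB.
- apply: measurable_funM; apply: (measurableT_comp (measurable_bump _)); exact: measurable_funB.
- move=> w; rewrite mulr_ge0 ?(ltW (bump_gt0 _ _))//= -[leRHS]mulr1.
  by rewrite ler_pM ?(ltW (bump_gt0 _ _)) ?bump_le1// ltW// c0.
- move=> w [/(bump_ball e0) h1 /(bump_ball h0) h2].
  have -> : 4 * (bump (h ^- 2) (V w - b) * bump (e ^- 2) (U w - a)) =
    (2 * bump (e ^- 2) (U w - a)) * (2 * bump (h ^- 2) (V w - b)) by ring.
  by rewrite -[leLHS]mulr1 ler_pM.
Qed.

Lemma gaussian_pair_ball1 U V p q (a e : R) : gaussian_pair P U V p q -> 0 < e ->
  (P [set w | (`|U w - a| <= e)%R] <= (2 * bump_mean p (e ^- 2) a)%:E)%E.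
Proof.
move=> UV e0; have [mU mV p0 q0 _] := UV.
have c0 : 0 < e ^- 2 by rewrite invr_gt0 exprn_gt0.
rewrite -(gaussian_pair_bump1 a UV (ltW c0)).
apply: (@probability_le_Rintegral _ _ 1) => //.
- by apply: measurable_norm_le; exact: measurable_funB.
- by apply: (measurableT_comp (measurable_bump _)); exact: measurable_funB.
- by move=> w; rewrite ltW ?bump_gt0//= bump_le1// ltW.
- by move=> w /(bump_ball e0).
Qed.

Lemma bump_mean_le p (e a : R) : 0 < p -> 0 < e -> bump_mean p (e ^- 2) a <= e / Num.sqrt p.
Proof.
move=> p0 e0; have e2 : 0 < e ^- 2 by rewrite invr_gt0 exprn_gt0.
rewrite /bump_mean -[leRHS]mulr1 ler_pM ?invr_ge0 ?(ltW (bump_gt0 _ _)) ?bump_le1//; last first.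
  by rewrite divr_ge0 ?(ltW e2)// addr_ge0// mulr_ge0// ltW.
rewrite -[e in leRHS](invrK e) -invfM lef_pV2 ?posrE ?mulr_gt0 ?invr_gt0 ?sqrtr_gt0//; last first.
  by rewrite addr_gt0// mulr_gt0.
have -> : e^-1 * Num.sqrt p = Num.sqrt (p * e ^- 2).
  by rewrite sqrtrM ?(ltW p0)// -exprVn sqrtr_sqr ger0_norm 1?mulrC// invr_ge0 ltW.
by rewrite ler_sqrt ?lerDr// addr_ge0// mulr_ge0 ?ltW.
Qed.

Lemma bump_meanVE q (h b : R) : 0 <= q -> 0 < h ->
  bump_mean q (h ^- 2) b = h / Num.sqrt (q + h ^+ 2) * bump ((q + h ^+ 2)^-1) b.
Proof.
move=> q0 h0; have h2 : 0 < h ^+ 2 by rewrite exprn_gt0.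
have M0 : 0 < q + h ^+ 2 by rewrite ltr_wpDl.
have E : 1 + q * h ^- 2 = (q + h ^+ 2) * h ^- 2 by rewrite mulrDl mulfV ?gt_eqF// addrC.
rewrite /bump_mean E; congr (_ * _).
  by rewrite sqrtrM ?(ltW M0)// -exprVn sqrtr_sqr ger0_norm ?invr_ge0 ?(ltW h0)// invfM invrK mulrC.
rewrite (_ : h ^- 2 / ((q + h ^+ 2) * h ^- 2) = (q + h ^+ 2)^-1)//.
move: (h ^+ 2) h2 M0 => x x0 M0.
by rewrite invfM invrK mulrCA mulVf ?mulr1// gt_eqF.
Qed.

(** The power of [1 - bump] is a combination of bumps; the additional factor
   [bump (c' n)] is what makes the induction on [m] close up. *)
Lemma gaussian_pair_bump_tail U V p q (a c c' : R) m : gaussian_pair P U V p q ->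
  0 < c -> 0 <= c' ->
  \int[P]_w (bump c (U w - a) * (1 - bump c' (V w)) ^+ m) =
  bump_mean p c a * \int[P]_w (1 - bump c' (V w)) ^+ m.
Proof.
move=> UV c0 c'0; have [mU mV p0 q0 _] := UV.
have mb : measurable_fun setT (fun w => bump c (U w - a)).
  by apply: (measurableT_comp (measurable_bump _)); exact: measurable_funB.
have mg n k : measurable_fun setT (fun w => bump (c' * n%:R) (V w) * (1 - bump c' (V w)) ^+ k).
  apply: measurable_funM; first exact: (measurableT_comp (measurable_bump _)).
  apply: measurable_funX; apply: measurable_funB => //.
  exact: (measurableT_comp (measurable_bump _)).
have bg n k w : `|bump (c' * n%:R) (V w) * (1 - bump c' (V w)) ^+ k| <= 1.
  have b0 := ltW (bump_gt0 c' (V w)); have b1 := bump_le1 (V w) c'0.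
  rewrite normrM -[leRHS]mulr1 ler_pM//.
    by rewrite ger0_norm ?(ltW (bump_gt0 _ _))// bump_le1// mulr_ge0.
  by rewrite ger0_norm ?exprn_ge0 ?exprn_ile1//; lra.
have ig n k := integrable_bounded P (mg n k) (bg n k).
have bgb n k w : `|bump c (U w - a) * (bump (c' * n%:R) (V w) * (1 - bump c' (V w)) ^+ k)| <= 1.
  rewrite normrM -[leRHS]mulr1 ler_pM//.
  by rewrite ger0_norm ?(ltW (bump_gt0 _ _))// bump_le1// ltW.
have igb n k := integrable_bounded P (measurable_funM mb (mg n k)) (bgb n k).
(* [n = 0] is the statement, as [bump 0] is constant *)
suff H : forall n, \int[P]_w (bump c (U w - a) * (bump (c' * n%:R) (V w) * (1 - bump c' (V w)) ^+ m)) =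
  bump_mean p c a * \int[P]_w (bump (c' * n%:R) (V w) * (1 - bump c' (V w)) ^+ m).
  have := H 0%N; rewrite mulr0.
  by under eq_Rintegral do rewrite bump0 mul1r;
    under [in RHS]eq_Rintegral do rewrite bump0 mul1r.
elim: m => [|m IH] n.
  under eq_Rintegral do rewrite expr0 mulr1 mulrC -[V _]subr0.
  rewrite (gaussian_pair_bump2 a 0 UV c0) ?mulr_ge0//; congr (_ * _).
  rewrite -(gaussian_pair_bump1 0 (gaussian_pairC UV)) ?mulr_ge0//.
  by apply: eq_Rintegral => w _; rewrite expr0 mulr1 subr0.
have E w : bump (c' * n%:R) (V w) * (1 - bump c' (V w)) ^+ m.+1 =
   bump (c' * n%:R) (V w) * (1 - bump c' (V w)) ^+ m -
   bump (c' * n.+1%:R) (V w) * (1 - bump c' (V w)) ^+ m.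
  by rewrite -natr1 mulrDr mulr1 -bumpM exprS; ring.
transitivity (\int[P]_w (bump c (U w - a) * (bump (c' * n%:R) (V w) * (1 - bump c' (V w)) ^+ m) -
   bump c (U w - a) * (bump (c' * n.+1%:R) (V w) * (1 - bump c' (V w)) ^+ m))).
  by apply: eq_Rintegral => w _; rewrite E mulrBr.
under [in RHS]eq_Rintegral do rewrite E.
apply: (etrans (RintegralB measurableT (igb n m) (igb n.+1 m))).
rewrite IH IH -mulrBr; congr (_ * _).
by apply: esym; exact: (RintegralB measurableT (ig n m) (ig n.+1 m)).
Qed.

(** [1 - bump] vanishes quadratically at [0], so its [m]-th power has a mean of
   order [(q / l^2)^m], while the bump in [U] contributes the factor [e]. *)
Lemma gaussian_pair_tail U V p q (a e l : R) m : gaussian_pair P U V p q ->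
  centered_gaussian P V q -> 0 < p -> 0 < q -> 0 < e -> 0 < l ->
  (P [set w | (`|U w - a| <= e /\ l <= `|V w|)%R] <=
   (2 * 3 ^+ m * (e / Num.sqrt p * (2 * m`!%:R * (2 * q / l ^+ 2) ^+ m)))%:E)%E.
Proof.
move=> UV gV p0 q0 e0 l0; have [mU mV _ _ _] := UV.
have c0 (r : R) : 0 < r -> 0 < r ^- 2 by move=> r0; rewrite invr_gt0 exprn_gt0.
have mt : measurable_fun setT (fun w => (1 - bump (l ^- 2) (V w)) ^+ m).
  apply: measurable_funX; apply: measurable_funB => //.
  exact: (measurableT_comp (measurable_bump _)).
have t01 w : 0 <= (1 - bump (l ^- 2) (V w)) ^+ m <= 1.
  have b0 := ltW (bump_gt0 (l ^- 2) (V w)); have b1 := bump_le1 (V w) (ltW (c0 _ l0)).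
  by rewrite exprn_ge0 ?exprn_ile1//; lra.
apply: (@le_trans _ _ (2 * 3 ^+ m * (\int[P]_w (bump (e ^- 2) (U w - a) * (1 - bump (l ^- 2) (V w)) ^+ m)))%:E).
  apply: (@probability_le_Rintegral _ _ 1) => //.
  - apply: measurableI; last exact: measurable_norm_ge.
    by apply: measurable_norm_le; exact: measurable_funB.
  - apply: measurable_funM => //; apply: (measurableT_comp (measurable_bump _)); exact: measurable_funB.
  - move=> w; have /andP[t0 t1] := t01 w.
    rewrite mulr_ge0 ?(ltW (bump_gt0 _ _))//= -[leRHS]mulr1.
    by rewrite ler_pM ?(ltW (bump_gt0 _ _)) ?bump_le1// ltW// c0.
  - move=> w [/(bump_ball e0) h1 /(bump_tail m l0) h2].
    by have := ler_pM ler01 ler01 h1 h2; lra.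
rewrite lee_fin ler_wpM2l ?mulr_ge0 ?exprn_ge0//.
rewrite (gaussian_pair_bump_tail _ _ UV) ?c0//; last exact/ltW/c0.
apply: ler_pM.
- by rewrite /bump_mean mulr_ge0 ?invr_ge0// ltW// bump_gt0.
- by apply: Rintegral_ge0 => w _; have /andP[] := t01 w.
- exact: bump_mean_le.
have [M1 M2] := centered_gaussian_moment m gV q0.
have l2 : 0 < 2 * l ^+ 2 by rewrite mulr_gt0// exprn_gt0.
apply: (@le_trans _ _ (\int[P]_w (((2 * l ^+ 2)^-1) ^+ m * (V w ^+ 2) ^+ m))).
  apply: le_Rintegral => //.
  - by apply: (integrable_bounded P mt (M := 1)) => w; have /andP[? ?] := t01 w; rewrite ger0_norm.
  - by rewrite /comp; under eq_fun do rewrite EFinM; exact: integrableZl.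
  move=> w _; rewrite -exprMn; apply: lerXn2r.
  - by rewrite nnegrE subr_ge0 bump_le1// ltW// c0.
  - by rewrite nnegrE; apply: mulr_ge0; rewrite ?sqr_ge0// invr_ge0 ltW.
  rewrite lerBlDr -lerBlDl.
  apply: le_trans (expR_ge1Dx _); rewrite lerD2l le_eqVlt; apply/orP; left; apply/eqP.
  by move: (l ^+ 2) l2 => y y0; field; rewrite gt_eqF//; lra.
rewrite RintegralZl//.
apply: (@le_trans _ _ ((2 * l ^+ 2)^-1 ^+ m * (2 * m`!%:R * (3 * q) ^+ m))).
  by rewrite ler_wpM2l// exprn_ge0// invr_ge0 ltW.
rewrite mulrCA -exprMn ler_wpM2l ?mulr_ge0//.
have ql : 0 <= q / l ^+ 2 by rewrite divr_ge0 ?sqr_ge0 ?ltW.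
rewrite (_ : (2 * l ^+ 2)^-1 * (3 * q) = 3 / 2 * (q / l ^+ 2)); last first.
  by move: (l ^+ 2) l2 => y y0; field; rewrite gt_eqF//; lra.
rewrite -!mulrA; move: (q / l ^+ 2) ql => y y0.
by apply: lerXn2r; rewrite ?nnegrE; lra.
Qed.

End pair_probabilities.

(** * The covariance of fractional Brownian motion *)

Section holder_increments.
Context {R : realType}.
Variable H : R.
Hypothesis H01 : 0 < H < 1.

Let H0 : 0 < H. Proof. by case/andP: H01. Qed.
Let H1 : H < 1. Proof. by case/andP: H01. Qed.

Lemma powR_sqr (x : R) : x `^ (2 * H) = (x `^ H) ^+ 2.
Proof. by rewrite mulrC powRrM -powR_mulrn// powR_ge0. Qed.

Lemma le_powRH (x y : R) : 0 <= x -> x <= y -> x `^ H <= y `^ H.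
Proof.
move=> x0 xy; apply: ge0_ler_powR => //; rewrite ?nnegrE//; first exact: ltW.
exact: le_trans xy.
Qed.

Lemma powRH_le1 (x : R) : 0 <= x <= 1 -> x `^ H <= 1.
Proof. by move=> /andP[x0 x1]; have := le_powRH x0 x1; rewrite powR1. Qed.

(** Young's inequality gives [(1 + u)^H <= 1 + H u], the tangent bound. *)
Lemma powRH_tangent (u : R) : 0 <= u -> (1 + u) `^ H <= 1 + H * u.
Proof.
move=> u0; have u1 : 0 <= 1 + u by lra.
have Hn : H != 0 by rewrite gt_eqF.
have := @conjugate_powR R ((1 + u) `^ H) 1 H^-1 (1 - H)^-1 (powR_ge0 _ _) ler01.
rewrite !invr_gt0 subr_gt0 !invrK powR1 mulr1 mul1r -powRrM mulfV// powRr1//.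
move=> /(_ H0 H1) h; apply: le_trans (h _) _; first by lra.
lra.
Qed.

(** Concavity scaled from the tangent bound at [1], using [z <= z^H] on
   [[0, 1]]. *)
Lemma powRH_add (x y : R) : 0 <= x -> x <= y -> 0 < y ->
  (y + x) `^ H <= y `^ H + H * x `^ H.
Proof.
move=> x0 xy y0; have yn : y != 0 by rewrite gt_eqF.
have u0 : 0 <= x / y by rewrite divr_ge0// ltW.
have u1 : x / y <= 1 by rewrite ler_pdivrMr// mul1r.
have -> : y + x = y * (1 + x / y) by field.
have {2}-> : x = y * (x / y) by field.
move: (x / y) u0 u1 => z u0 u1.
rewrite !powRM ?(ltW y0)//; last by lra.
have t := powRH_tangent u0.
have w : z <= z `^ H.
  have [->|un] := eqVneq z 0; first exact: powR_ge0.
  by rewrite -[leLHS]powRr1//; apply: ger_powR; rewrite ?lt0r ?un ?u0 ?u1 ?(ltW H1).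
have p0 := powR_ge0 y H.
have h : (1 + z) `^ H <= 1 + H * z `^ H.
  apply: le_trans t _; rewrite lerD2l ler_wpM2l// ltW//.
by apply: le_trans (ler_wpM2l p0 h) _; rewrite mulrDr mulr1; lra.
Qed.

(** On [[a, 1]] the function [t^H] is [H]-Hoelder with this constant, and the
   point is that it is less than [1]. *)
Definition holder_gap (a : R) := 1 - (1 - H) * a `^ H.

Lemma powRH_increment (a s t : R) : 0 < a -> a <= s -> s <= t -> t <= 1 ->
  t `^ H - s `^ H <= holder_gap a * (t - s) `^ H.
Proof.
move=> a0 sa st t1; rewrite /holder_gap.
have s0 : 0 < s by exact: lt_le_trans sa.
have u0 : 0 <= t - s by lra.
have aH := powR_ge0 a H; have uH := powR_ge0 (t - s) H.
have a1 : a `^ H <= 1 by apply: powRH_le1; rewrite (ltW a0)/=; lra.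
have u1 : (t - s) `^ H <= 1 by apply: powRH_le1; lra.
have as' : a `^ H <= s `^ H by apply: le_powRH => //; exact: ltW.
(* in a sum of two powers it is the smaller term that gains the factor [H] *)
have [us|su] := leP (t - s) s.
  have := powRH_add u0 us s0; rewrite subrKC => h.
  have : (1 - H) * a `^ H <= (1 - H) * 1 by rewrite ler_wpM2l// subr_ge0 ltW.
  move=> h2; have := ler_wpM2r uH h2.
  by lra.
have h := powRH_add (ltW s0) (ltW su) (lt_trans s0 su); rewrite subrK in h.
have h1 : (1 - H) * a `^ H * (t - s) `^ H <= (1 - H) * s `^ H.
  rewrite -mulrA ler_wpM2l ?subr_ge0 ?(ltW H1)//.
  by apply: le_trans as'; rewrite ler_piMr.
by lra.
Qed.

Lemma holder_gap_bounds (a : R) : 0 < a <= 1 -> 0 <= holder_gap a < 1.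
Proof.
move=> /andP[a0 a1]; rewrite /holder_gap.
have aH : 0 < a `^ H by exact: powR_gt0.
have aH1 : a `^ H <= 1 by apply: powRH_le1; rewrite (ltW a0).
have := mulr_gt0 aH (_ : 0 < 1 - H); rewrite subr_gt0 => /(_ H1).
have : (1 - H) * a `^ H <= (1 - H) * 1 by rewrite ler_wpM2l// subr_ge0 ltW.
by have := H0; lra.
Qed.

End holder_increments.

Section fbm_covariance.
Context {R : realType}.
Variable H : R.
Hypothesis H01 : 0 < H < 1.

Let H0 : 0 < H. Proof. by case/andP: H01. Qed.

(** The coefficient of the linear regression of [X_t] on [X_s]. *)
Definition fbm_reg (s t : R) : R := fbm_cov H s t / fbm_cov H s s.

(** The variance of [X_t] given [X_s]. *)
Definition fbm_cvar (s t : R) : R :=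
  fbm_cov H t t - fbm_cov H s t ^+ 2 / fbm_cov H s s.

Lemma fbm_var (t : R) : 0 <= t -> fbm_cov H t t = (t `^ H) ^+ 2.
Proof.
move=> t0; rewrite /fbm_cov subrr normr0 powR0; last by rewrite gt_eqF// mulr_gt0.
by rewrite ger0_norm// powR_sqr; field.
Qed.

Lemma fbm_covE (s t : R) : 0 <= s -> 0 <= t ->
  fbm_cov H s t = 2^-1 * ((t `^ H) ^+ 2 + (s `^ H) ^+ 2 - (`|t - s| `^ H) ^+ 2).
Proof. by move=> s0 t0; rewrite /fbm_cov !powR_sqr (ger0_norm s0) (ger0_norm t0). Qed.

Definition fbm_gap (a : R) : R := (1 - holder_gap H a ^+ 2) * (a `^ H) ^+ 2 / 4.

Lemma fbm_gap_gt0 (a : R) : 0 < a <= 1 -> 0 < fbm_gap a.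
Proof.
move=> a01; have /andP[k0 k1] := holder_gap_bounds H01 a01.
have /andP[a0 _] := a01.
rewrite divr_gt0// mulr_gt0 ?exprn_gt0 ?powR_gt0//.
by rewrite subr_gt0 expr_lt1.
Qed.

Section two_times.
Variables a s t : R.
Hypotheses (a01 : 0 < a <= 1) (s_a1 : a <= s <= 1) (t_a1 : a <= t <= 1).

Let x := s `^ H.
Let y := t `^ H.
Let D := `|t - s| `^ H.
Let a0 : 0 < a. Proof. by case/andP: a01. Qed.
Let s0 : 0 < s. Proof. by case/andP: s_a1 => h _; exact: lt_le_trans h. Qed.
Let t0 : 0 < t. Proof. by case/andP: t_a1 => h _; exact: lt_le_trans h. Qed.
Let x0 : 0 < x. Proof. exact: powR_gt0. Qed.
Let y0 : 0 < y. Proof. exact: powR_gt0. Qed.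
Let ax : a `^ H <= x. Proof. by apply: le_powRH => //; [exact: ltW|case/andP: s_a1]. Qed.
Let ay : a `^ H <= y. Proof. by apply: le_powRH => //; [exact: ltW|case/andP: t_a1]. Qed.
Let x1 : x <= 1. Proof. by apply: powRH_le1 => //; rewrite (ltW s0); case/andP: s_a1. Qed.
Let D0 : 0 <= D. Proof. exact: powR_ge0. Qed.

(** Heron's formula: the conditional variance is the squared height, over the
   side [s^H], of the triangle of sides [s^H], [t^H] and [|t - s|^H]. The bounds
   below say that on [[a, 1]] this height is comparable to [|t - s|^H]. *)
Lemma fbm_cvarE :
  fbm_cvar s t = (D ^+ 2 - (y - x) ^+ 2) * ((x + y) ^+ 2 - D ^+ 2) / (4 * x ^+ 2).
Proof.
rewrite /fbm_cvar !fbm_var ?(ltW s0) ?(ltW t0)// fbm_covE ?(ltW s0) ?(ltW t0)// -/x -/y -/D.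
by field; rewrite gt_eqF.
Qed.

Let yx : (y - x) ^+ 2 <= holder_gap H a ^+ 2 * D ^+ 2.
Proof.
have /andP[k0 k1] := holder_gap_bounds H01 a01.
have h : `|y - x| <= holder_gap H a * D.
  have /andP[sa s1'] := s_a1; have /andP[ta t1'] := t_a1.
  rewrite /D; have [st|ts] := leP s t.
    rewrite ger0_norm ?subr_ge0 1?(le_powRH H01)// ?(ltW s0)//.
    by rewrite ger0_norm ?subr_ge0//; exact: powRH_increment.
  rewrite distrC ger0_norm ?subr_ge0 1?(le_powRH H01)// ?(ltW t0) ?(ltW ts)//.
  by rewrite distrC ger0_norm ?subr_ge0 ?(ltW ts)//; apply: powRH_increment => //; exact: ltW.
rewrite -exprMn -(real_normK (num_real (y - x))) lerXn2r ?nnegrE//.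
exact: mulr_ge0.
Qed.

Let Dxy : (a `^ H) ^+ 2 <= (x + y) ^+ 2 - D ^+ 2.
Proof.
have aH := powR_ge0 a H.
have hD : D <= Num.max x y.
  rewrite /D le_max; have [st|ts] := leP s t.
    by rewrite ger0_norm ?subr_ge0// (@le_powRH _ _ H01 (t - s) t) ?orbT//; move: s0; lra.
  by rewrite distrC ger0_norm ?subr_ge0 ?(ltW ts)// (@le_powRH _ _ H01 (s - t) s)//; move: t0 ts; lra.
have hm : D + a `^ H <= x + y.
  by move: hD; rewrite le_max => /orP[]; move: ax ay; lra.
have : (D + a `^ H) ^+ 2 <= (x + y) ^+ 2 by rewrite lerXn2r ?nnegrE ?addr_ge0 ?(ltW x0) ?(ltW y0).
by have := mulr_ge0 D0 aH; rewrite sqrrD; lra.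
Qed.

Lemma fbm_cvar_ge : fbm_gap a * D ^+ 2 <= fbm_cvar s t.
Proof.
have /andP[k0 k1] := holder_gap_bounds H01 a01.
rewrite /fbm_gap fbm_cvarE ler_pdivlMr ?mulr_gt0 ?exprn_gt0//.
have h1 : 0 <= (1 - holder_gap H a ^+ 2) * D ^+ 2.
  by rewrite mulr_ge0 ?sqr_ge0// subr_ge0 exprn_ile1// ltW.
have h2 : (1 - holder_gap H a ^+ 2) * D ^+ 2 <= D ^+ 2 - (y - x) ^+ 2.
  by move: yx; lra.
have h3 := ler_pM h1 (sqr_ge0 (a `^ H)) h2 Dxy.
apply: le_trans h3; rewrite -!mulrA mulrCA mulrA.
have x21 : x ^+ 2 <= 1 by rewrite exprn_ile1// ltW.
have := ler_wpM2l (mulr_ge0 h1 (sqr_ge0 (a `^ H))) x21.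
nra.
Qed.

Lemma fbm_cvar_le : fbm_cvar s t <= D ^+ 2.
Proof.
rewrite fbm_cvarE ler_pdivrMr ?mulr_gt0 ?exprn_gt0//.
have := sqr_ge0 (D ^+ 2 - y ^+ 2 + x ^+ 2); lra.
Qed.

(** The square of [(1 - reg) s^H] is [D^2] minus the conditional variance. *)
Lemma fbm_reg_close : `|1 - fbm_reg s t| <= D / x.
Proof.
have h : 0 <= fbm_cvar s t.
  apply: le_trans fbm_cvar_ge.
  by apply: mulr_ge0; [exact/ltW/fbm_gap_gt0|exact: sqr_ge0].
rewrite -(@ler_pXn2r _ 2%N) ?nnegrE ?divr_ge0 ?(ltW x0)//.
rewrite real_normK ?num_real// /fbm_reg fbm_var ?(ltW s0)//.
move: h; rewrite /fbm_cvar !fbm_var ?(ltW s0) ?(ltW t0)// fbm_covE ?(ltW s0) ?(ltW t0)// -/x -/y -/D.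
set c := (2^-1 * _) => h.
have -> : (1 - c / x ^+ 2) ^+ 2 = (x ^+ 2 - c) ^+ 2 / (x ^+ 2) ^+ 2 by field; rewrite gt_eqF.
have -> : (D / x) ^+ 2 = D ^+ 2 * x ^+ 2 / (x ^+ 2) ^+ 2 by field; rewrite gt_eqF.
rewrite ler_wpM2r ?invr_ge0 ?sqr_ge0//.
have x2 : 0 < x ^+ 2 by rewrite exprn_gt0.
have h2 : c ^+ 2 <= y ^+ 2 * x ^+ 2.
  by rewrite -ler_pdivrMr//; lra.
have D2 : D ^+ 2 = x ^+ 2 + y ^+ 2 - 2 * c by rewrite /c; field.
rewrite D2; nra.
Qed.

End two_times.
End fbm_covariance.

(** * One coordinate at two times *)

(** If [X_s] and [X_t] are within [e] of [y] and [z], then the residual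
   [X_t - reg X_s] is within [ball_factor * e] of [z - reg y]. *)
Definition ball_factor (R : realType) (H a : R) : R := 2 + (a `^ H)^-1.

Definition fbm_scale (R : realType) (H a s t e : R) : R :=
  Num.sqrt (fbm_cvar H s t + (ball_factor H a * e) ^+ 2).

Section fbm_linear.
Context {R : realType} d (T : measurableType d) (P : probability T R).
Variable H : R.
Hypothesis H01 : 0 < H < 1.
Variable X : R -> T -> R.
Hypothesis fX : fbm1 P H `[0, 1] X.

Lemma fbm1_measurable (t : R) : 0 <= t <= 1 -> measurable_fun setT (X t).
Proof.
by move=> t01; case: fX => -[mX _] _ _ _; apply: mX; rewrite /= in_itv.
Qed.

Lemma fbm1_cross (s t : R) : 0 <= s <= 1 -> 0 <= t <= 1 ->
  (\int[P]_w (X s w * X t w)%:E = (fbm_cov H s t)%:E)%E.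
Proof.
move=> s01 t01; case: fX => _ _ h _.
by have := h s t; rewrite /= !in_itv/= => /(_ s01 t01); rewrite unlock.
Qed.

Lemma fbm1_sqr_integrable (t : R) : 0 <= t <= 1 ->
  P.-integrable setT (fun w => (X t w ^+ 2)%:E).
Proof.
move=> t01; apply/integrableP; split.
  by apply/measurable_EFinP; apply: measurable_funX; exact: fbm1_measurable.
under eq_integral do rewrite gee0_abs ?lee_fin ?sqr_ge0//.
by rewrite [ltLHS](fbm1_cross t01 t01) ltry.
Qed.

Lemma fbm1_integrable (t : R) : 0 <= t <= 1 -> P.-integrable setT (fun w => (X t w)%:E).
Proof.
move=> t01; have i2 := fbm1_sqr_integrable t01.
have i1 : P.-integrable setT (EFin \o cst (1 : R)) by exact: finite_measure_integrable_cst.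
apply: le_integrable (integrableD measurableT i1 i2) => //.
  by apply/measurable_EFinP; exact: fbm1_measurable.
move=> w _; rewrite /= lee_fin [leRHS]ger0_norm ?addr_ge0 ?sqr_ge0//.
by have := sqr_ge0 (X t w - 1); have := sqr_ge0 (X t w + 1); rewrite ler_norml; lra.
Qed.

Lemma fbm1_cross_integrable (s t : R) : 0 <= s <= 1 -> 0 <= t <= 1 ->
  P.-integrable setT (fun w => (X s w * X t w)%:E).
Proof.
move=> s01 t01; have i1 := fbm1_sqr_integrable s01; have i2 := fbm1_sqr_integrable t01.
apply: le_integrable (integrableD measurableT i1 i2) => //.
  by apply/measurable_EFinP; apply: measurable_funM; exact: fbm1_measurable.
move=> w _; rewrite /= lee_fin [leRHS]ger0_norm ?addr_ge0 ?sqr_ge0//.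
by have := sqr_ge0 (X s w - X t w); have := sqr_ge0 (X s w + X t w); rewrite ler_norml; nra.
Qed.

Lemma fbm1_lincomb (s t a b : R) : 0 <= s <= 1 -> 0 <= t <= 1 ->
  centered_gaussian P (fun w => a * X s w + b * X t w)
    (a ^+ 2 * fbm_cov H s s + 2 * a * b * fbm_cov H s t + b ^+ 2 * fbm_cov H t t).
Proof.
move=> s01 t01; have [[_ gX] EX _ _] := fX.
have mst : measurable_fun setT (fun w => a * X s w + b * X t w).
  by apply: measurable_funD; apply: measurable_funM => //; exact: fbm1_measurable.
pose ts (k : 'I_2) : R := if k == ord0 then s else t.
pose as' (k : 'I_2) : R := if k == ord0 then a else b.
have tsI k : `[0, 1]%classic (ts k) by rewrite /ts /=; case: ifP; rewrite in_itv.
have [m [sd law]] := gX 2%N ts as' tsI.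
apply: (@centered_gaussianP _ _ _ _ _ m sd) => //.
- move=> A mA; rewrite -law// /pushforward; congr (P _).
  apply/seteqP; split=> w /=; rewrite !big_ord_recl big_ord0 addr0 /as' /ts//=.
- have Z r : 0 <= r <= 1 -> (\int[P]_w (X r w)%:E = 0)%E.
    by move=> r01; have := EX r; rewrite /= in_itv/= => /(_ r01); rewrite unlock.
  under eq_integral do rewrite EFinD !EFinM.
  by rewrite integralD ?integralZl ?Z ?mule0 ?adde0//; try apply: integrableZl; rewrite ?fbm1_integrable//; exact: fbm1_integrable.
- have is2 := fbm1_sqr_integrable s01; have it2 := fbm1_sqr_integrable t01.
  have ist := fbm1_cross_integrable s01 t01.
  have E r : 0 <= r <= 1 -> (\int[P]_w (X r w ^+ 2)%:E = (fbm_cov H r r)%:E)%E.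
    by move=> r01; rewrite -fbm1_cross//; apply: eq_integral => w _; rewrite expr2.
  transitivity (\int[P]_w (((a ^+ 2)%:E * (X s w ^+ 2)%:E + (2 * a * b)%:E * (X s w * X t w)%:E) + (b ^+ 2)%:E * (X t w ^+ 2)%:E))%E.
    by apply: eq_integral => w _; rewrite -!EFinM -!EFinD; congr EFin; ring.
  rewrite integralD//; [|by apply: integrableD => //; exact: integrableZl|exact: integrableZl].
  rewrite integralD//; [|exact: integrableZl|exact: integrableZl].
  by rewrite !integralZl// !E// fbm1_cross.
Qed.

Lemma fbm1_pair (s t : R) : 0 < s <= 1 -> 0 <= t <= 1 -> 0 <= fbm_cvar H s t ->
  gaussian_pair P (X s) (fun w => X t w - fbm_reg H s t * X s w)
    (fbm_cov H s s) (fbm_cvar H s t) /\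
  centered_gaussian P (fun w => X t w - fbm_reg H s t * X s w) (fbm_cvar H s t).
Proof.
move=> /andP[s0 s1] t01 q0; have s01 : 0 <= s <= 1 by rewrite ltW.
have vs : 0 < fbm_cov H s s by rewrite fbm_var// ?ltW// exprn_gt0// powR_gt0.
have mX := fbm1_measurable.
have L a b := fbm1_lincomb (a - b * fbm_reg H s t) b s01 t01.
have Lv a b : (a - b * fbm_reg H s t) ^+ 2 * fbm_cov H s s +
    2 * (a - b * fbm_reg H s t) * b * fbm_cov H s t + b ^+ 2 * fbm_cov H t t =
    a ^+ 2 * fbm_cov H s s + b ^+ 2 * fbm_cvar H s t.
  by rewrite /fbm_reg /fbm_cvar; field; rewrite gt_eqF.
split.
- split; [exact: mX| |exact: ltW|by []|].
    by apply: measurable_funB; [exact: mX|apply: measurable_funM => //; exact: mX].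
  move=> a b th; have := centered_gaussian_cos 1 th (L a b).
  rewrite Lv expr1n mul1r => <-; apply: eq_Rintegral => w _.
  by congr cos; ring.
- have -> : fbm_cvar H s t = 0 ^+ 2 * fbm_cov H s s + 1 ^+ 2 * fbm_cvar H s t by ring.
  have -> : (fun w => X t w - fbm_reg H s t * X s w) =
            (fun w => (0 - 1 * fbm_reg H s t) * X s w + 1 * X t w).
    by apply/funext => w; ring.
  by rewrite -Lv; exact: L.
Qed.

(** The regression residual is independent of [X s], so that the bound is a
   product: [M] is the standard deviation of the residual blurred at scale [e],
   and [w0] is the displacement that the residual has to make. *)
Lemma fbm1_two_point (a s t e y z : R) :
  0 < a <= 1 -> a <= s <= 1 -> a <= t <= 1 -> s != t -> 0 < e ->
  let k := ball_factor H a in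
  let M := fbm_scale H a s t e in
  let w0 := z - fbm_reg H s t * y in
  is_true (P [set w | (`|X s w - y| <= e /\ `|X t w - z| <= e)%R] <=
    (4 * (e / (a `^ H) * (k * e / M * bump (M ^- 2) w0)))%:E)%E.
Proof.
move=> a01 sa1 ta1 st e0 k M w0.
have /andP[a0 a1] := a01; have /andP[sa s1] := sa1; have /andP[ta t1] := ta1.
have s0 : 0 < s by exact: lt_le_trans sa.
have t0 : 0 < t by exact: lt_le_trans ta.
have ts0 : 0 < `|t - s| by rewrite normr_gt0 subr_eq0 eq_sym.
have D0 : 0 < `|t - s| `^ H by exact: powR_gt0.
have q0 : 0 < fbm_cvar H s t.
  apply: lt_le_trans (fbm_cvar_ge H01 a01 sa1 ta1).
  by rewrite mulr_gt0 ?fbm_gap_gt0// exprn_gt0.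
have s01' : 0 < s <= 1 by rewrite s0.
have s01 : 0 <= s <= 1 by rewrite (ltW s0).
have t01 : 0 <= t <= 1 by rewrite (ltW t0).
have [UV _] := fbm1_pair s01' t01 (ltW q0).
have aH : 0 < a `^ H by exact: powR_gt0.
have k0 : 0 < k by rewrite addr_gt0// invr_gt0.
have ke : 0 < k * e by rewrite mulr_gt0.
have aHs : a `^ H <= s `^ H by apply: (le_powRH H01) => //; exact: ltW.
have b1 : `|fbm_reg H s t| <= 1 + (a `^ H)^-1.
  have h := fbm_reg_close H01 a01 sa1 ta1.
  have h2 : `|t - s| `^ H / s `^ H <= (a `^ H)^-1.
    rewrite -[leRHS]mul1r ler_pM ?powR_ge0 ?invr_ge0 ?powR_ge0//.
      apply: (powRH_le1 H01); rewrite normr_ge0/= ler_norml; lra.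
    by rewrite lef_pV2 ?posrE ?powR_gt0.
  have := le_trans h h2; rewrite !ler_norml; lra.
apply: (@le_trans _ _ (P [set w | (`|X s w - y| <= e /\ `|(X t w - fbm_reg H s t * X s w) - w0| <= k * e)%R])).
  have mX := fbm1_measurable.
  have mb (g : T -> R) (c r : R) : measurable_fun setT g -> measurable [set w | `|g w - c| <= r].
    by move=> mg; apply: measurable_norm_le; exact: measurable_funB.
  apply: le_measure; rewrite ?inE.
  - by apply: measurableI; apply: mb; exact: mX.
  - apply: measurableI; apply: mb; first exact: mX.
    by apply: measurable_funB; [exact: mX|apply: measurable_funM => //; exact: mX].
  - move=> w /= [h1 h2]; split => //.
    rewrite (_ : _ - w0 = (X t w - z) - fbm_reg H s t * (X s w - y)); last by rewrite /w0; ring.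
    apply: le_trans (ler_normB _ _) _; rewrite normrM.
    have := ler_pM (normr_ge0 _) (normr_ge0 _) b1 h1.
    by rewrite /k /ball_factor; lra.
apply: le_trans (gaussian_pair_ball y w0 UV e0 ke) _.
rewrite lee_fin ler_wpM2l//; apply: ler_pM.
- by rewrite mulr_ge0 ?invr_ge0 ?sqrtr_ge0// ltW// bump_gt0.
- by rewrite mulr_ge0 ?invr_ge0 ?sqrtr_ge0// ltW// bump_gt0.
- apply: le_trans (bump_mean_le _ _ e0) _; first by rewrite fbm_var ?(ltW s0)// exprn_gt0// powR_gt0.
  rewrite fbm_var ?(ltW s0)// sqrtr_sqr ger0_norm ?powR_ge0// ler_wpM2l ?(ltW e0)//.
  by rewrite lef_pV2 ?posrE ?powR_gt0.
- rewrite bump_meanVE ?(ltW q0)//.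
  by rewrite /M /fbm_scale -/k sqr_sqrtr// addr_ge0 ?(ltW q0) ?sqr_ge0.
Qed.

(** Where [X s] is near [z] it is bounded, and the increment differs from the
   independent residual by at most a multiple of [|t - s|^H]; hence the factor
   [e] for being near [z] is kept beside the tail of the increment. *)
Lemma fbm1_increment_tail (a Z : R) (m : nat) : 0 < a <= 1 -> 0 <= Z ->
  exists2 C : R, 0 < C & forall s t e l z, a <= s <= 1 -> a <= t <= 1 ->
  0 < e <= Z -> 0 < l -> `|z| <= Z ->
  (P [set w | (`|X s w - z| <= e /\ l <= `|X t w - X s w|)%R] <=
    (C * e * (`|t - s| `^ H / l) ^+ (2 * m))%:E)%E.
Proof.
move=> a01 Z0; have /andP[a0 a1] := a01.
have aH : 0 < a `^ H by exact: powR_gt0.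
pose L : R := 4 * (Z + 1) / a `^ H.
have L0 : 0 < L by rewrite divr_gt0// mulr_gt0//; lra.
pose C1 : R := 2 / a `^ H * L ^+ (2 * m).
pose C2 : R := 2 * 3 ^+ m * (1 / a `^ H * (2 * m`!%:R * 8 ^+ m)).
have C10 : 0 < C1 by rewrite mulr_gt0 ?exprn_gt0// divr_gt0.
have C20 : 0 < C2 by rewrite !mulr_gt0 ?exprn_gt0 ?invr_gt0// ltr0n fact_gt0.
exists (C1 + C2); first exact: addr_gt0.
move=> s t e l z sa1 ta1 /andP[e0 eZ] l0 zZ.
have /andP[sa s1] := sa1; have /andP[ta t1] := ta1.
have s0 : 0 < s by exact: lt_le_trans sa.
have t0 : 0 < t by exact: lt_le_trans ta.
have s01 : 0 <= s <= 1 by rewrite (ltW s0).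
have t01 : 0 <= t <= 1 by rewrite (ltW t0).
have mX := fbm1_measurable.
set D := `|t - s| `^ H; have D0 : 0 <= D by exact: powR_ge0.
have [st|st] := eqVneq s t.
  rewrite (_ : [set w | _] = set0) ?measure0 ?lee_fin.
    by rewrite !mulr_ge0 ?exprn_ge0 ?divr_ge0 ?(ltW e0) ?(ltW l0)// addr_ge0// ltW.
  by apply/seteqP; split=> w //= [_]; rewrite st subrr normr0; rewrite leNgt l0.
have Dp : 0 < D by rewrite powR_gt0// normr_gt0 subr_eq0 eq_sym.
have q0 : 0 < fbm_cvar H s t.
  apply: lt_le_trans (fbm_cvar_ge H01 a01 sa1 ta1).
  by rewrite mulr_gt0 ?fbm_gap_gt0// exprn_gt0.
have s01' : 0 < s <= 1 by rewrite s0.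
have [UV gV] := fbm1_pair s01' t01 (ltW q0).
have vs : Num.sqrt (fbm_cov H s s) = s `^ H.
  by rewrite fbm_var ?(ltW s0)// sqrtr_sqr ger0_norm ?powR_ge0.
have vs0 : 0 < fbm_cov H s s by rewrite fbm_var ?(ltW s0)// exprn_gt0// powR_gt0.
have aHs : a `^ H <= s `^ H by apply: (le_powRH H01) => //; exact: ltW.
have m1 : measurable [set w | `|X s w - z| <= e].
  by apply: measurable_norm_le; apply: measurable_funB => //; exact: mX.
have m2 : measurable [set w | l <= `|X t w - X s w|].
  by apply: measurable_norm_ge; apply: measurable_funB; exact: mX.
have r0 : 0 <= D / l by rewrite divr_ge0// ltW.
(* for [l] of the order of the increment, being near [z] is already unlikely enough *)
have [small|large] := leP l (L * D).
  apply: (@le_trans _ _ (P [set w | (`|X s w - z| <= e)%R])).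
    apply: le_measure; rewrite ?inE//; first exact: measurableI.
    by move=> w [].
  apply: le_trans (gaussian_pair_ball1 z UV e0) _.
  rewrite lee_fin; apply: (@le_trans _ _ (C1 * e * (D / l) ^+ (2 * m))); last first.
    rewrite ler_wpM2r ?exprn_ge0// ler_wpM2r ?(ltW e0)//.
    by rewrite lerDl ltW.
  apply: (@le_trans _ _ (2 * (e / s `^ H))).
    by rewrite ler_wpM2l// -vs; exact: bump_mean_le.
  rewrite /C1 (_ : _ * e * _ = 2 * (e / a `^ H) * (L ^+ (2 * m) * (D / l) ^+ (2 * m))); last by ring.
  rewrite -exprMn -[leLHS]mulr1 ler_pM ?mulr_ge0 ?invr_ge0 ?powR_ge0 ?(ltW e0)//.
    by rewrite ler_wpM2l// ler_wpM2l ?(ltW e0)// lef_pV2 ?posrE ?powR_gt0.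
  by rewrite exprn_ege1// mulrA ler_pdivlMr// mul1r.
apply: (@le_trans _ _ (P [set w | (`|X s w - z| <= e /\ l / 2 <= `|X t w - fbm_reg H s t * X s w|)%R])).
  apply: le_measure; rewrite ?inE.
  - exact: measurableI.
  - apply: measurableI => //; apply: measurable_norm_ge.
    by apply: measurable_funB; [exact: mX|apply: measurable_funM => //; exact: mX].
  - move=> w /= [h1 h2]; split => //.
    have E : X t w - fbm_reg H s t * X s w = (X t w - X s w) + (1 - fbm_reg H s t) * X s w by ring.
    have h3 : `|X s w| <= 2 * Z.
      have : `|X s w| <= `|X s w - z| + `|z| by rewrite -{1}(subrK z (X s w)) ler_normD.
      lra.
    have h4 : `|(1 - fbm_reg H s t) * X s w| <= l / 2.
      rewrite normrM; apply: (@le_trans _ _ (D / s `^ H * (2 * Z))).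
        by rewrite ler_pM// (fbm_reg_close H01 a01).
      apply: (@le_trans _ _ (D / a `^ H * (2 * Z))).
        rewrite ler_wpM2r ?mulr_ge0// ler_wpM2l//.
        by rewrite lef_pV2 ?posrE ?powR_gt0.
      move: large; rewrite /L => large.
      have : 4 * Z / a `^ H * D <= 4 * (Z + 1) / a `^ H * D.
        rewrite ler_wpM2r// ler_wpM2r ?invr_ge0 ?powR_ge0//; lra.
      lra.
    rewrite E; set A := X t w - X s w in h2 *; set B := (_ * X s w) in h4 *.
    have : `|A| <= `|A + B| + `|B| by rewrite -{1}(addrK B A) ler_normB.
    lra.
have l20 : 0 < l / 2 by rewrite divr_gt0.
apply: le_trans (gaussian_pair_tail z m UV gV vs0 q0 e0 l20) _.
rewrite lee_fin; apply: (@le_trans _ _ (C2 * e * (D / l) ^+ (2 * m))); last first.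
  rewrite ler_wpM2r ?exprn_ge0// ler_wpM2r ?(ltW e0)//.
  by rewrite lerDr ltW.
rewrite vs /C2.
rewrite (_ : _ * e * _ = 2 * 3 ^+ m * (e / a `^ H * (2 * m`!%:R * (8 ^+ m * (D / l) ^+ (2 * m))))); last by ring.
rewrite ler_wpM2l ?mulr_ge0 ?exprn_ge0//; apply: ler_pM.
- by rewrite divr_ge0 ?powR_ge0// ltW.
- by rewrite !mulr_ge0 ?exprn_ge0 ?mulr_ge0 ?invr_ge0 ?sqr_ge0 ?(ltW q0).
- by rewrite ler_wpM2l ?(ltW e0)// lef_pV2 ?posrE ?powR_gt0.
rewrite ler_wpM2l ?mulr_ge0// exprM -exprMn.
have qD := fbm_cvar_le H01 a01 sa1 ta1.
apply: lerXn2r; rewrite ?nnegrE.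
- by rewrite mulr_ge0 ?invr_ge0 ?sqr_ge0// mulr_ge0// ltW.
- by rewrite mulr_ge0 ?sqr_ge0.
rewrite (_ : 8 * (D / l) ^+ 2 = 2 * D ^+ 2 / (l / 2) ^+ 2); last by field; rewrite gt_eqF.
by rewrite ler_wpM2r ?invr_ge0 ?sqr_ge0// ler_wpM2l.
Qed.

End fbm_linear.

(** * One coordinate over a short time interval *)

Lemma eq_ler (R : realType) (x y : R) : x = y -> x <= y.
Proof. by move=> ->. Qed.

(** A retraction onto [[0, 1]], which makes total functions of time out of paths
   that are only controlled there. *)
Definition clamp01 (R : realType) (t : R) : R := Num.max 0 (Num.min t 1).

Section clamp.
Context {R : realType}.

Lemma clamp01_itv (t : R) : 0 <= clamp01 t <= 1.
Proof. by rewrite /clamp01 le_max lexx/= ge_max ler01 ge_min lexx orbT. Qed.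

Lemma clamp01_id (t : R) : 0 <= t <= 1 -> clamp01 t = t.
Proof. by move=> /andP[t0 t1]; rewrite /clamp01 min_l// max_r. Qed.

Lemma continuous_clamp01 : continuous (@clamp01 R).
Proof.
move=> t; apply: (@continuous_max R R^o (cst 0) (fun t => Num.min t 1)).
  exact: cvg_cst.
by apply: (@continuous_min R R^o (fun t => t) (cst 1)); [exact: cvg_id|exact: cvg_cst].
Qed.

Lemma continuous_comp_clamp01 (f : R -> R) :
  {within `[0, 1], continuous f} -> continuous (f \o @clamp01 R).
Proof.
move=> cf t.
have c01 : `[0, 1]%classic (clamp01 t) by rewrite /= in_itv/= clamp01_itv.
apply: (@cvg_comp _ _ _ (@clamp01 R) f _ (within `[0, 1] (nbhs (clamp01 t)))).
  move=> A; rewrite /within/= => nA.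
  apply: (@filterS _ (nbhs t) _ _ _ _ (continuous_clamp01 nA)) => s Hs; apply: Hs.
  by rewrite /= in_itv/= clamp01_itv.
have H : within `[0, 1] (nbhs (clamp01 t)) --> (clamp01 t : subspace `[0, 1]).
  by apply/(subspace_cvgP _ c01) => B.
by move=> A nA; exact: H _ (cf (clamp01 t) A nA).
Qed.

End clamp.

Section process_sigma_theory.
Context {R : realType} d (T : measurableType d).
Variables (I : set R) (X : R -> T -> R).
Let G := \bigcup_(t in I) preimage_set_system setT (X t) measurable.
Let T' := g_sigma_algebraType G.

Lemma process_sigma_measurable (A : set T) :
  (forall t, I t -> measurable_fun setT (X t)) -> process_sigma I X A -> measurable A.
Proof.
move=> mX; apply: smallest_sub; first exact: sigma_algebra_measurable.
by move=> B [t It [C mC <-]]; exact: mX.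
Qed.

Lemma measurable_process_sigma (t : R) : I t ->
  measurable_fun (setT : set T') (X t : T' -> R).
Proof.
move=> It _ B mB; apply: sub_sigma_algebra; exists t => //.
by exists B.
Qed.

Lemma process_sigma_ball (t z e : R) : I t -> process_sigma I X [set w | `|X t w - z| <= e].
Proof.
move=> It; have mX := measurable_process_sigma It.
suff : measurable ([set w | `|X t w - z| <= e] : set T') by [].
by apply: measurable_norm_le; exact: measurable_funB.
Qed.

Lemma process_sigma_increment (s t l : R) : I s -> I t ->
  process_sigma I X [set w | l <= `|X t w - X s w|].
Proof.
move=> Is It; have mXs := measurable_process_sigma Is; have mXt := measurable_process_sigma It.
suff : measurable ([set w | l <= `|X t w - X s w|] : set T') by [].
by apply: measurable_norm_ge; exact: measurable_funB.
Qed.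

Lemma process_sigmaI (A B : set T) :
  process_sigma I X A -> process_sigma I X B -> process_sigma I X (A `&` B).
Proof. exact: (@measurableI _ T'). Qed.

Lemma process_sigmaU (A B : set T) :
  process_sigma I X A -> process_sigma I X B -> process_sigma I X (A `|` B).
Proof. exact: (@measurableU _ T'). Qed.

Lemma process_sigma_bigcup (F : nat -> set T) :
  (forall n, process_sigma I X (F n)) -> process_sigma I X (\bigcup_n F n).
Proof. exact: (@bigcupT_measurable _ T'). Qed.

Lemma process_sigma_bigsetU n (F : nat -> set T) :
  (forall k, process_sigma I X (F k)) -> process_sigma I X (\big[setU/set0]_(k < n) F k).
Proof. by move=> mF; apply: (@bigsetU_measurable _ T') => k _; exact: mF. Qed.

End process_sigma_theory.

Lemma min1_increment (R : realType) (u v : R) : 0 <= v ->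
  `|Num.min u 1 - Num.min (u + v) 1| <= v.
Proof.
by move=> v0; have [h1|h1] := leP u 1; have [h2|h2] := leP (u + v) 1; rewrite ler_norml; lra.
Qed.

(** Dyadic approximation from below: refining the mesh either keeps the
   current point or moves it to the next one. *)
Lemma dyadic_floor (R : realType) (l t D : R) : 0 < D -> l <= t -> t <= l + D ->
  exists j : nat -> nat,
    [/\ forall k, l + (j k)%:R * (D * 2^-1 ^+ k) <= t,
        forall k, t - D * 2^-1 ^+ k <= l + (j k)%:R * (D * 2^-1 ^+ k),
        forall k, j k.+1 = (j k).*2 \/ j k.+1 = (j k).*2.+1
      & forall k, (j k < (2 ^ k).+1)%N].
Proof.
move=> D0 lt tD.
pose y (k : nat) := (t - l) / (D * 2^-1 ^+ k).
have dk k : 0 < D * 2^-1 ^+ k by rewrite mulr_gt0// exprn_gt0.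
have y0 k : 0 <= y k by rewrite divr_ge0 ?subr_ge0// ltW.
have jP k := truncn_itv (y0 k).
exists (fun k => Num.truncn (y k)); split => k; have /andP[h1 h2] := jP k.
- by move: h1; rewrite ler_pdivlMr//; lra.
- by move: h2; rewrite ltr_pdivrMr// -natr1 mulrDl mul1r; lra.
- have yS : y k.+1 = 2 * y k.
    by rewrite /y exprS; field; rewrite !gt_eqF// exprn_gt0.
  have /andP[h3 h4] := jP k.+1; rewrite yS in h3 h4 *.
  move: (Num.truncn (2 * y k)) (Num.truncn (y k)) h1 h2 h3 h4 => j' j h1 h2 h3 h4.
  have u1 : (j' < j.*2.+2)%N.
    rewrite -(ltr_nat R) -[j.*2.+2]/(j.+1.*2) -muln2 natrM.
    by apply: le_lt_trans h3 _; lra.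
  have u2 : (j.*2 < j'.+1)%N.
    by rewrite -(ltr_nat R) -muln2 natrM; apply: le_lt_trans h4; lra.
  move: u1; rewrite ltnS leq_eqVlt => /predU1P[->|]; first by right.
  by rewrite ltnS => u1; left; apply/eqP; rewrite eqn_leq u1.
- rewrite ltnS -(ler_nat R); apply: le_trans h1 _.
  rewrite ler_pdivrMr// mulrCA natrX -exprMn mulfV// expr1n mulr1.
  by rewrite lerBlDl.
Qed.

Section fbm_hit.
Context {R : realType} d (T : measurableType d) (P : probability T R).
Variable H : R.
Hypothesis H01 : 0 < H < 1.
Variable X : R -> T -> R.
Hypothesis fX : fbm1 P H `[0, 1] X.
Let I01 : set R := `[0, 1]%classic.

(** The degenerate pair [(X s, X s - X s)] gives the one-time estimate. *)
Lemma fbm1_one_point (a s e z : R) : 0 < a -> a <= s <= 1 -> 0 < e ->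
  (P [set w | (`|X s w - z| <= e)%R] <= (2 * (e / a `^ H))%:E)%E.
Proof.
move=> a0 /andP[sa s1] e0; have s0 : 0 < s by exact: lt_le_trans sa.
have s01 : 0 < s <= 1 by rewrite s0.
have s01' : 0 <= s <= 1 by rewrite ltW.
have v0 : 0 < fbm_cov H s s by rewrite fbm_var ?(ltW s0)// exprn_gt0// powR_gt0.
have c0 : fbm_cvar H s s = 0.
  by rewrite /fbm_cvar expr2 mulfK ?subrr// gt_eqF.
have [|UV _] := fbm1_pair H01 fX s01 s01'; first by rewrite c0.
apply: le_trans (gaussian_pair_ball1 z UV e0) _.
rewrite lee_fin ler_wpM2l//; apply: le_trans (bump_mean_le _ v0 e0) _.
rewrite fbm_var ?(ltW s0)// sqrtr_sqr ger0_norm ?powR_ge0// ler_wpM2l ?(ltW e0)//.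
rewrite lef_pV2 ?posrE ?powR_gt0//.
by apply: (le_powRH H01) => //; exact: ltW.
Qed.

(** If [X] comes within [r] of [z] on [[l, l + 2 r^(1/H)]], then it is already
   within a multiple of [r] of [z] at an end of that interval, or some dyadic
   increment is too large at a time where [X] is near [z]. *)
Lemma fbm1_hit (a Z : R) : 0 < a <= 1 -> 0 <= Z ->
  exists2 C : R, 0 < C & forall l r z, a <= l <= 1 -> 0 < r <= 1 -> `|z| <= Z ->
  exists A : set T, [/\ process_sigma I01 X A, (P A <= (C * r)%:E)%E &
    forall w t, l <= t -> t <= 1 -> t <= l + 2 * r `^ H^-1 -> `|X t w - z| <= r -> A w].
Proof.
move=> a01 Z0; have /andP[a0 a1] := a01; have /andP[H0 H1] := H01.
have aH : 0 < a `^ H by exact: powR_gt0.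
pose p : R := 2^-1 `^ H; pose q := Num.sqrt p.
have p0 : 0 < p by rewrite powR_gt0// invr_gt0.
have q0 : 0 < q by rewrite sqrtr_gt0.
have q2 : q ^+ 2 = p by rewrite sqr_sqrtr// ltW.
have p1 : p < 1.
  have := @gt0_ltr_powR R H H0 2^-1 1; rewrite powR1; apply; rewrite ?nnegrE//.
  by rewrite invf_lt1// ltr1n.
have q1 : q < 1 by rewrite -(@expr_lt1 _ 2)// ?q2// ltW.
(* the moment of order [2m] beats the number [2^k] of increments of level [k] *)
pose m := (Num.truncn (2 / H)).+1.
have Hm : 2 <= H * m%:R.
  by have := truncnS_gt (2 / H); rewrite -/m ltr_pdivrMr// mulrC => /ltW.
have pk k : (2^-1 ^+ k) `^ H = p ^+ k 
  by elim: k => [|k IH]; rewrite ?expr0 ?powR1// !exprS powRM ?IH ?exprn_ge0.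
have pm : p ^+ m <= 4^-1.
  rewrite -(powR_mulrn m (ltW p0)) /p -powRrM.
  apply: (@le_trans _ _ (2^-1 `^ 2)); last first.
    by rewrite powR_mulrn//; lra.
  by apply: ger_powR => //; rewrite invr_gt0 ltr0n/= invf_le1// ler1n.
pose R0 := 2 + (1 - q)^-1.
have R00 : 0 < R0 by rewrite addr_gt0// invr_gt0 subr_gt0.
pose Z' := Z + R0; have Z'0 : 0 <= Z' by rewrite addr_ge0// ltW.
have [C C0 tail] := fbm1_increment_tail H01 fX m a01 Z'0.
pose C1 := 4 * R0 / a `^ H + 4 * C * R0.
have C10 : 0 < C1 by rewrite addr_gt0 ?divr_gt0 ?mulr_gt0.
exists C1 => // l r z /andP[al l1] /andP[r0 r1] zZ.
have l0 : 0 < l by exact: lt_le_trans al.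
pose D := 2 * r `^ H^-1.
have D0 : 0 < D by rewrite mulr_gt0// powR_gt0.
have DH : (2^-1 * D) `^ H = r.
  by rewrite /D mulrA mulVf// mul1r -powRrM mulVf ?gt_eqF// powRr1// ltW.
pose pt k j : R := Num.min (l + j%:R * (D * 2^-1 ^+ k)) 1.
have pt_a1 k j : a <= pt k j <= 1.
  rewrite /pt ge_min lexx orbT andbT le_min a1 andbT.
  rewrite (le_trans al)// lerDl mulr_ge0// mulr_ge0 ?(ltW D0)// exprn_ge0//.
have pt01 k j : I01 (pt k j).
  by rewrite /I01/= in_itv/=; have /andP[h ->] := pt_a1 k j; rewrite (le_trans _ h)// ltW.
(* radii decreasing to [2 r]; an increment of level [k] is large beyond their gap [r q^k] *)
pose Rk k := r * (2 + q ^+ k / (1 - q)).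
have RkE k : Rk k - Rk k.+1 = r * q ^+ k.
  rewrite /Rk exprS; field; rewrite gt_eqF// subr_gt0//.
have Rk2 k : r * 2 <= Rk k.
  by rewrite /Rk ler_wpM2l ?(ltW r0)// lerDl divr_ge0 ?exprn_ge0 ?(ltW q0)// subr_ge0 ltW.
have RkR0 k : Rk k <= r * R0.
  rewrite /Rk /R0 ler_wpM2l ?(ltW r0)// lerD2l ler_piMl ?invr_ge0 ?subr_ge0 ?(ltW q1)//.
  by rewrite exprn_ile1// ltW.
have rR0 : 0 < r * R0 <= Z'.
  rewrite mulr_gt0//= /Z' (@le_trans _ _ R0)//; last by rewrite lerDr.
  by rewrite ler_piMl// ltW.
pose E0 j := [set w | `|X (pt 0 j) w - z| <= r * R0].
pose F k j := [set w | `|X (pt k.+1 j.*2.+1) w - z| <= r * R0] `&`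
              [set w | r * q ^+ k <= `|X (pt k j) w - X (pt k.+1 j.*2.+1) w|].
pose A := (E0 0%N `|` E0 1%N) `|` \bigcup_k \big[setU/set0]_(j < (2 ^ k).+1) F k j.
have sE0 j : process_sigma I01 X (E0 j) by apply: process_sigma_ball.
have sF k j : process_sigma I01 X (F k j).
  by apply: process_sigmaI; [exact: process_sigma_ball|exact: process_sigma_increment].
have sFk k : process_sigma I01 X (\big[setU/set0]_(j < (2 ^ k).+1) F k j).
  exact: (process_sigma_bigsetU _ (sF k)).
have mX t : I01 t -> measurable_fun setT (X t) by rewrite /I01/= in_itv/= => /(fbm1_measurable fX).
have mm (B : set T) : process_sigma I01 X B -> measurable B by exact: process_sigma_measurable.
exists A; split.
- apply: process_sigmaU; first exact: process_sigmaU.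
  exact: process_sigma_bigcup.
- have PE j : (P (E0 j) <= (2 * (r * R0 / a `^ H))%:E)%E.
    by apply: fbm1_one_point => //; case/andP: rR0.
  have PF k j : (P (F k j) <= (C * (r * R0) * p ^+ (m * k))%:E)%E.
    apply: le_trans (tail (pt k.+1 j.*2.+1) (pt k j) (r * R0) (r * q ^+ k) z (pt_a1 _ _) (pt_a1 _ _) rR0 _ _) _.
    + by rewrite mulr_gt0// exprn_gt0.
    + by rewrite (le_trans zZ)// lerDl ltW.
    have [rR00 _] := andP rR0.
    rewrite lee_fin; apply: ler_wpM2l; first exact: mulr_ge0 (ltW C0) (ltW rR00).
    have dpt : `|pt k j - pt k.+1 j.*2.+1| <= 2^-1 * D * 2^-1 ^+ k.
      have e : l + (j.*2.+1)%:R * (D * 2^-1 ^+ k.+1) = l + j%:R * (D * 2^-1 ^+ k) + 2^-1 * D * 2^-1 ^+ k.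
        by rewrite exprS -natr1 -muln2 natrM; field.
      rewrite /pt e; set u := l + _; set v := 2^-1 * D * _.
      have h0 : 0 <= 2^-1 :> R by rewrite invr_ge0.
      have v0 : 0 <= v by apply: mulr_ge0; [exact: mulr_ge0 h0 (ltW D0)|exact: exprn_ge0].
      exact: min1_increment.
    have h : `|pt k j - pt k.+1 j.*2.+1| `^ H <= r * p ^+ k.
      apply: le_trans (le_powRH H01 (normr_ge0 _) dpt) _.
      by rewrite powRM ?DH ?pk// ?exprn_ge0// mulr_ge0// ltW.
    have qk : 0 < q ^+ k by rewrite exprn_gt0.
    have h2 : `|pt k j - pt k.+1 j.*2.+1| `^ H / (r * q ^+ k) <= q ^+ k.
      rewrite ler_pdivrMr ?mulr_gt0//; apply: le_trans h _.
      by rewrite -q2 -exprM mulnC exprM expr2 mulrCA.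
    apply: (@le_trans _ _ ((q ^+ k) ^+ (2 * m))).
      apply: lerXn2r => //; rewrite nnegrE ?(ltW qk)//.
      by rewrite divr_ge0 ?powR_ge0// mulr_ge0 ?(ltW r0) ?(ltW qk).
    by rewrite -q2 -!exprM; apply: eq_ler; congr (_ ^+ _); rewrite [(k * _)%N]mulnC -mulnA.
  have Pk k : (P (\big[setU/set0]_(j < (2 ^ k).+1) F k j) <= ((4 * C * (r * R0)) / (2 ^ k.+1)%:R)%:E)%E.
    have [rR00 _] := andP rR0.
    apply: le_trans (Boole_inequality _ _) _; first by move=> j _; apply: mm.
    apply: (@le_trans _ _ (\sum_(j < (2 ^ k).+1) (C * (r * R0) * p ^+ (m * k))%:E)%E).
      by apply: lee_sum => j _; exact: PF.
    rewrite sumEFin lee_fin sumr_const card_ord -[_ *+ (2 ^ k).+1]mulr_natr.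
    have c0 : 0 <= C * (r * R0) by rewrite mulr_ge0 ?(ltW C0) ?(ltW rR00).
    rewrite (_ : 4 * C * (r * R0) / _ = C * (r * R0) * (4 / (2 ^ k.+1)%:R)); last by ring.
    move: (C * (r * R0)) c0 => c c0.
    rewrite -mulrA; apply: ler_wpM2l => //; rewrite exprM.
    have n2 : 0 < (2 ^ k)%:R :> R by rewrite ltr0n expn_gt0.
    apply: (@le_trans _ _ ((4^-1) ^+ k * (2 * (2 ^ k)%:R))).
      apply: ler_pM; rewrite ?exprn_ge0 ?(ltW p0)//.
        by apply: lerXn2r; rewrite ?nnegrE ?exprn_ge0 ?(ltW p0)// invr_ge0.
      by rewrite -natr1; have : 1 <= (2 ^ k)%:R :> R by [rewrite ler1n expn_gt0]; lra.
    apply: eq_ler; rewrite expnS natrM exprVn natrX (_ : 4 = 2 ^+ 2 :> R); last by ring.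
    rewrite exprAC; move: n2; rewrite natrX; move: (2 ^+ k) => b b0.
    by field; rewrite gt_eqF.
  have [rR00 _] := andP rR0.
  have PU : (P (\bigcup_k \big[setU/set0]_(j < (2 ^ k).+1) F k j) <= (4 * C * (r * R0))%:E)%E.
    apply: le_trans (measure_sigma_subadditive P _ _ (@subset_refl _ _)) _.
    - by move=> k; apply: mm.
    - by apply: bigcupT_measurable => k; apply: mm.
    have := @epsilon_trick R (fun=> 0%E) (4 * C * (r * R0)) xpredT (fun=> lexx _) _.
    rewrite [X in (_ <= X + _)%E]eseries0// add0e => h; apply: le_trans _ (h _); last first.
      by rewrite !mulr_ge0 ?(ltW C0) ?(ltW rR00)// ltW.
    by apply: lee_nneseries => // k _; rewrite add0e; exact: Pk.
  have mE j : measurable (E0 j) by apply: mm.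
  apply: le_trans (measureU2 _ _ _) _; [exact: measurableU|by apply: bigcupT_measurable => k; apply: mm|].
  apply: (@le_trans _ _ ((P (E0 0%N) + P (E0 1%N)) + (4 * C * (r * R0))%:E)%E).
    by apply: leeD => //; exact: measureU2.
  apply: (@le_trans _ _ ((2 * (r * R0 / a `^ H))%:E + (2 * (r * R0 / a `^ H))%:E + (4 * C * (r * R0))%:E)%E).
    by apply: leeD => //; exact: leeD.
  rewrite -!EFinD lee_fin /C1; apply: eq_ler; ring.
- move=> w t lt t1 tD Xt.
  have t0 : 0 <= t by rewrite (le_trans _ lt)// ltW.
  have [j [jl ju jS jle]] := dyadic_floor D0 lt tD.
  have ptE k : pt k (j k) = l + (j k)%:R * (D * 2^-1 ^+ k).
    by rewrite /pt min_l// (le_trans (jl k)).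
  have cvg_pt : pt k (j k) @[k --> \oo] --> t.
    apply: (@squeeze_cvgr _ _ _ _ (fun k => t - D * 2^-1 ^+ k) (fun=> t)).
    - by apply: nearW => k; rewrite ptE ju jl.
    - rewrite -[X in _ --> X]subr0; apply: cvgB; first exact: cvg_cst.
      rewrite -[X in _ --> X](mulr0 D); apply: cvgM; first exact: cvg_cst.
      apply: cvg_expr; rewrite ger0_norm// invf_lt1// ltr1n//.
    - exact: cvg_cst.
  have cX : X (pt k (j k)) w @[k --> \oo] --> X t w.
    have cc := continuous_comp_clamp01 (let: And4 _ _ _ c := fX in c w).
    have := cvg_comp _ _ cvg_pt (cc t).
    rewrite /= clamp01_id ?t0//.
    rewrite (_ : _ \o _ = (fun k => X (pt k (j k)) w))//.
    apply/funext => k /=; rewrite clamp01_id//.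
    by have /andP[h ->] := pt_a1 k (j k); rewrite (le_trans _ h)// ltW.
  (* at a fine level the dyadic approximation is close to the target, by continuity *)
  have [K RK] : exists K, `|X (pt K (j K)) w - z| <= Rk K.
    have r2 : `|X t w - z| < r * 2 by apply: le_lt_trans Xt _; rewrite ltr_pMr// ltr1n.
    have [N _ /(_ N (leqnn N)) /= hN] : \forall k \near \oo, `|X (pt k (j k)) w - z| < r * 2.
      apply: (@cvgr_lt _ _ _ _ (fun k => `|X (pt k (j k)) w - z|) _ _ _ r2).
      by apply: cvg_norm; apply: cvgB => //; exact: cvg_cst.
    by exists N; rewrite (le_trans (ltW hN)).
  have exK : exists k, `|X (pt k (j k)) w - z| <= Rk k by exists K.
  (* at the first level where it is close, the last increment has been large *)
  case: (ex_minnP exK) => -[|k] hk kmin.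
    left; have : (j 0 < 2)%N by have := jle 0; rewrite expn0.
    case: (j 0) hk => [|[|//]] hk _; [left|right]; exact: le_trans hk (RkR0 0%N).
  have hk' : Rk k < `|X (pt k (j k)) w - z|.
    by rewrite ltNge; apply/negP => /kmin; rewrite ltnn.
  have dR := RkE k.
  have rq : 0 < r * q ^+ k by rewrite mulr_gt0// exprn_gt0.
  case: (jS k) => jE.
    have : pt k.+1 (j k.+1) = pt k (j k).
      by rewrite !ptE jE exprS -muln2 natrM; field.
    move=> ptS; rewrite ptS in hk; exfalso.
    move: hk hk' dR rq; clear; move: (Rk k) (Rk k.+1) (r * _) (`|_|) => x y u v; lra.
  right; exists k => //.
  rewrite -bigcup_mkord; exists (j k) => //=; split=> /=.
    by rewrite -jE (le_trans hk).
  rewrite -jE -dR.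
  move: hk hk'; set u := X (pt k.+1 _) w; set v := X (pt k _) w => h1 h2.
  have h3 : `|v - z| <= `|v - u| + `|u - z| by exact: ler_distD.
  move: h1 h2 h3; clear; move: (Rk k) (Rk k.+1) (`|_ - _|) (`|v - u|) (`|u - z|) => a b c e f; lra.
Qed.

End fbm_hit.

(** * Estimates for all coordinates *)

Section fbm_multidim.
Context {R : realType} dT (T : measurableType dT) (P : probability T R).
Variables (d : nat) (H : R).
Hypothesis H01 : 0 < H < 1.
Variable B : 'I_d -> R -> T -> R.
Hypothesis fB : fbm P H `[0, 1] B.
Let I01 : set R := `[0, 1]%classic.

(** Bounds for the coordinates multiply by independence. *)
Lemma fbm_indep_le (A : 'I_d -> set T) (c : 'I_d -> R) :
  (forall i, process_sigma I01 (B i) (A i)) ->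
  (forall i, (P (A i) <= (c i)%:E)%E) ->
  (P (\bigcap_(i in [set: 'I_d]) A i) <= (\prod_(i < d) c i)%:E)%E.
Proof.
move=> sA PA; have [_ indep] := fB; rewrite indep//.
have c0 i : 0 <= c i by rewrite -lee_fin; exact: le_trans (PA i).
suff /andP[] : (0 <= \prod_(i < d) P (A i) <= (\prod_(i < d) c i)%:E)%E by [].
elim/big_rec2: _ => [|i x y _ /andP[y0 xy]]; first by rewrite lee01 lexx.
by rewrite mule_ge0//= EFinM lee_pmul.
Qed.

Lemma sqr_enorm (x : 'rV[R]_d) : enorm x ^+ 2 = \sum_(i < d) x 0 i ^+ 2.
Proof. by rewrite sqr_sqrtr// sumr_ge0// => i _; rewrite sqr_ge0. Qed.

Lemma enorm_ge0 (x : 'rV[R]_d) : 0 <= enorm x.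
Proof. exact: sqrtr_ge0. Qed.

Lemma rho_ge0 (u v : R * 'rV[R]_d) : 0 <= rho H u v.
Proof. by rewrite le_max enorm_ge0 orbT. Qed.

(** The Gaussian factors of the coordinates multiply to a Gaussian in the
   Euclidean norm of the conditional displacement, which decays faster than
   [rho^-d]; the time part of [rho] is controlled by the conditional
   variance. *)
Lemma fbm_two_point (a Z : R) : (0 < d)%N -> 0 < a <= 1 -> 0 <= Z ->
  exists2 C : R, 0 < C & forall s t (y z : 'rV[R]_d) (e : R),
  a <= s <= 1 -> a <= t <= 1 -> s != t -> 0 < e -> (forall i, `|y 0 i| <= Z) ->
  (P (\bigcap_(i in [set: 'I_d])
       [set w | (`|B i s w - y 0 i| <= e /\ `|B i t w - z 0 i| <= e)%R])
   <= (C * e ^+ (2 * d) / rho H (s, y) (t, z) ^+ d)%:E)%E.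
Proof.
move=> d0 a01 Z0; have /andP[a0 a1] := a01; have /andP[H0 H1] := H01.
have aH : 0 < a `^ H by exact: powR_gt0.
pose g := fbm_gap H a; have g0 : 0 < g by exact: fbm_gap_gt0.
pose k := ball_factor H a.
have k0 : 0 < k by rewrite addr_gt0// invr_gt0.
have dR : 0 < d%:R :> R by rewrite ltr0n.
pose L := 2 * (Z / a `^ H) ^+ 2.
have L0 : 0 <= L by rewrite mulr_ge0// sqr_ge0.
pose C1 := 2 + (1 + d%:R * L) / g.
have C10 : 0 < C1.
  by rewrite addr_gt0// divr_gt0// ltr_pwDl// mulr_ge0// ler0n.
pose C2 := 1 + C1 * d%:R.
have C20 : 0 < C2 by rewrite addr_gt0// mulr_gt0.
pose C3 := 4 * k / a `^ H.
have C30 : 0 < C3 by rewrite divr_gt0// mulr_gt0.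
exists (C3 ^+ d * C2 ^+ d); first by rewrite mulr_gt0// exprn_gt0.
move=> s t y z e sa1 ta1 st e0 yZ.
have /andP[sa s1] := sa1; have /andP[ta t1] := ta1.
have s0 : 0 < s by exact: lt_le_trans sa.
have t0 : 0 < t by exact: lt_le_trans ta.
pose D := `|t - s| `^ H.
have D0 : 0 < D by rewrite powR_gt0// normr_gt0 subr_eq0 eq_sym.
pose M := fbm_scale H a s t e.
have q0 : g * D ^+ 2 <= fbm_cvar H s t by exact: fbm_cvar_ge.
have q0' : 0 <= fbm_cvar H s t by apply: le_trans q0; rewrite mulr_ge0 ?sqr_ge0// ltW.
have M2 : M ^+ 2 = fbm_cvar H s t + (k * e) ^+ 2.
  by rewrite sqr_sqrtr// addr_ge0// sqr_ge0.
have M20 : 0 < M ^+ 2 by rewrite M2 ltr_wpDl// exprn_gt0// mulr_gt0.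
have M0 : 0 < M by rewrite lt0r sqrtr_ge0 andbT; apply: contraTneq M20 => ->; rewrite expr0n ltxx.
pose w0 i := z 0 i - fbm_reg H s t * y 0 i.
pose S := \sum_(i < d) w0 i ^+ 2.
have S0 : 0 <= S by rewrite sumr_ge0// => i _; rewrite sqr_ge0.
pose c (i : 'I_d) := 4 * (e / a `^ H * (k * e / M * bump (M ^- 2) (w0 i))).
apply: le_trans (fbm_indep_le _ (fun i => _ : (_ <= (c i)%:E)%E)) _.
- move=> i; apply: process_sigmaI; apply: process_sigma_ball.
    by rewrite /I01/= in_itv/= (ltW s0).
  by rewrite /I01/= in_itv/= (ltW t0).
- by move=> i; apply: (fbm1_two_point H01 (fB.1 i)).
have -> : \prod_(i < d) c i = C3 ^+ d * e ^+ (2 * d) * (M ^- d * expR (- (S / M ^+ 2) / 2)).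
  transitivity (\prod_(i < d) (C3 * e ^+ 2 * M^-1 * bump (M ^- 2) (w0 i))).
    by apply: eq_bigr => i _; rewrite /c /C3; field; rewrite !gt_eqF.
  have hE : (C3 * e ^+ 2 / M) ^+ d = C3 ^+ d * e ^+ (2 * d) * M ^- d.
    by rewrite (exprM e 2 d); move: (e ^+ 2) => e2; rewrite exprMn exprMn exprVn.
  rewrite big_split/= prodr_const card_ord hE -[LHS]mulrA; congr (_ * (_ * _)).
  rewrite /bump -expR_sum; congr expR.
  rewrite /S big_distrl/= -sumrN big_distrl/=; apply: eq_bigr => i _.
  by rewrite [w0 i ^+ 2 / _]mulrC.
rewrite lee_fin -!mulrA [C2 ^+ d * _]mulrCA; apply: ler_wpM2l; first by rewrite exprn_ge0// ltW.
apply: ler_wpM2l; first by rewrite exprn_ge0// ltW.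
set r := rho _ _ _.
have r0 : 0 < r by rewrite /r /rho lt_max -/D distrC D0.
have r2 : r ^+ 2 <= C1 * (M ^+ 2 + S).
  have DM : D ^+ 2 <= M ^+ 2 / g.
    by rewrite ler_pdivlMr// mulrC M2 (le_trans q0)// lerDl sqr_ge0.
  have hE : enorm (y - z) ^+ 2 <= 2 * S + d%:R * L * (M ^+ 2 / g).
    rewrite sqr_enorm.
    apply: (@le_trans _ _ (\sum_(i < d) (2 * w0 i ^+ 2 + L * (M ^+ 2 / g)))); last first.
      rewrite big_split/= -big_distrr/= sumr_const card_ord -[(L * _) *+ d]mulr_natl.
    by apply: eq_ler; congr (_ + _); exact: mulrA.
    apply: ler_sum => i _; rewrite !mxE.
    have -> : y 0 i - z 0 i = - (w0 i) + (1 - fbm_reg H s t) * y 0 i by rewrite /w0; ring.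
    set v := (1 - _) * _.
    have hv : v ^+ 2 <= (Z / a `^ H) ^+ 2 * (M ^+ 2 / g).
      apply: (@le_trans _ _ ((Z / a `^ H) ^+ 2 * D ^+ 2)); last by rewrite ler_wpM2l ?sqr_ge0.
      rewrite -exprMn -(real_normK (num_real v)); apply: lerXn2r; rewrite ?nnegrE//.
        by rewrite mulr_ge0 ?divr_ge0 ?(ltW aH) ?(ltW D0).
      rewrite normrM [leRHS](_ : _ = D / a `^ H * Z); last by ring.
      apply: ler_pM => //; apply: le_trans (fbm_reg_close H01 a01 sa1 ta1) _.
      rewrite -/D ler_wpM2l ?(ltW D0)// lef_pV2 ?posrE ?powR_gt0//.
      by apply: (le_powRH H01) => //; exact: ltW.
    rewrite /L -[2 * _ * _]mulrA; have := sqr_ge0 (w0 i + v); move: hv; move: (v) (w0 i) => v' w'.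
    by move: (_ * (M ^+ 2 / g)) => K; lra.
  have Mg : 0 <= M ^+ 2 / g by rewrite divr_ge0 ?sqr_ge0 ?ltW.
  have dL : 0 <= d%:R * L by rewrite mulr_ge0 ?ler0n.
  have gS : 0 <= (1 + d%:R * L) / g * S by rewrite !mulr_ge0 ?invr_ge0 ?addr_ge0 ?(ltW g0).
  have -> : C1 * (M ^+ 2 + S) = 2 * M ^+ 2 + 2 * S + M ^+ 2 / g + d%:R * L * (M ^+ 2 / g) + (1 + d%:R * L) / g * S.
    by rewrite /C1; field; rewrite gt_eqF.
  have := mulr_ge0 dL Mg; have M2' := sqr_ge0 M.
  move: hE DM Mg gS S0; move: (d%:R * L) => dl.
  rewrite /r /rho/= distrC -/D; case: (leP D (enorm (y - z))) => _; lra.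
rewrite ler_pdivlMr ?exprn_gt0//.
(* [r^2 <= C1 M^2 (1 + u)] with [u = S / M^2], and [1 + u <= d exp (u / d)] *)
have key : r ^+ d <= C2 ^+ d * M ^+ d * expR (S / M ^+ 2 / 2).
  rewrite -(@ler_pXn2r _ 2)//; last 2 first.
  - by rewrite nnegrE exprn_ge0// ltW.
  - by rewrite nnegrE !mulr_ge0 ?exprn_ge0 ?expR_ge0 ?ltW.
  have CMS : 0 <= C1 * (M ^+ 2 + S) by apply: mulr_ge0; rewrite ?(ltW C10)// addr_ge0// sqr_ge0.
  rewrite !exprMn -expRM_natl -!exprM ![(d * 2)%N]mulnC !exprM.
  apply: (@le_trans _ _ ((C1 * (M ^+ 2 + S)) ^+ d)).
    by apply: lerXn2r r2; rewrite nnegrE// sqr_ge0.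
  pose u := S / M ^+ 2; have u0 : 0 <= u by rewrite divr_ge0 ?sqr_ge0.
  have -> : 2%:R * (S / M ^+ 2 / 2) = d%:R * (u / d%:R) by rewrite /u; field; rewrite !gt_eqF.
  rewrite expRM_natl -!exprMn; apply: lerXn2r; rewrite ?nnegrE.
  - exact: CMS.
  - by apply: mulr_ge0; [exact: sqr_ge0|exact: expR_ge0].
  have -> : M ^+ 2 + S = M ^+ 2 * (1 + u) by rewrite /u; field; rewrite gt_eqF.
  have h1 : 1 + u <= d%:R * expR (u / d%:R).
    apply: (@le_trans _ _ (d%:R * (1 + u / d%:R))).
      rewrite mulrDr mulr1 mulrCA mulfV ?gt_eqF// mulr1 lerD2r.
      by rewrite ler1n.
    by rewrite ler_wpM2l ?ler0n// expR_ge1Dx.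
  apply: (@le_trans _ _ (C1 * (M ^+ 2 * (d%:R * expR (u / d%:R))))).
    by rewrite ler_wpM2l ?(ltW C10)// ler_wpM2l ?sqr_ge0.
  rewrite (_ : _ * _ = C1 * d%:R * (M ^+ 2 * expR (u / d%:R))); last by ring.
  rewrite exprMn -[leRHS]mulrA; apply: ler_wpM2r.
    by apply: mulr_ge0; [exact: sqr_ge0|exact: expR_ge0].
  by rewrite /C2; have := mulr_ge0 (ltW C10) (ltW dR); move: (C1 * _) => x x0; nra.
have Md : M ^+ d != 0 by rewrite gt_eqF// exprn_gt0.
have w1 : 0 <= M ^- d * expR (- (S / M ^+ 2) / 2).
  by apply: mulr_ge0; [rewrite invr_ge0 exprn_ge0// ltW|exact: expR_ge0].
apply: le_trans (ler_wpM2l w1 key) _; apply: eq_ler.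
rewrite mulNr expRN; have : expR (S / M ^+ 2 / 2) != 0 by rewrite gt_eqF// expR_gt0.
move: (expR _) (C2 ^+ d) (M ^+ d) Md => u v m m0 u0.
by field; rewrite m0 u0.
Qed.

(** The event [A] is a superset of the event of hitting the box, which need not
   be measurable a priori. *)
Lemma fbm_hit (a Z : R) : 0 < a <= 1 -> 0 <= Z ->
  exists2 C : R, 0 < C & forall (l r : R) (z : 'rV[R]_d),
  a <= l <= 1 -> 0 < r <= 1 -> (forall i, `|z 0 i| <= Z) ->
  exists A : set T, [/\ measurable A, (P A <= (C * r ^+ d)%:E)%E &
    forall w t, l <= t -> t <= 1 -> t <= l + 2 * r `^ H^-1 ->
      (forall i, `|B i t w - z 0 i| <= r) -> A w].
Proof.
move=> a01 Z0.
have /choice[C hC] : forall i : 'I_d, exists C : R, 0 < C /\ forall l r z : R,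
    a <= l <= 1 -> 0 < r <= 1 -> `|z| <= Z ->
    exists A : set T, [/\ process_sigma I01 (B i) A, (P A <= (C * r)%:E)%E &
    forall w t, l <= t -> t <= 1 -> t <= l + 2 * r `^ H^-1 -> `|B i t w - z| <= r -> A w].
  by move=> i; have [C C0 h] := fbm1_hit H01 (fB.1 i) a01 Z0; exists C.
exists (\prod_(i < d) C i); first by apply: prodr_gt0 => i _; exact: (hC i).1.
move=> l r z al r01 zZ.
have /choice[A hA] : forall i : 'I_d, exists A : set T,
    [/\ process_sigma I01 (B i) A, (P A <= (C i * r)%:E)%E &
    forall w t, l <= t -> t <= 1 -> t <= l + 2 * r `^ H^-1 -> `|B i t w - z 0 i| <= r -> A w].
  by move=> i; exact: (hC i).2.
exists (\bigcap_(i in [set: 'I_d]) A i); split.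
- apply: fin_bigcap_measurable; first exact: finite_finset.
  move=> i _; have [sA _ _] := hA i; apply: process_sigma_measurable sA => t It.
  by have [[+ _] _ _ _] := fB.1 i; exact.
- apply: le_trans (fbm_indep_le _ _) _.
  + by move=> i; have [+ _ _] := hA i; exact.
  + by move=> i; have [_ + _] := hA i; exact.
  by rewrite lee_fin big_split/= prodr_const card_ord.
- by move=> w t lt t1 tr Bz i _; have [_ _ h] := hA i; exact: (h w t).
Qed.

(** The variances [t^(2H)] are between [a^(2H)] and [1]. *)
Lemma fbm_one_point (a Z : R) : 0 < a -> 0 <= Z ->
  exists2 c : R, 0 < c & forall t (y : 'rV[R]_d) (e : R),
  a <= t <= 1 -> 0 < e <= 1 -> (forall i, `|y 0 i| <= Z) ->
  ((c * e ^+ d)%:E <= P (\bigcap_(i in [set: 'I_d]) [set w | (`|B i t w - y 0 i| <= e)%R]))%E.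
Proof.
move=> a0 Z0; have aH2 : 0 < (a `^ H) ^+ 2 by rewrite exprn_gt0// powR_gt0.
have [c c0 hc] := @centered_gaussian_interval R _ T P _ _ aH2 Z0.
exists (c ^+ d) => [|t y e /andP[ta t1] e01 yZ]; first exact: exprn_gt0.
have t0 : 0 < t by exact: lt_le_trans ta.
have t01 : 0 <= t <= 1 by rewrite ltW.
have [_ ->] := fB; last first.
  by move=> i; apply: process_sigma_ball; rewrite /= in_itv/= t01.
have e0 : 0 <= c * e by apply: mulr_ge0; [exact: ltW|case/andP: e01 => /ltW].
suff h i : ((c * e)%:E <= P [set w | (`|B i t w - y 0 i| <= e)%R])%E.
  rewrite -exprMn -[d in X in (X <= _)%E]card_ord -prodr_const.
  suff /andP[] : (0 <= (\prod_(i < d) (c * e))%:E <= \prod_(i < d) P [set w | (`|B i t w - y 0 i| <= e)%R])%E by [].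
  elim/big_rec2: _ => [|i p q _ /andP[p0 pq]]; first by rewrite lee01 lexx.
  by rewrite EFinM mule_ge0//= lee_pmul.
apply: (hc (B i t) (fbm_cov H t t)) => //.
  have -> : B i t = (fun w => 1 * B i t w + 0 * B i t w).
    by apply/funext => w; rewrite mul1r mul0r addr0.
  rewrite [X in centered_gaussian _ _ X](_ : _ = 1 ^+ 2 * fbm_cov H t t + 2 * 1 * 0 * fbm_cov H t t + 0 ^+ 2 * fbm_cov H t t).
    exact: (fbm1_lincomb (fB.1 i)).
  by rewrite expr1n expr0n/=; ring.
rewrite fbm_var ?(ltW t0)//; apply/andP; split; last by rewrite exprn_ile1 ?powR_ge0// powRH_le1.
by apply: lerXn2r; rewrite ?nnegrE ?powR_ge0//; apply: (le_powRH H01) => //; exact: ltW.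
Qed.

End fbm_multidim.

(** * Analytic sets *)

Lemma exists_inv_lt (R : realType) (e : R) : 0 < e -> exists n : nat, n.+1%:R^-1 < e.
Proof.
move=> e0; exists (Num.truncn e^-1); rewrite -[ltRHS]invrK ltf_pV2 ?posrE ?invr_gt0//.
exact: truncnS_gt.
Qed.

(** Dependent choice along the finite prefixes of a sequence. *)
Lemma seq_choice (Q : seq nat -> Prop) : Q [::] ->
  (forall s, Q s -> exists M, Q (rcons s M)) -> exists m : nat -> nat, forall k, Q (mkseq m k).
Proof.
move=> Q0 QS.
have /choice[g hg] : forall s, exists M, Q s -> Q (rcons s M).
  by move=> s; have [/QS[M QM]|nQ] := pselect (Q s); [exists M|exists 0%N].
pose st k := iter k (fun s => rcons s (g s)) [::].
exists (fun k => g (st k)) => k.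
have -> : mkseq (fun k => g (st k)) k = st k.
  by elim: k => [//|k IH]; rewrite mkseqS IH.
by elim: k => [//|k IH] /=; exact: hg.
Qed.

Section analytic_sets.
Context {R : realType} {X : pseudoMetricType R}.

(** Suslin schemes are usually indexed by finite sequences; here the set of level
   [n] is a function of an infinite sequence that reads its first [n] terms. *)
Definition suslin_scheme (F : nat -> (nat -> nat) -> set X) :=
  (forall n s, closed (F n s)) /\
  (forall n s s', (forall i, (i < n)%N -> s i = s' i) -> F n s = F n s').

Definition analytic (A : set X) := exists2 F, suslin_scheme F &
  A = [set x | exists s, forall n, F n s x].

Lemma closed_analytic (C : set X) : closed C -> analytic C.
Proof.
move=> cC; exists (fun _ _ => C); first by split.
by apply/seteqP; split=> [x Cx|x [_ /(_ 0%N)]//]; exists (fun=> 0%N).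
Qed.

(** The first term of the sequence selects the set. *)
Lemma bigcup_analytic (A : nat -> set X) : (forall k, analytic (A k)) ->
  analytic (\bigcup_k A k).
Proof.
move=> aA; have /choice[F hF] : forall k, exists F, suslin_scheme F /\
    A k = [set x | exists s, forall n, F n s x].
  by move=> k; have [F sF AF] := aA k; exists F.
exists (fun n s => if n is m.+1 then F (s 0%N) m (s \o S) else setT).
  split=> [[|n] s|[|n] s s' ss']//.
    by case: (hF (s 0%N)) => -[+ _ _]; exact.
  rewrite ss'//; case: (hF (s' 0%N)) => -[_ h] _; apply: h => i im /=.
  exact: ss'.
apply/seteqP; split=> [x [k _]|x [s hs]].
  rewrite (hF k).2 => -[s hs]; exists (fun i => if i is j.+1 then s j else k) => -[//|n].
  exact: (hs n).
by exists (s 0%N) => //; rewrite (hF _).2; exists (s \o S) => n; exact: (hs n.+1).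
Qed.

(** One sequence encodes countably many: its terms are shared out along an
   injection of [nat * nat] into [nat], and a condition is imposed as soon as
   all terms that it reads are available. *)
Lemma bigcap_analytic (A : nat -> set X) : (forall k, analytic (A k)) ->
  analytic (\bigcap_k A k).
Proof.
move=> aA; have /choice[F hF] : forall k, exists F, suslin_scheme F /\
    A k = [set x | exists s, forall n, F n s x].
  by move=> k; have [F sF AF] := aA k; exists F.
pose code (k i : nat) : nat := pickle (k, i).
pose J n := [set km : nat * nat | forall i, (i < km.2)%N -> (code km.1 i < n)%N].
exists (fun n s => \bigcap_(km in J n) F km.1 km.2 (fun i => s (code km.1 i))).
  split=> [n s|n s s' ss'].
    by apply: closed_bigI => -[k m] _; case: (hF k) => -[+ _ _]; exact.
  apply: eq_bigcapr => -[k m] /= h; case: (hF k) => -[_ hk] _; apply: hk => i im.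
  by apply: ss'; exact: h.
apply/seteqP; split=> [x Ax|x [s hs] k _].
  have /choice[s hs] : forall k, exists s, forall n, F k n s x.
    by move=> k; have := Ax k I; rewrite (hF k).2.
  exists (fun j => if unpickle j is Some ki then s ki.1 ki.2 else 0%N) => n [k m] /= _.
  rewrite (_ : (fun i => _) = s k); first exact: hs.
  by apply/funext => i; rewrite /code pickleK.
rewrite (hF k).2; exists (fun i => s (code k i)) => m.
have [n hn] : exists n, forall i, (i < m)%N -> (code k i < n)%N.
  exists (\sum_(i < m) (code k i).+1)%N => i im.
  by rewrite (bigD1 (Ordinal im))//= leq_addr.
exact: (hs n (k, m)).
Qed.

(** An open set is the union of the closures of the sets of points at distance
   at least [1 / n] from its complement. *)
Lemma open_analytic (U : set X) : open U -> analytic U.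
Proof.
move=> oU.
have -> : U = \bigcup_n closure [set x | ball x n.+1%:R^-1 `<=` U].
  apply/seteqP; split=> [x Ux|x [n _ clx]].
    have /nbhs_ballP[e /= e0 xU] : nbhs x U by exact: open_nbhs_nbhs.
    have [n ne] := exists_inv_lt e0.
    exists n => //; apply: subset_closure => /= y xy; apply: xU.
    by apply: le_ball xy; exact: ltW.
  have n0 : 0 < n.+1%:R^-1 :> R by rewrite invr_gt0.
  have [y [yU xy]] := clx _ (nbhsx_ballx x _ n0).
  by apply: yU; exact: ball_sym.
by apply: bigcup_analytic => n; apply: closed_analytic; exact: closed_closure.
Qed.

(** Analytic sets are not closed under complement, but the sets that are analytic
   together with their complement form a sigma-algebra. *)
Definition bianalytic (A : set X) := analytic A /\ analytic (~` A).

Lemma open_bianalytic (U : set X) : open U -> bianalytic U.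
Proof. by move=> oU; split; [exact: open_analytic|exact/closed_analytic/open_closedC]. Qed.

Lemma sigma_algebra_bianalytic : sigma_algebra setT bianalytic.
Proof.
split=> [|A [aA aC]|A aA].
- by split; [exact/closed_analytic/closed0|rewrite setC0; exact/closed_analytic/closedT].
- by rewrite setTD; split; rewrite ?setCK.
- split; first by apply: bigcup_analytic => k; exact: (aA k).1.
  by rewrite setC_bigcup; apply: bigcap_analytic => k; exact: (aA k).2.
Qed.

End analytic_sets.

(** * Capacitability *)

Lemma le_mkseq (m : nat -> nat) k s : mkseq m k = mkseq s k -> forall i, (i < k)%N -> m i = s i.
Proof.
by move=> e i ik; have := congr1 (nth 0%N ^~ i) e; rewrite !nth_mkseq.
Qed.

Section choquet.
Context {R : realType} {X : pseudoMetricType R}.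

(** Only finitely many prefixes of length [k] are bounded by [m]. *)
Lemma closed_bounded_union k (m : nat -> nat) (G : (nat -> nat) -> set X) :
  (forall s, closed (G s)) ->
  (forall s s', (forall i, (i < k)%N -> s i = s' i) -> G s = G s') ->
  closed [set x | exists s, (forall i, (s i <= m i)%N) /\ G s x].
Proof.
elim: k m G => [|k IH] m G cG eqG.
  rewrite (_ : [set x | _] = G m)//; apply/seteqP; split=> [x [s [_]]|x Gx].
    by rewrite (eqG s m).
  by exists m.
pose cons (j : nat) s := fun i => if i is i'.+1 then s i' else j : nat.
rewrite (_ : [set x | _] = \bigcup_(j in `I_(m 0%N).+1)
    [set x | exists s, (forall i, (s i <= m i.+1)%N) /\ G (cons j s) x]).
  apply: closed_bigcup; first exact: finite_II.
  move=> j _; apply: (IH (m \o S) (fun s => G (cons j s))) => [s|s s' ss']//.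
  by apply: eqG => -[//|i] ik; exact: ss'.
apply/seteqP; split=> [x [s [sm Gx]]|x [j /= jm [s [sm Gx]]]].
  exists (s 0%N); first by rewrite /= ltnS.
  exists (s \o S); split=> [i|]; first exact: sm.
  by rewrite (eqG _ s)// => -[].
by exists (cons j s); split=> // -[|i] //=; rewrite -ltnS.
Qed.

(** Capacitability: [big] stands for having capacity above a level. The terms
   of a branch through a point of the analytic set are bounded one after the
   other without losing bigness; all branches below such bounds form a compact
   set, and by Koenig's lemma what remains is in the analytic set. *)
Lemma analytic_closed_approx (big : set X -> Prop) (A K : set X) :
  (forall S S', S `<=` S' -> big S -> big S') ->
  (forall S : nat -> set X, (forall n, S n `<=` S n.+1) -> big (\bigcup_n S n) ->
     exists n, big (S n)) ->
  analytic A -> A `<=` K -> closed K -> big A ->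
  exists Q : nat -> set X, [/\ forall k, closed (Q k), forall k, Q k.+1 `<=` Q k,
    forall k, Q k `<=` K, \bigcap_k Q k `<=` A & forall k, big (Q k)].
Proof.
move=> bigS bigU [F [cF eF] AE] AK cK bigA.
pose br (p : seq nat) := [set x | K x /\ exists s,
  (forall i, (i < size p)%N -> (s i <= nth 0 p i)%N) /\ forall n, F n s x].
(* [br p]: the points reached by a branch whose first terms are bounded by [p] *)
have [m hm] : exists m, forall k, big (br (mkseq m k)).
  apply: (@seq_choice (fun p => big (br p))) => [|p bp].
    apply: bigS bigA => x Ax; split; first exact: AK.
    by move: Ax; rewrite AE => -[s hs]; exists s.
  apply: (bigU (fun M => br (rcons p M))) => [M x [Kx [s [sp Fs]]]|].
    split=> //; exists s; split=> // i; rewrite size_rcons ltnS => ip.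
    have := sp i; rewrite size_rcons ltnS => /(_ ip); rewrite !nth_rcons.
    case: ifP => // _; case: ifP => // _ h; exact: leqW.
  apply: bigS bp => x [Kx [s [sp Fs]]]; exists (s (size p)) => //; split=> //; exists s.
  split=> // i; rewrite size_rcons ltnS nth_rcons leq_eqVlt => /orP[/eqP->|ip].
    by rewrite ltnn eqxx.
  by rewrite ip; exact: sp.
pose G k s := \bigcap_(n in `I_k.+1) F n s.
exists (fun k => K `&` [set x | exists s, (forall i, (s i <= m i)%N) /\ G k s x]); split.
- move=> k; apply: closedI => //; apply: (@closed_bounded_union k) => [s|s s' ss'].
    by apply: closed_bigI => n _; exact: cF.
  apply: eq_bigcapr => n /=; rewrite ltnS => nk; apply: eF => i ni; apply: ss'.
  exact: leq_trans nk.
- move=> k x [Kx [s [sm Gx]]]; split=> //; exists s; split=> // n nk; apply: Gx.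
  exact: leqW.
- by move=> k x [].
- move=> x hx.
  have {}hx k : exists s, (forall i, (s i <= m i)%N) /\ G k s x.
    by have [_] := hx k I.
  (* Koenig's lemma: a prefix extended by good sequences of every depth has such an extension *)
  have [t ht] : exists t, forall j k, exists s, [/\ forall i, (s i <= m i)%N,
      mkseq s j = mkseq t j & G k s x].
    suff [t ht] : exists t, forall j, forall k, exists s, [/\ forall i, (s i <= m i)%N,
      mkseq s (size (mkseq t j)) = mkseq t j & G k s x].
      by exists t => j k; have [s] := ht j k; rewrite size_mkseq; exists s.
    apply: (@seq_choice (fun p => forall k, exists s, [/\ forall i, (s i <= m i)%N,
      mkseq s (size p) = p & G k s x])) => [k|p hp].
      by have [s [sm Gx]] := hx k; exists s.
    apply: contrapT => /forallNP nP.
    have /choice[kk hkk] : forall M, exists k, ~ exists s, [/\ forall i, (s i <= m i)%N,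
        mkseq s (size (rcons p M)) = rcons p M & G k s x].
      by move=> M; apply/existsNP; exact: nP.
    pose q := m (size p); have [s [sm sp Gx]] := hp (\max_(M < q.+1) kk M)%N.
    apply: (hkk (s (size p))); exists s; split=> //.
      by rewrite size_rcons mkseqS sp.
    move=> n /= nk; apply: Gx => /=; rewrite ltnS; move: nk; rewrite ltnS => nk.
    apply: leq_trans nk _.
    have sq : (s (size p) < q.+1)%N by rewrite ltnS.
    exact: (leq_bigmax (Ordinal sq)).
  rewrite AE; exists t => n; have [s [_ st Gx]] := ht n n.
  rewrite -(eF n s); first by apply: Gx => /=.
  exact: le_mkseq.
- move=> k; apply: bigS (hm k) => x [Kx [s [sm Fx]]]; split=> //.
  exists (fun i => if (i < k)%N then s i else 0%N); split=> [i|n /=].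
    by case: ifP => // ik; have := sm i; rewrite size_mkseq nth_mkseq// => /(_ ik).
  rewrite ltnS => nk; rewrite -(eF n s) // => i ni.
  by rewrite (leq_trans ni nk).
Qed.

(** Compactness in the form used below: a sequence of conditions that fail near
   each point from some index on fails everywhere at a common index. *)
Lemma compact_escape (K : set X) (C : nat -> set X) : compact K ->
  (forall x, K x -> exists n, exists2 V, nbhs x V & forall m y, (n <= m)%N -> V y -> ~ C m y) ->
  exists n, forall x, K x -> ~ C n x.
Proof.
move=> /compact_near_coveringP cK hC.
have [//|n _ hn] := cK nat \oo (fun n x => ~ C n x) _.
  move=> x /hC[n [V xV hV]]; exists (V, [set m | (n <= m)%N]) => /=.
    by split=> //; exists n.
  by move=> [y m] /= [Vy nm]; exact: hV.
by exists n => x Kx; exact: (hn n (leqnn n)).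
Qed.

Lemma compact_net (K : set X) (e : R) : compact K -> 0 < e ->
  exists S : set X, [/\ finite_set S, S `<=` K & forall x, K x -> exists2 k, S k & ball k e x].
Proof.
move=> /compact_near_coveringP cK e0.
pose F (G : set (set X)) := exists S0 : set X,
  [/\ finite_set S0, S0 `<=` K & forall S, S0 `<=` S -> G S].
have FF : Filter F.
  split=> [|G1 G2 [S1 [f1 K1 h1]] [S2 [f2 K2 h2]]|G1 G2 G12 [S [fS KS h]]].
  - by exists set0; split=> // x [].
  - exists (S1 `|` S2); split; first by rewrite finite_setU.
      by move=> x [/K1|/K2].
    by move=> S h; split; [apply: h1|apply: h2] => x Sx; apply: h; [left|right].
  - by exists S; split=> // S' SS'; apply: G12; exact: h.
have [x Kx|S [fS SK hS]] := cK _ F (fun S x => exists2 k, S k & ball k e x) FF.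
  exists (ball x e, [set S | S x]) => /=.
    split; first exact: nbhsx_ballx.
    exists [set x]; split; [exact: finite_set1|by move=> _ ->|by move=> S h; exact: h].
  by move=> [y S] /= [xy Sx]; exists x.
by exists S; split=> //; exact: hS.
Qed.

End choquet.

(** * Hitting events of random closed sets *)

Section random_closed_set.
Context {R : realType} {X : pseudoMetricType R} dT (T : measurableType dT).
Context (P : probability T R).

(** The probability of the smallest measurable cover; it is continuous along
   increasing unions of arbitrary sets, as a capacity has to be. *)
Definition outer_prob (S : set T) : \bar R :=
  ereal_inf [set P U | U in [set U | measurable U /\ S `<=` U]].

Lemma outer_prob_le (S U : set T) : measurable U -> S `<=` U -> (outer_prob S <= P U)%E.
Proof. by move=> mU SU; apply: ereal_inf_lbound; exists U. Qed.

Lemma le_outer_prob (S S' : set T) : S `<=` S' -> (outer_prob S <= outer_prob S')%E.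
Proof.
move=> SS'; apply: le_ereal_inf_tmp => _ [U [mU S'U] <-]; apply: outer_prob_le => //.
exact: subset_trans S'U.
Qed.

Lemma outer_prob_fin (S : set T) : outer_prob S \is a fin_num.
Proof.
rewrite ge0_fin_numE; first by apply: le_lt_trans (outer_prob_le measurableT _) _ => //;
  rewrite probability_setT ltry.
by apply: le_ereal_inf_tmp => _ [U _ <-].
Qed.

Lemma outer_prob_meas (S : set T) : measurable S -> outer_prob S = P S.
Proof.
move=> mS; apply/eqP; rewrite eq_le outer_prob_le//=.
by apply: le_ereal_inf_tmp => _ [U [mU SU] <-]; apply: le_measure => //; rewrite inE.
Qed.

(** Near-optimal measurable covers of the [S n] are made increasing by
   intersecting each with its successors. *)
Lemma outer_prob_cont (S : nat -> set T) (l : R) : (forall n, S n `<=` S n.+1) ->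
  (l%:E < outer_prob (\bigcup_n S n))%E -> exists n, (l%:E < outer_prob (S n))%E.
Proof.
move=> ndS lS; apply: contrapT => /forallNP nl.
have /choice[U hU] : forall n, exists U,
    [/\ measurable U, S n `<=` U & (P U < (l + n.+1%:R^-1)%:E)%E].
  move=> n; have /negP := nl n; rewrite -leNgt => h.
  have /ereal_inf_lt[_ [U [mU SU] <-] Ul] : (outer_prob (S n) < (l + n.+1%:R^-1)%:E)%E.
    by apply: le_lt_trans h _; rewrite lte_fin ltrDl invr_gt0.
  by exists U.
have ndS' m n : (m <= n)%N -> S m `<=` S n.
  by move=> /subnK <-; elim: (n - m)%N => // k IH; exact: subset_trans (ndS _).
pose V n := \bigcap_k U (n + k)%N.
have mV n : measurable (V n) by apply: bigcapT_measurable => k; case: (hU (n + k)%N).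
have Vl n : (P (V n) <= l%:E)%E.
  apply/lee_addgt0Pr => e e0; have [k ke] := exists_inv_lt e0.
  have [mU _ Ul] := hU (n + k)%N.
  apply: (@le_trans _ _ (P (U (n + k)%N))).
    by apply: le_measure; rewrite ?inE//; exact: bigcap_inf.
  apply: ltW; apply: lt_le_trans Ul _; rewrite -EFinD lee_fin lerD2l.
  apply: le_trans (ltW ke); rewrite lef_pV2 ?posrE// ler_nat ltnS; exact: leq_addl.
have mVU : measurable (\bigcup_n V n) by exact: bigcupT_measurable.
have SV : \bigcup_n S n `<=` \bigcup_n V n.
  move=> w [n _ Sw]; exists n => // k _; have [_ + _] := hU (n + k)%N; apply.
  by apply: ndS' Sw; exact: leq_addr.
have := lt_le_trans lS (outer_prob_le mVU SV); rewrite ltNge => /negP; apply.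
have ndV : {homo V : n m / (n <= m)%N >-> (n <= m)%O}.
  move=> n m nm; apply/subsetPset => w Vw k _; have := Vw (m - n + k)%N I.
  by rewrite addnA subnKC.
have cV := nondecreasing_cvg_mu (mu := P) mV mVU ndV.
rewrite -(cvg_lim _ cV)//; apply: lime_le; first by apply/cvg_ex; exists (P (\bigcup_n V n)).
by apply: nearW => n; exact: Vl.
Qed.

Variable xi : nat -> T -> X.
Hypothesis mxi : forall j k r, 0 < r -> measurable [set w | ball k r (xi j w)].

(** A random closed set is given by a sequence of random points that is dense in
   it, so that meeting a compact set is a countable condition. *)
Definition hits (A : set X) : set T :=
  [set w | exists2 u, A u & closure (range (xi^~ w)) u].

Lemma hitsS (A A' : set X) : A `<=` A' -> hits A `<=` hits A'.
Proof. by move=> AA' w [u Au]; exists u => //; exact: AA'. Qed.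

Lemma hits_bigcup (A : nat -> set X) : hits (\bigcup_n A n) = \bigcup_n hits (A n).
Proof.
apply/seteqP; split=> [w [u [n _ Au] cu]|w [n _ [u Au cu]]]; first by exists n => //; exists u.
by exists u => //; exists n.
Qed.

(** A compact set is met when, for each [n], one of the points [xi j] is within
   [2 / n] of one of the points of a finite [1 / n]-net. *)
Lemma measurable_hits (K : set X) : compact K -> measurable (hits K).
Proof.
move=> cK; have r0 n : 0 < n.+1%:R^-1 :> R by rewrite invr_gt0.
have /choice[S hS] : forall n, exists S : set X, [/\ finite_set S, S `<=` K &
    forall x, K x -> exists2 k, S k & ball k n.+1%:R^-1 x].
  by move=> n; exact: compact_net.
rewrite (_ : hits K = \bigcap_n \bigcup_j \bigcup_(k in S n)
    [set w | ball k (n.+1%:R^-1 + n.+1%:R^-1) (xi j w)]).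
  apply: bigcapT_measurable => n; apply: bigcupT_measurable => j.
  by apply: fin_bigcup_measurable => [|k _]; [by have [] := hS n|apply: mxi; rewrite addr_gt0].
apply/seteqP; split=> [w [u Ku cu] n _|w hw].
  have [_ _ /(_ u Ku)[k Sk ku]] := hS n.
  have [_ [[j _ <-] uj]] := cu _ (nbhsx_ballx u _ (r0 n)).
  by exists j => //; exists k => //; exact: ball_triangle uj.
apply: contrapT => nhw.
pose C n := [set k | exists j, ball k (n.+1%:R^-1 + n.+1%:R^-1) (xi j w)].
have [|n hn] := @compact_escape _ _ K C cK.
  move=> x Kx.
  have /nbhs_ballP[e /= e0 xe] : nbhs x (~` closure (range (xi^~ w))).
    apply: open_nbhs_nbhs; split; first exact/closed_openC/closed_closure.
    by move=> cx; apply: nhw; exists x.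
  have [n ne] := exists_inv_lt (divr_gt0 e0 (ltr0n _ 3)).
  exists n; exists (ball x (e / 3)); first by apply: nbhsx_ballx; rewrite divr_gt0.
  move=> m y nm xy [j yj]; apply: (xe (xi j w)); last by apply: subset_closure; exists j.
  apply: (@le_ball _ _ _ (e / 3 + (m.+1%:R^-1 + m.+1%:R^-1))); last exact: ball_triangle yj.
  have : m.+1%:R^-1 <= n.+1%:R^-1 :> R by rewrite lef_pV2 ?posrE// ler_nat ltnS.
  by move: (m.+1%:R^-1) (n.+1%:R^-1) ne => u v; lra.
have [j _ [k Sk kj]] := hw n I; have [_ SK _] := hS n.
by apply: (hn k (SK k Sk)); exists j.
Qed.

Lemma hits_bigcap_compact (K : set X) (Q : nat -> set X) : compact K ->
  (forall k, closed (Q k)) -> (forall k, Q k.+1 `<=` Q k) -> (forall k, Q k `<=` K) ->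
  \bigcap_k hits (Q k) `<=` hits (\bigcap_k Q k).
Proof.
move=> cK cQ ndQ QK w hw; apply: contrapT => nhw.
have ndQ' m n : (m <= n)%N -> Q n `<=` Q m.
  by move=> /subnK <-; elim: (n - m)%N => // k IH; exact: subset_trans (ndQ _) IH.
pose W := closure (range (xi^~ w)).
have [|n hn] := @compact_escape _ _ K (fun k => Q k `&` W) cK.
  move=> x Kx; have [Wx|nWx] := pselect (W x); last first.
    exists 0%N; exists (~` W); last by move=> m y _ nW [].
    by apply: open_nbhs_nbhs; split=> //; exact/closed_openC/closed_closure.
  have /existsNP[n nQ] : ~ forall k, Q k x.
    by move=> Qx; apply: nhw; exists x => // k _; exact: Qx.
  exists n; exists (~` Q n); last by move=> m y nm nQy [/(ndQ' _ _ nm)].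
  by apply: open_nbhs_nbhs; split=> //; exact/closed_openC.
by have [u Qu cu] := hw n I; apply: (hn u (QK n u Qu)).
Qed.

(** The outer probability of hitting is a capacity: it is continuous along
   increasing unions and along decreasing sequences of compact sets. *)
Lemma analytic_hits_approx (A K0 : set X) (e : R) : hausdorff_space X ->
  analytic A -> compact K0 -> A `<=` K0 -> 0 < e ->
  exists K U, [/\ compact K, K `<=` A, measurable U, hits A `<=` U &
    (P U <= P (hits K) + e%:E)%E].
Proof.
move=> hX aA cK0 AK0 e0; have fA := outer_prob_fin (hits A).
have cl0 := compact_closed hX cK0.
pose s := fine (outer_prob (hits A)).
have sE : outer_prob (hits A) = s%:E by rewrite fineK.
have [|||Q [cQ ndQ QK QA lQ]] := @analytic_closed_approx _ _
    (fun S => ((s - e / 2)%:E < outer_prob (hits S))%E) A K0 _ _ aA AK0 cl0.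
- by move=> S S' SS' h; apply: lt_le_trans h _; apply: le_outer_prob; exact: hitsS.
- move=> S ndS; rewrite hits_bigcup; apply: outer_prob_cont => n; exact: hitsS.
- by rewrite sE lte_fin; lra.
have cQ' k : compact (Q k) by exact: subclosed_compact (cQ k) cK0 (QK k).
have cQQ : compact (\bigcap_k Q k).
  apply: subclosed_compact cK0 _; first exact: closed_bigI.
  by move=> x /(_ 0%N I); exact: QK.
have [_ [U [mU AU] <-] Us] : exists2 y, [set P U | U in [set U | measurable U /\ hits A `<=` U]] y &
    (y < (s + e / 2)%:E)%E.
  by apply: ereal_inf_lt; rewrite -/(outer_prob _) sE lte_fin; lra.
exists (\bigcap_k Q k), U; split=> //.
have mQ k : measurable (hits (Q k)) by exact: measurable_hits.
have mQQ : measurable (\bigcap_k hits (Q k)) by exact: bigcapT_measurable.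
have ndQ' : {homo (fun k => hits (Q k)) : n m / (n <= m)%N >-> (m <= n)%O}.
  apply/nonincreasing_seqP => n; apply/subsetPset; exact: hitsS.
have h : ((s - e / 2)%:E <= P (hits (\bigcap_k Q k)))%E.
  apply: (@le_trans _ _ (P (\bigcap_k hits (Q k)))).
    have PQ0 : (P (hits (Q 0%N)) < +oo)%E by apply: le_lt_trans (probability_le1 P (mQ 0%N)) (ltry _).
    have cP := nonincreasing_cvg_mu (mu := P) PQ0 mQ mQQ ndQ'.
    rewrite -(cvg_lim _ cP)//; apply: lime_ge.
      by apply/cvg_ex; exists (P (\bigcap_k hits (Q k))).
    by apply: nearW => k; have := lQ k; rewrite outer_prob_meas//= => /ltW.
  apply: le_measure; rewrite ?inE//; first exact: measurable_hits.
  exact: hits_bigcap_compact QK.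
apply: ltW; apply: lt_le_trans Us _; rewrite (_ : s + e / 2 = s - e / 2 + e); last by lra.
by rewrite EFinD leeD2r.
Qed.

(** The event lies between two measurable sets of equal probability. *)
Lemma measurable_hits_analytic (A K0 : set X) : measure_is_complete P -> hausdorff_space X ->
  analytic A -> compact K0 -> A `<=` K0 -> measurable (hits A).
Proof.
move=> complP hX aA cK0 AK0.
have /choice[KU hKU] : forall n, exists KU : set X * set T,
    [/\ compact KU.1, KU.1 `<=` A, measurable KU.2, hits A `<=` KU.2 &
      (P KU.2 <= P (hits KU.1) + n.+1%:R^-1%:E)%E].
  move=> n; have n0 : 0 < n.+1%:R^-1 :> R by rewrite invr_gt0.
  by have [K [U h]] := analytic_hits_approx hX aA cK0 AK0 n0; exists (K, U).
pose L := \bigcup_n hits (KU n).1; pose U := \bigcap_n (KU n).2.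
have mK n : measurable (hits (KU n).1) by apply: measurable_hits; case: (hKU n).
have mU n : measurable (KU n).2 by case: (hKU n).
have mL : measurable L by exact: bigcupT_measurable.
have LA : L `<=` hits A by move=> w [n _]; apply: hitsS; case: (hKU n).
have AU : hits A `<=` U by move=> w hw n _; have [_ _ _ + _] := hKU n; exact.
rewrite (_ : hits A = L `|` (hits A `\` L)); last by rewrite setDUK.
apply: measurableU => //; apply: complP; exists (U `\` L); split; last exact: setSD.
- by apply: measurableD => //; exact: bigcapT_measurable.
apply/eqP; rewrite eq_le measure_ge0 andbT; apply/lee_addgt0Pr => e e0; rewrite add0e.
have [n ne] := exists_inv_lt e0; have [_ KA _ hU PU] := hKU n.
have sub : hits (KU n).1 `<=` (KU n).2 by apply: subset_trans hU; exact: hitsS.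
apply: (@le_trans _ _ (P ((KU n).2 `\` hits (KU n).1))).
  apply: le_measure; rewrite ?inE; [by apply: measurableD => //; exact: bigcapT_measurable|
    exact: measurableD|].
  by move=> w [Uw nL]; split; [exact: Uw|move=> hw; apply: nL; exists n].
have fK : P (hits (KU n).1) \is a fin_num by exact: fin_num_measure.
have -> : P ((KU n).2 `\` hits (KU n).1) = (P (KU n).2 - P (hits (KU n).1))%E.
  rewrite measureD//; last by apply: le_lt_trans (probability_le1 P _) (ltry _).
  by congr (_ - P _)%E; apply/setIidPr.
rewrite leeBlDl//; apply: le_trans PU _; rewrite leeD2l// lee_fin; exact: ltW.
Qed.

End random_closed_set.

(** * Space-time and the hitting event *)

Section space_time.
Context {R : realType} (d : nat).
Let X := (R * 'rV[R]_d)%type.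
Let Xm := (R * borel_rV R d)%type.

Lemma continuous_fst : continuous (fst : X -> R).
Proof. by move=> u; exact: cvg_fst. Qed.

Lemma continuous_snd : continuous (snd : X -> 'rV[R]_d).
Proof. by move=> u; exact: cvg_snd. Qed.

Lemma measurable_coord (i : 'I_d) :
  measurable_fun setT ((fun y => y 0 i) : borel_rV R d -> R).
Proof.
apply: (@measurability _ _ _ _ _ _ (@RGenOpens.G R)); first exact: RGenOpens.measurableE.
move=> _ [_ [a [b ->]] <-]; rewrite setTI; apply: sub_sigma_algebra.
have := @continuousP 'rV[R]_d R (fun y => y 0 i); case=> h _; apply: h.
  exact: coord_continuous.
exact: interval_open.
Qed.

(** The product sigma-algebra is generated by cylinders over open sets. *)
Lemma measurable_bianalytic (A : set Xm) : measurable A -> bianalytic (A : set X).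
Proof.
rewrite measurable_prod_measurableType; move: A.
apply: smallest_sub; first exact: sigma_algebra_bianalytic.
move=> _ [A mA [B mB <-]].
have sa := @sigma_algebra_bianalytic R X.
have bA : bianalytic (fst @^-1` A : set X).
  have {}mA : (@RGenOpens.G R).-sigma.-measurable A by rewrite -RGenOpens.measurableE.
  have := sigma_algebra_image (fst : X -> R) sa.
  rewrite /image_set_system => sa1.
  have : (@RGenOpens.G R).-sigma.-measurable `<=` [set B | bianalytic (setT `&` (fst : X -> R) @^-1` B)].
    apply: smallest_sub; first exact: sa1.
    move=> _ [a [b ->]] /=; rewrite setTI; apply: open_bianalytic.
    by have [h _] := @continuousP X R fst; apply: h; [exact: continuous_fst|exact: interval_open].
  by move=> h; rewrite -[_ @^-1` _]setTI; exact: h mA.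
have bB : bianalytic (snd @^-1` B : set X).
  have := sigma_algebra_image (snd : X -> 'rV[R]_d) sa.
  rewrite /image_set_system => sa1.
  have : open.-sigma.-measurable `<=` [set B | bianalytic (setT `&` (snd : X -> 'rV[R]_d) @^-1` B)].
    apply: smallest_sub; first exact: sa1.
    move=> U oU /=; rewrite setTI; apply: open_bianalytic.
    by have [h _] := @continuousP X 'rV[R]_d snd; apply: h; [exact: continuous_snd|].
  by move=> h; rewrite -[_ @^-1` _]setTI; exact: h mB.
have hb : <<s @bianalytic R X >> = @bianalytic R X by exact: sigma_algebra_id.
suff : <<s @bianalytic R X >> (A `*` B) by rewrite hb.
rewrite (_ : A `*` B = fst @^-1` A `&` snd @^-1` B); last by [].
by apply: (@measurableI _ (g_sigma_algebraType (@bianalytic R X))); apply: sub_sigma_algebra.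
Qed.

Lemma measurable_ball_spacetime (k : X) (r : R) : measurable (ball k r : set Xm).
Proof.
rewrite (_ : ball k r = ball k.1 r `*` ball k.2 r); last first.
  by apply/seteqP; split=> u [].
apply: measurableX.
  exact: measurable_ball.
by apply: sub_sigma_algebra; exact: ball_open.
Qed.

Lemma compact_box (M : R) : compact [set u : X | 0 <= u.1 <= 1 /\ forall i, `|u.2 0 i| <= M].
Proof.
rewrite (_ : [set u | _] = `[0, 1]%classic `*` [set v : 'rV[R]_d | forall i, `[- M, M]%classic (v ord0 i)]).
  apply: compact_setX; first exact: segment_compact.
  by apply: (@rV_compact R d (fun=> `[- M, M]%classic)) => i; exact: segment_compact.
apply/seteqP; split=> -[t y] /= [h1 h2]; split.
- by rewrite in_itv.
- by move=> i; rewrite in_itv/= -ler_norml.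
- by move: h1; rewrite in_itv.
- by move=> i; have := h2 i; rewrite in_itv/= -ler_norml.
Qed.

(** For the random closed set [{u}] on the space itself, hitting a set is
   belonging to it. *)
Lemma inner_regular (mu : probability Xm R) (A K0 : set X) (e : R) :
  measurable (A : set Xm) -> compact K0 -> A `<=` K0 -> 0 < e ->
  exists K : set X, [/\ compact K, K `<=` A, measurable (K : set Xm) &
    (mu A <= mu K + e%:E)%E].
Proof.
move=> mA cK0 AK0 e0.
pose xi (n : nat) (u : Xm) : X := u.
have mxi j k r : 0 < r -> measurable [set w | ball k r (xi j w)].
  by move=> _; exact: measurable_ball_spacetime.
have hX : hausdorff_space X by exact: norm_hausdorff.
have hE (C : set X) : hits xi C = C.
  apply/seteqP; split=> [u [v Cv]|u Cu].
    rewrite (_ : range _ = [set u]); last first.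
      by apply/seteqP; split=> [_ [_ _ <-]//|_ ->]; exists 0%N.
    have /closure_id <- : closed [set (u : X)] by exact: (accessible_closed_set1 (hausdorff_accessible hX)).
    by move=> vu; rewrite -vu.
  by exists u => //; apply: subset_closure; exists 0%N.
have [K [U [cK KA mU]]] := analytic_hits_approx mu mxi hX (measurable_bianalytic mA).1 cK0 AK0 e0.
rewrite !hE => AU UK; exists K; split=> //.
  by have := measurable_hits mxi cK; rewrite hE.
by apply: le_trans UK; apply: le_measure; rewrite ?inE.
Qed.

End space_time.

Section graph_of_measurable.
Context {R : realType} (d : nat) (f : R -> 'rV[R]_d).
Let I01 : set R := `[0, 1]%classic.
Hypothesis mf : measurable_fun I01 (f : R -> borel_rV R d).

Lemma measurable_coord_clamp (i : 'I_d) : measurable_fun setT (fun t => f (clamp01 t) 0 i).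
Proof.
have mc : measurable_fun setT (@clamp01 R).
  apply: continuous_measurable_fun; exact: continuous_clamp01.
apply: (@measurable_comp _ _ _ _ _ _ I01 (fun t => f t 0 i)) mc.
- exact: measurable_itv.
- by move=> _ [t _ <-]; rewrite /I01/= in_itv/= clamp01_itv.
- exact: (measurableT_comp (measurable_coord i) mf).
Qed.

Lemma measurable_graph (E : set R) : measurable E -> E `<=` I01 ->
  measurable (graph_on E f : set (R * borel_rV R d)).
Proof.
move=> mE E01.
rewrite (_ : graph_on E f = (E `*` setT) `&` \bigcap_(i in [set: 'I_d])
    [set u : R * borel_rV R d | u.2 0 i = f (clamp01 u.1) 0 i]).
  apply: measurableI; first exact: measurableX.
  apply: fin_bigcap_measurable => [|i _]; first exact: finite_finset.
  have h : measurable_fun setT (fun u : R * borel_rV R d => u.2 0 i == f (clamp01 u.1) 0 i).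
    apply: measurable_fun_eqr.
      exact: (measurableT_comp (measurable_coord i) measurable_snd).
    exact: (measurableT_comp (measurable_coord_clamp i) measurable_fst).
  have := h measurableT [set true] I; rewrite setTI.
  by congr measurable; apply/seteqP; split=> u /= /eqP.
apply/seteqP; split=> [_ [t Et <-]|[t y] [[/= Et _] h]].
  split=> // i _ /=; rewrite clamp01_id//.
  by have := E01 _ Et; rewrite /I01/= in_itv.
exists t => //; congr pair; apply/rowP => i; rewrite (h i)//= clamp01_id//.
by have := E01 _ Et; rewrite /I01/= in_itv.
Qed.

End graph_of_measurable.

Section hitting_by_paths.
Context {R : realType} dT (T : measurableType dT) (d : nat).
Variable B : 'I_d -> R -> T -> R.
Let I01 : set R := `[0, 1]%classic.
Hypothesis mB : forall i t, I01 t -> measurable_fun setT (B i t).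
Hypothesis cB : forall i w, {within I01, continuous (fun t => B i t w)}.
Variable x : 'rV[R]_d.
Let X := (R * 'rV[R]_d)%type.

Definition shifted_path (w : T) (t : R) : X :=
  (clamp01 t, x - \row_i B i (clamp01 t) w).

(** The points [(t, x - B_t)] at rational times are dense in the reflected path;
   that path meets the graph of [f] exactly when [B + f] takes the value [x]. *)
Definition path_point (j : nat) (w : T) : X := shifted_path w (ratr (odflt 0 (unpickle j))).

Lemma measurable_path_point j (k : X) (r : R) : 0 < r -> measurable [set w | ball k r (path_point j w)].
Proof.
move=> r0.
set t := clamp01 (ratr (odflt 0 (unpickle j)) : R).
have It : I01 t by rewrite /I01/= in_itv/= clamp01_itv.
rewrite (_ : [set w | _] = [set w | ball k.1 r t] `&`
    \bigcap_(i in [set: 'I_d]) [set w | `|B i t w - (x 0 i - k.2 0 i)| < r]).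
  apply: measurableI.
    have [h|h] := pselect (ball k.1 r t).
      by rewrite (_ : [set _ | _] = setT)//; apply/seteqP; split.
    by rewrite (_ : [set _ | _] = set0)//; apply/seteqP; split.
  apply: fin_bigcap_measurable => [|i _]; first exact: finite_finset.
  by apply: measurable_norm_lt; apply: measurable_funB => //; exact: mB.
apply/seteqP; split=> w.
  move=> [h1 [_ h2]]; split=> // i _ /=; have := h2 0 i; rewrite /ball/= /ball_/= !mxE.
  by congr (`|_| < _); rewrite -/t; ring.
move=> [h1 h2]; split=> //; split=> // i0 i; rewrite ord1; have := h2 i I; rewrite /ball/= /ball_/= !mxE.
by congr (`|_| < _); rewrite -/t; ring.
Qed.

Lemma continuous_shifted_path w : continuous (shifted_path w).
Proof.
move=> t; suff h : (x - \row_i B i (clamp01 s) w) @[s --> t] --> (x - \row_i B i (clamp01 t) w).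
  exact: cvg_pair (@continuous_clamp01 R t) h.
apply/cvg_ballP => e e0.
have : \forall s \near t, forall i : 'I_d, ball (B i (clamp01 t) w) e (B i (clamp01 s) w).
  have h (i : 'I_d) : \forall s \near t, ball (B i (clamp01 t) w) e (B i (clamp01 s) w).
    have c : {within I01, continuous (fun t => B i t w)} by move=> s; exact: cB.
    by have /(_ t)/cvg_ballP := continuous_comp_clamp01 c; exact.
  have F1 : Filter (nbhs t) := nbhs_filter t.
  exact: (filter_forall (F := nbhs t)
    (f := fun i s => ball (B i (clamp01 t) w) e (B i (clamp01 s) w)) F1 h).
apply: filterS => s hs; split=> // i0 i; rewrite ord1 /ball/= /ball_/= !mxE.
by have := hs i; rewrite /ball/= /ball_/= ; rewrite distrC; congr (`|_| < _); ring.
Qed.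

Lemma closure_path_points w : closure (range (path_point^~ w)) =
  [set u : X | 0 <= u.1 <= 1 /\ \row_i B i u.1 w + u.2 = x].
Proof.
have rangeE : [set u : X | 0 <= u.1 <= 1 /\ \row_i B i u.1 w + u.2 = x] = shifted_path w @` `[0, 1]%classic.
  apply/seteqP; split=> [[t y] /= [t01 yx]|_ /= [t t01 <-]].
    exists t; first by rewrite /= in_itv.
    by rewrite /shifted_path clamp01_id// -yx addrAC subrr add0r.
  by rewrite clamp01_itv subrKC.
rewrite rangeE; apply/seteqP; split.
  have /closure_id -> : closed (shifted_path w @` `[0, 1]%classic).
    apply: compact_closed; first exact: norm_hausdorff.
    apply: continuous_compact; last exact: segment_compact.
    by apply: continuous_subspaceT; exact: continuous_shifted_path.
  apply: closureS => _ [j _ <-].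
  exists (clamp01 (ratr (odflt 0 (unpickle j)))); first by rewrite /= in_itv/= clamp01_itv.
  by rewrite /path_point /shifted_path clamp01_id// clamp01_itv.
move=> _ [t _ <-] V nV.
have /nbhs_ballP[e /= e0 eV] : nbhs t (shifted_path w @^-1` V) by exact: continuous_shifted_path.
have [q [qe [r _ rq]]] := dense_rat (ex_intro _ t (ballxx t e0)) (ball_open t e).
exists (shifted_path w q); split; last exact: eV.
by exists (pickle r) => //; rewrite /path_point pickleK/= rq.
Qed.

Lemma hits_path_points (A : set X) : hits path_point A =
  [set w | exists2 u, A u & 0 <= u.1 <= 1 /\ \row_i B i u.1 w + u.2 = x].
Proof.
apply/seteqP; split=> w [u Au h]; exists u => //; last by rewrite closure_path_points.
by move: h; rewrite closure_path_points.
Qed.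

Lemma hits_graph (f : R -> 'rV[R]_d) (E : set R) : E `<=` I01 ->
  hits path_point (graph_on E f) = [set w | exists t, E t /\ \row_i B i t w + f t = x].
Proof.
move=> E01; rewrite hits_path_points; apply/seteqP; split.
  by move=> w [_ [t Et <-] [_ h]]; exists t.
move=> w [t [Et h]]; exists (t, f t); first by exists t.
by split=> //=; have := E01 _ Et; rewrite /I01/= in_itv.
Qed.

Lemma measurable_hitting_event (P : probability T R) (f : R -> 'rV[R]_d) (E : set R) :
  measure_is_complete P -> measurable_fun I01 (f : R -> borel_rV R d) ->
  (exists M, forall t, 0 <= t <= 1 -> forall i, `|f t 0 i| <= M) ->
  measurable E -> E `<=` I01 ->
  measurable [set w | exists t, E t /\ \row_i B i t w + f t = x].
Proof.
move=> complP mf [M fM] mE E01; rewrite -hits_graph//.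
apply: (measurable_hits_analytic measurable_path_point complP (@norm_hausdorff _ X)).
- exact: (measurable_bianalytic (measurable_graph mf mE E01)).1.
- exact: compact_box M.
- move=> _ [t Et <-]; have t01 : 0 <= t <= 1 by have := E01 _ Et; rewrite /I01/= in_itv.
  by split=> //= i; exact: fM.
Qed.

End hitting_by_paths.

(** * The second moment method *)

Section second_moment.
Context {R : realType} d1 d2 (T : measurableType d1) (U : measurableType d2).
Variables (P : probability T R) (mu : probability U R).
Variable S : set (T * U).
Hypothesis mS : measurable S.
Let z (w : T) : \bar R := mu (xsection S w).

Let mz : measurable_fun setT z.
Proof. exact: (measurable_fun_xsection mu mS). Qed.

Let z01 w : (0 <= z w <= 1)%E.
Proof. by rewrite measure_ge0 probability_le1//; exact: measurable_xsection. Qed.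

Lemma integral_xsection (A : set (T * U)) : measurable A ->
  (\int[P]_w mu (xsection A w) = \int[mu]_u P (ysection A u))%E.
Proof.
move=> mA; have := @indic_fubini_tonelli _ _ T U R P mu A mA.
by rewrite (indic_fubini_tonelli_FE mu mA) (indic_fubini_tonelli_GE P mA).
Qed.

Let g (p : T * U) : \bar R := ((\1_S p)%:E * z p.1)%E.

Let mg : measurable_fun setT g.
Proof.
apply: emeasurable_funM; first by apply/measurable_EFinP; exact: measurable_indic.
exact: (measurableT_comp mz measurable_fst).
Qed.

Let g0 p : (0 <= g p)%E.
Proof. by rewrite mule_ge0// ?lee_fin//; have /andP[] := z01 p.1. Qed.

Let S' u := S `&` (ysection S u `*` setT).

Let mS' u : measurable (S' u).
Proof.
by apply: measurableI => //; apply: measurableX => //; exact: measurable_ysection.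
Qed.

Let ysectionS' u v : ysection (S' u) v = ysection S u `&` ysection S v.
Proof.
apply/seteqP; split=> w; rewrite /ysection/= !inE.
  by move=> [Sv [/= Su _]]; split=> //; move: Su; rewrite /ysection/= inE.
by move=> [Su Sv]; split=> //; split=> //=; rewrite /ysection/= inE.
Qed.

Lemma measurable_ysectionI u : measurable_fun setT (fun v => P (ysection S u `&` ysection S v)).
Proof.
have := measurable_fun_ysection P (mS' u); congr measurable_fun.
by apply/funext => v; rewrite /= ysectionS'.
Qed.

Let integral_g u : (\int[P]_w g (w, u) = \int[mu]_v P (ysection S u `&` ysection S v))%E.
Proof.
transitivity (\int[P]_w mu (xsection (S' u) w))%E.
  apply: eq_integral => w _; rewrite /g/= /indic.
  have [wS|wS] := boolP ((w, u) \in S).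
    rewrite mul1e /z; congr (mu _); apply/seteqP; split=> v; rewrite /xsection/= !inE.
      by move=> Sv; split=> //; split=> //=; rewrite /ysection/= .
    by case.
  rewrite mul0e (_ : xsection (S' u) w = set0) ?measure0//; apply/seteqP; split=> v //.
  by rewrite /xsection/= inE => -[_ [/=]]; rewrite /ysection/= (negbTE wS).
by rewrite integral_xsection//; apply: eq_integral => v _; rewrite ysectionS'.
Qed.

Lemma measurable_integral_ysectionI :
  measurable_fun setT (fun u => \int[mu]_v P (ysection S u `&` ysection S v))%E.
Proof.
have := @measurable_fun_fubini_tonelli_G _ _ T U R P g mg g0; congr measurable_fun.
by apply/funext => u; exact: integral_g.
Qed.

(** Fubini's theorem applied twice: once for each factor of the square. *)
Lemma integral_sqr_xsection :
  (\int[P]_w (z w * z w) = \int[mu]_u \int[mu]_v P (ysection S u `&` ysection S v))%E.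
Proof.
transitivity (\int[P]_w \int[mu]_u g (w, u))%E.
  apply: eq_integral => w _; rewrite /g/=.
  have -> : (fun u => ((\1_S (w, u))%:E * z w)%E) = (fun u => (z w * (\1_(xsection S w) u)%:E)%E).
    apply/funext => u; rewrite muleC; congr (_ * _%:E)%E.
    by rewrite /indic; congr (_%:R); rewrite mem_xsection.
  have mw : measurable (xsection S w) by exact: measurable_xsection.
  rewrite ge0_integralZl//.
    by rewrite integral_indic ?setIT.
  by apply/measurable_EFinP; exact: measurable_indic.
by rewrite fubini_tonelli//; apply: eq_integral => u _; exact: integral_g.
Qed.

(** Paley-Zygmund: [2 z <= z^2 / q + q] where [z] is nonzero, integrated with
   [q] the ratio of the bounds for the second and the first moment. *)
Lemma second_moment_bound (k : U -> U -> \bar R) (K : set U) (l m D G : R) :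
  measurable_fun setT (fun p : U * U => k p.1 p.2) -> (forall u v, 0 <= k u v)%E ->
  measurable K -> (m%:E <= mu K)%E -> 0 < l -> 0 < m -> 0 < D -> 0 < G ->
  (forall u, K u -> (l%:E <= P (ysection S u))%E) ->
  (forall u v, (P (ysection S u `&` ysection S v) <= D%:E * k u v)%E) ->
  (\int[mu]_u \int[mu]_v k u v <= G%:E)%E ->
  (((l * m) ^+ 2 / (D * G))%:E <= P [set w | z w != 0%E])%E.
Proof.
move=> mk k0 mK mKm l0 m0 D0 G0 hl hD hG.
have mA : measurable [set w | z w != 0%E].
  by have := emeasurable_neq measurableT mz 0%E; rewrite setTI.
set A := [set w | _] in mA *.
have zz0 w : (0 <= z w * z w)%E by have /andP[h _] := z01 w; exact: mule_ge0.
have mzz : measurable_fun setT (fun w => (z w * z w)%E) by exact: emeasurable_funM.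
have EZ : ((l * m)%:E <= \int[P]_w z w)%E.
  rewrite integral_xsection//.
  apply: (@le_trans _ _ (\int[mu]_(u in K) l%:E)%E).
    by rewrite integral_cst// EFinM lee_pmul2l.
  have mP : measurable_fun setT (fun u => P (ysection S u)) by exact: (measurable_fun_ysection P mS).
  apply: (@le_trans _ _ (\int[mu]_(u in K) P (ysection S u))%E).
    apply: ge0_le_integral => //.
    - by move=> u _; rewrite lee_fin ltW.
    - exact: measurable_funS mP.
  by apply: ge0_subset_integral.
have EZ2 : (\int[P]_w (z w * z w) <= (D * G)%:E)%E.
  rewrite integral_sqr_xsection EFinM.
  have mk1 u : measurable_fun setT (fun v => k u v).
    exact: (measurableT_comp mk (pair1_measurable u)).
  have mF : measurable_fun setT (fun u => \int[mu]_v k u v)%E.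
    exact: (@measurable_fun_fubini_tonelli_F _ _ U U R mu (fun p => k p.1 p.2) mk).
  have F0 u : (0 <= \int[mu]_v k u v)%E by exact: integral_ge0.
  apply: (@le_trans _ _ (\int[mu]_u (D%:E * \int[mu]_v k u v))%E); last first.
    by rewrite ge0_integralZl// ?lee_fin ?(ltW D0)// lee_pmul2l.
  have mI := measurable_ysectionI.
  apply: ge0_le_integral => //.
  - by move=> u _; apply: integral_ge0 => v _; exact: measure_ge0.
  - exact: measurable_integral_ysectionI.
  - exact: emeasurable_funM.
  move=> u _; rewrite -ge0_integralZl// ?lee_fin ?(ltW D0)//.
  apply: ge0_le_integral => //.
  exact: emeasurable_funM.
pose q := D * G / (l * m); have lm0 : 0 < l * m by exact: mulr_gt0.
have q0 : 0 < q by rewrite divr_gt0 ?mulr_gt0.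
have key : (2%:E * \int[P]_w z w <= q^-1%:E * \int[P]_w (z w * z w) + q%:E * P A)%E.
  rewrite -ge0_integralZl//.
  rewrite -ge0_integralZl//; last by rewrite lee_fin invr_ge0 ltW.
  rewrite -[A]setIT -integral_indic// -ge0_integralZl//; last 2 first.
  - by apply/measurable_EFinP; exact: measurable_indic.
  - by rewrite lee_fin ltW.
  rewrite -ge0_integralD//; last 4 first.
  - by move=> w _; rewrite mule_ge0// lee_fin invr_ge0 ltW.
  - exact: emeasurable_funM.
  - by move=> w _; rewrite mule_ge0// lee_fin// ltW.
  - by apply: emeasurable_funM => //; apply/measurable_EFinP; exact: measurable_indic.
  apply: ge0_le_integral => //.
  - by move=> w _; have /andP[h _] := z01 w; rewrite mule_ge0.
  - exact: emeasurable_funM.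
  - apply: emeasurable_funD; apply: emeasurable_funM => //.
    by apply/measurable_EFinP; exact: measurable_indic.
  move=> w _; have /andP[h0 h1] := z01 w.
  have [zE|zN] := eqVneq (z w) 0%E.
    by rewrite zE !mule0 add0e mule_ge0// lee_fin// ltW.
  have -> : \1_A w = 1 :> R by rewrite /indic mem_set.
  have zf : z w \is a fin_num by rewrite ge0_fin_numE// (le_lt_trans h1)// ltry.
  rewrite -(fineK zf) mule1 -!EFinM -EFinD lee_fin.
  move: (fine (z w)) => y.
  have : 0 <= (y - q) ^+ 2 / q by rewrite divr_ge0 ?sqr_ge0 ?ltW.
  have -> : (y - q) ^+ 2 / q = q^-1 * (y * y) + q - 2 * y by field; rewrite gt_eqF.
  by rewrite subr_ge0.
have fPA : P A \is a fin_num by exact: fin_num_measure.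
have : ((2 * (l * m))%:E <= q^-1%:E * (D * G)%:E + q%:E * P A)%E.
  apply: (@le_trans _ _ (2%:E * \int[P]_w z w)%E); first by rewrite EFinM lee_pmul2l.
  apply: le_trans key _; rewrite leeD2r// lee_pmul2l// lte_fin invr_gt0//.
rewrite -(fineK fPA) -!EFinM -EFinD !lee_fin.
have -> : q^-1 * (D * G) = l * m by rewrite /q; field; rewrite !gt_eqF.
move: (fine (P A)) => p hp; have : l * m <= q * p by lra.
rewrite [q * p]mulrC -ler_pdivrMr// => h; apply: le_trans h; rewrite /q.
by apply: eq_ler; field; rewrite !gt_eqF.
Qed.

End second_moment.

(** * The Riesz kernel of the parabolic metric *)

Section kernel.
Context {R : realType} (d : nat) (H : R).
Let Xm := (R * borel_rV R d)%type.

Lemma measurable_rho : measurable_fun setT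
  (fun p : Xm * Xm => rho H (p.1 : R * 'rV[R]_d) (p.2 : R * 'rV[R]_d)).
Proof.
have m11 : measurable_fun setT (fun p : Xm * Xm => p.1.1) by exact: (measurableT_comp measurable_fst measurable_fst).
have m12 : measurable_fun setT (fun p : Xm * Xm => p.1.2) by exact: (measurableT_comp measurable_snd measurable_fst).
have m21 : measurable_fun setT (fun p : Xm * Xm => p.2.1) by exact: (measurableT_comp measurable_fst measurable_snd).
have m22 : measurable_fun setT (fun p : Xm * Xm => p.2.2) by exact: (measurableT_comp measurable_snd measurable_snd).
apply: measurable_maxr.
  apply: (measurableT_comp (measurable_powR H)).
  by apply: (measurableT_comp (@normr_measurable _ setT)) => //; exact: measurable_funB.
apply: (measurableT_comp (f := @Num.sqrt R)).
  by apply: continuous_measurable_fun; exact: sqrt_continuous.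
apply: measurable_sum => i; apply: measurable_funX.
rewrite (_ : (fun p : Xm * Xm => _) = (fun p => p.1.2 0 i - p.2.2 0 i)); last first.
  by apply/funext => p; rewrite !mxE.
by apply: measurable_funB; [exact: (measurableT_comp (measurable_coord i) m12)|
  exact: (measurableT_comp (measurable_coord i) m22)].
Qed.

Variable alpha : R.

(** A form in which the measurability of the kernel is visible: the finite values
   are powers of [rho]. *)
Lemma riesz_kernelE (u v : R * 'rV[R]_d) : riesz_kernel H alpha u v =
  if rho H u v `^ alpha == 0 then +oo%E else ((rho H u v `^ alpha) `^ (-1))%:E.
Proof. by rewrite /riesz_kernel inver powR_inv1 ?powR_ge0. Qed.

Lemma measurable_riesz_kernel : measurable_fun setT
  (fun p : Xm * Xm => riesz_kernel H alpha (p.1 : R * 'rV[R]_d) (p.2 : R * 'rV[R]_d)).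
Proof.
under eq_fun do rewrite riesz_kernelE.
have mr : measurable_fun setT (fun p : Xm * Xm => rho H (p.1 : R * 'rV[R]_d) (p.2 : R * 'rV[R]_d) `^ alpha).
  exact: (measurableT_comp (measurable_powR alpha) measurable_rho).
apply: measurable_fun_if => //.
- by apply: measurable_fun_eqr.
- apply/measurable_EFinP; apply: measurable_funTS.
  exact: (measurableT_comp (measurable_powR (-1)) mr).
Qed.

Lemma riesz_kernel_ge0 (u v : R * 'rV[R]_d) : (0 <= riesz_kernel H alpha u v)%E.
Proof. by rewrite riesz_kernelE; case: ifP => //; rewrite lee_fin powR_ge0. Qed.

End kernel.

Section capacity_finite.
Context {R : realType} (d : nat) (H : R).
Hypothesis H0 : 0 < H.
Let Xm := (R * borel_rV R d)%type.
Variables (f : R -> 'rV[R]_d) (M : R) (E : set R).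
Hypothesis fM : forall t : R, 0 <= t <= 1 -> forall i, `|f t 0 i| <= M.
Hypothesis mf : measurable_fun (`[0, 1]%classic : set R) (f : R -> borel_rV R d).
Hypothesis mE : measurable E.
Hypothesis E01 : E `<=` `[0, 1]%classic.

Lemma rho_graph_le : exists2 L : R, 0 < L &
  forall u v, graph_on E f u -> graph_on E f v -> rho H u v <= L.
Proof.
pose L := 1 + Num.sqrt (\sum_(i < d) (2 * `|M|) ^+ 2).
have L1 : 1 <= L by rewrite lerDl sqrtr_ge0.
exists L => [|_ _ [s Es <-] [t Et <-]]; first exact: lt_le_trans L1.
have := E01 Es; rewrite /= in_itv/= => s01; have := E01 Et; rewrite /= in_itv/= => t01.
rewrite /rho ge_max/=; apply/andP; split.
  apply: le_trans L1; have h : `|s - t| <= 1 by rewrite ler_norml; lra.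
  by have := ge0_ler_powR (ltW H0) _ _ h; rewrite powR1 !nnegrE; exact.
apply: (@le_trans _ _ (Num.sqrt (\sum_(i < d) (2 * `|M|) ^+ 2))); last by rewrite lerDr.
rewrite ler_wsqrtr// ler_sum// => i _; rewrite !mxE -(real_normK (num_real (_ - _))).
apply: lerXn2r; rewrite ?nnegrE// ?mulr_ge0//.
apply: le_trans (ler_normB _ _) _; have := fM s01 i; have := fM t01 i; have := ler_norm M.
by move: `|M| `|f s 0 i| `|f t 0 i| => a b c; lra.
Qed.

(** On a bounded graph the kernel is bounded below, and hence so is the energy. *)
Lemma capacity_lty (alpha : R) : 0 < alpha -> (capacity H alpha (graph_on E f) < +oo)%E.
Proof.
move=> alpha0; have [L L0 hL] := rho_graph_le.
have mG : measurable (graph_on E f : set Xm) by exact: measurable_graph.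
set G := graph_on E f in hL mG *.
pose q := (L `^ alpha) `^ (-1); have q0 : 0 < q by rewrite !powR_gt0.
suff h : (q%:E <= ereal_inf [set energy H alpha mu | mu in [set mu : probability Xm R | mu.-negligible (~` G)]])%E.
  rewrite /capacity -/G; have h0 : (0 < q%:E)%E by rewrite lte_fin.
  move: h; case: (ereal_inf _) => [r||//]; last by rewrite invey.
  by rewrite lee_fin inver => qr; rewrite gt_eqF ?ltry// (lt_le_trans q0).
apply: le_ereal_inf_tmp => _ [mu nG <-].
have muG : mu G = 1%E.
  have nG0 : mu (~` G) = 0%E by exact: measure_negligible (measurableC mG) nG.
  rewrite -(probability_setT mu) -(setUv G) measureU ?setICr//; last exact: measurableC.
  by rewrite [X in (_ + X)%E]nG0 adde0.
have kq u v : G u -> G v -> (q%:E <= riesz_kernel H alpha u v)%E.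
  move=> Gu Gv; rewrite riesz_kernelE; case: ifP => [|/negbT n0]; first by rewrite leey.
  have rp : 0 < rho H u v `^ alpha by rewrite lt0r n0 powR_ge0.
  rewrite lee_fin /q !powR_inv1 ?powR_ge0// lef_pV2 ?posrE ?rp//; last exact: powR_gt0.
  by apply: ge0_ler_powR; rewrite ?nnegrE ?(ltW alpha0) ?rho_ge0 ?(ltW L0)//; exact: hL.
have mk := @measurable_riesz_kernel R d H alpha.
have mk1 (u : Xm) : measurable_fun setT (fun v : Xm => riesz_kernel H alpha (u : R * 'rV[R]_d) (v : R * 'rV[R]_d)).
  exact: (measurableT_comp mk (pair1_measurable u)).
have k0 := @riesz_kernel_ge0 R d H alpha.
have mF := @measurable_fun_fubini_tonelli_F _ _ Xm Xm R mu _ mk (fun p => k0 p.1 p.2).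
have inner (u : Xm) : G u -> (q%:E <= \int[mu]_v riesz_kernel H alpha u v)%E.
  move=> Gu; apply: (@le_trans _ _ (\int[mu]_(v in G) q%:E)%E).
    by rewrite integral_cst// [X in (_ * X)%E]muG mule1.
  apply: (@le_trans _ _ (\int[mu]_(v in G) riesz_kernel H alpha u v)%E).
    apply: ge0_le_integral.
    - exact: mG.
    - by move=> v _; rewrite lee_fin ltW.
    - exact: measurable_cst.
    - by apply: measurable_funS (mk1 u).
    - by move=> v Gv; exact: kq.
  apply: ge0_subset_integral.
  - exact: mG.
  - exact: measurableT.
  - exact: mk1.
  - by move=> v _; exact: k0.
  - exact: subsetT.
rewrite /energy; apply: (@le_trans _ _ (\int[mu]_(u in G) q%:E)%E).
  by rewrite integral_cst// [X in (_ * X)%E]muG mule1.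
apply: (@le_trans _ _ (\int[mu]_(u in G) \int[mu]_v riesz_kernel H alpha u v)%E).
  apply: ge0_le_integral.
  - exact: mG.
  - by move=> v _; rewrite lee_fin ltW.
  - exact: measurable_cst.
  - by apply: measurable_funS mF.
  - exact: inner.
apply: ge0_subset_integral.
- exact: mG.
- exact: measurableT.
- exact: mF.
- by move=> u _; apply: integral_ge0 => v _; exact: k0.
- exact: subsetT.
Qed.

End capacity_finite.

(** * Positive capacity *)

Section caratheodory.
Context {R : realType} d1 d2 (T : measurableType d1) (U : measurableType d2).

(** Caratheodory: for a function measurable in one variable and continuous in the
   other, small values are detected at rational times. *)
Lemma measurable_caratheodory_ball (g : R -> T -> R) (tau h : U -> R) (e : R) :
  (forall s, measurable_fun setT (g s)) -> (forall w, continuous (g^~ w)) ->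
  measurable_fun setT tau -> measurable_fun setT h ->
  measurable [set p : T * U | `|g (tau p.2) p.1 + h p.2| <= e].
Proof.
move=> mg cg mtau mh; pose q j : R := ratr (odflt 0 (unpickle j)).
pose S m j := [set p : T * U | `|tau p.2 - q j| < m.+1%:R^-1] `&`
  [set p : T * U | `|g (q j) p.1 + h p.2| < e + m.+1%:R^-1].
rewrite (_ : [set p | _] = \bigcap_m \bigcup_j S m j).
  apply: bigcapT_measurable => m; apply: bigcupT_measurable => j; apply: measurableI.
    apply: (measurable_norm_lt (g := fun p => tau p.2 - q j)); apply: measurable_funB => //.
    exact: (measurableT_comp mtau measurable_snd).
  apply: (measurable_norm_lt (g := fun p => g (q j) p.1 + h p.2)); apply: measurable_funD.
    exact: (measurableT_comp (mg (q j)) measurable_fst).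
  exact: (measurableT_comp mh measurable_snd).
apply/seteqP; split=> [[w u] /= hw m _|[w u] hw].
  have m0 : 0 < m.+1%:R^-1 :> R by rewrite invr_gt0.
  have /cvg_ballP/(_ _ m0)/nbhs_ballP[r /= r0 hr] := cg w (tau u).
  pose r' := Num.min r m.+1%:R^-1; have r'0 : 0 < r' by rewrite lt_min r0.
  have [z [zr [p _ pz]]] := dense_rat (ex_intro _ _ (ballxx (tau u) r'0)) (ball_open (tau u) r').
  have /hr := le_ball (ltac:(by rewrite ge_min lexx) : r' <= r) zr.
  have := le_ball (ltac:(by rewrite ge_min lexx orbT) : r' <= m.+1%:R^-1) zr.
  rewrite /ball/= /ball_/= => h1 h2; exists (pickle p) => //; rewrite /S /q pickleK/= pz; split=> //=.
  rewrite (_ : g z w + h u = (g (tau u) w + h u) - (g (tau u) w - g z w)); last by ring.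
  by apply: le_lt_trans (ler_normB _ _) _; exact: ler_ltD.
apply/ler_addgt0Pr => r r0 /=; have r2 : 0 < r / 2 by rewrite divr_gt0.
have /cvg_ballP/(_ _ r2)/nbhs_ballP[del /= del0 hdel] := cg w (tau u).
pose b := Num.min del (r / 2); have b0 : 0 < b by rewrite lt_min del0.
have [m] := exists_inv_lt b0; rewrite lt_min => /andP[md mr].
have [j _ [/= h1 h2]] := hw m I.
have := hdel (q j) (lt_trans h1 md); rewrite /ball/= => h3.
rewrite (_ : g (tau u) w + h u = (g (q j) w + h u) + (g (tau u) w - g (q j) w)); last by ring.
apply: le_trans (ler_normD _ _) _.
by move: h2 mr h3; move: (m.+1%:R^-1) `|g (q j) w + h u| `|g (tau u) w - _| => v1 v2 v3; lra.
Qed.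

End caratheodory.

Section capacity_positive.
Context {R : realType} (d : nat) (H : R) dT (T : measurableType dT) (P : probability T R).
Hypothesis H01 : 0 < H < 1.
Hypothesis d_gt0 : (0 < d)%N.
Variable B : 'I_d -> R -> T -> R.
Hypothesis fB : fbm P H `[0, 1] B.
Let X := (R * 'rV[R]_d)%type.
Let Xm := (R * borel_rV R d)%type.
Variables (f : R -> 'rV[R]_d) (M : R) (E : set R).
Hypothesis fM : forall t : R, 0 <= t <= 1 -> forall i, `|f t 0 i| <= M.
Hypothesis mf : measurable_fun (`[0, 1]%classic : set R) (f : R -> borel_rV R d).
Hypothesis mE : measurable E.
Hypothesis E01 : E `<=` `]0, 1].
Variable x : 'rV[R]_d.

Let mB i t : 0 <= t <= 1 -> measurable_fun setT (B i t).
Proof. by move=> t01; have [[+ _] _ _ _] := fB.1 i; apply; rewrite /= in_itv. Qed.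

Let cB i w : continuous (fun s => B i (clamp01 s) w).
Proof. by have [_ _ _ c] := fB.1 i; exact: continuous_comp_clamp01 (c w). Qed.

(** Points [(w, (t, y))] such that the path [w] is near [x - y] at time [t]. *)
Definition near_hit (e : R) : set (T * Xm) :=
  [set p | forall i, `|B i (clamp01 p.2.1) p.1 + ((p.2.2 : 'rV[R]_d) 0 i - x 0 i)| <= e].

Lemma measurable_near_hit e : measurable (near_hit e).
Proof.
rewrite (_ : near_hit e = \bigcap_(i in [set: 'I_d])
    [set p : T * Xm | `|B i (clamp01 p.2.1) p.1 + ((p.2.2 : 'rV[R]_d) 0 i - x 0 i)| <= e]); last first.
  by apply/seteqP; split=> p h i; [move=> _; exact: h|exact: h].
apply: fin_bigcap_measurable => [|i _]; first exact: finite_finset.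
apply: (measurable_caratheodory_ball (g := fun s w => B i (clamp01 s) w) (tau := fst)
  (h := fun u : Xm => (u.2 : 'rV[R]_d) 0 i - x 0 i)).
- by move=> s; apply: mB; exact: clamp01_itv.
- by move=> w; exact: cB.
- exact: measurable_fst.
- apply: measurable_funB => //.
  exact: (measurableT_comp (measurable_coord i) measurable_snd).
Qed.

(** A point of [K] that is not hit has a neighbourhood where the distance stays
   bounded below, by continuity of the path. *)
Lemma near_hit_compact (K : set X) (w : T) : compact K ->
  (forall n : nat, exists2 u, K u & near_hit n.+1%:R^-1 (w, u)) ->
  exists2 u, K u & forall i, B i (clamp01 u.1) w + u.2 0 i = x 0 i.
Proof.
move=> cK hn; apply: contrapT => nh.
have [|n hnn] := @compact_escape R X K (fun n => [set u | near_hit n.+1%:R^-1 (w, u)]) cK.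
  move=> u Ku; have /existsNP[i /eqP ni] : ~ forall i, B i (clamp01 u.1) w + u.2 0 i = x 0 i.
    by move=> h; apply: nh; exists u.
  pose F (v : X) := B i (clamp01 v.1) w + v.2 0 i.
  have cF : continuous F.
    move=> v; apply: (@cvgD R R^o).
      apply: (@cvg_comp _ _ _ fst (fun s => B i (clamp01 s) w) (nbhs v) (nbhs v.1)); first exact: cvg_fst.
      exact: (@cB i w v.1).
    apply: (@cvg_comp _ _ _ snd (fun y : 'rV[R]_d => y 0 i) (nbhs v) (nbhs v.2)); first exact: cvg_snd.
    exact: coord_continuous.
  pose del := `|F u - x 0 i|; have del0 : 0 < del by rewrite normr_gt0 subr_eq0.
  have del2 : 0 < del / 2 by rewrite divr_gt0.
  have [n nd] := exists_inv_lt del2.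
  exists n; exists (F @^-1` ball (F u) (del / 2)).
    by apply: (cF u); exact: nbhsx_ballx.
  move=> m v nm; rewrite /= /ball/= => Fv /(_ i) /=.
  have : m.+1%:R^-1 <= n.+1%:R^-1 :> R by rewrite lef_pV2 ?posrE// ler_nat ltnS.
  rewrite addrA -/(F v) => mn Fx.
  have : del <= `|F u - F v| + `|F v - x 0 i|.
    by rewrite /del (_ : F u - x 0 i = (F u - F v) + (F v - x 0 i)) ?ler_normD//; ring.
  by move: (m.+1%:R^-1) (n.+1%:R^-1) nd mn Fx Fv => v1 v2; lra.
by have [u Ku hu] := hn n; exact: hnn Ku hu.
Qed.

(** Two points of the graph at the same time coincide, and there the kernel is
   infinite; this makes the bound hold on the diagonal. *)
Lemma two_point_kernel (a Z : R) (K : set Xm) : measurable K -> 0 < a <= 1 -> 0 <= Z ->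
  (forall u : X, K u -> a <= u.1 <= 1 /\ forall i, `|x 0 i - u.2 0 i| <= Z) ->
  (forall u v : X, K u -> K v -> u.1 = v.1 -> u = v) ->
  exists2 C : R, 0 < C & forall e, 0 < e -> forall u v : Xm,
    (P (ysection (near_hit e `&` (setT `*` K)) u `&` ysection (near_hit e `&` (setT `*` K)) v)
     <= (C * e ^+ (2 * d))%:E * riesz_kernel H d%:R (u : X) (v : X))%E.
Proof.
move=> mK a01 Z0 hK Kinj; have [C C0 hC] := fbm_two_point H01 fB d_gt0 a01 Z0.
exists C => // e e0 u v.
have Ce : 0 < C * e ^+ (2 * d) by rewrite mulr_gt0// exprn_gt0.
have rhs0 : (0 <= (C * e ^+ (2 * d))%:E * riesz_kernel H d%:R (u : X) (v : X))%E.
  by rewrite mule_ge0// ?lee_fin ?(ltW Ce)//; exact: riesz_kernel_ge0.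
set S := near_hit e `&` _.
have yS (w : T) (u' : Xm) : ysection S u' w -> K u' /\ near_hit e (w, u').
  by rewrite /ysection/= inE => -[? [_ ?]].
have [[Ku Kv]|nK] := pselect (K u /\ K v); last first.
  rewrite (_ : _ `&` _ = set0) ?measure0//; apply/seteqP; split=> w // [/yS[? _] /yS[? _]].
  exact: nK.
have [ua uZ] := hK u Ku; have [va vZ] := hK v Kv.
have [uv|uv] := eqVneq u.1 v.1.
  rewrite (Kinj _ _ Ku Kv uv) riesz_kernelE.
  rewrite (_ : rho H (v : X) (v : X) = 0) ?powR0 ?eqxx ?pnatr_eq0 -?lt0n//.
    by rewrite mulry gtr0_sg// mul1e leey.
  rewrite /rho !subrr normr0 powR0; last by have /andP[H0 _] := H01; rewrite gt_eqF.
  rewrite /enorm big1 ?sqrtr0 ?maxxx// => i _.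
  by rewrite mxE expr0n.
have r0 : 0 < rho H (u : X) (v : X).
  by rewrite /rho lt_max powR_gt0 // normr_gt0 subr_eq0.
have rE : rho H (u.1, x - u.2 : 'rV[R]_d) (v.1, x - v.2 : 'rV[R]_d) = rho H (u : X) (v : X).
  rewrite /rho/=; congr (Num.max _ _); rewrite /enorm; congr (Num.sqrt _).
  by apply: eq_bigr => i _; rewrite !mxE; move: (x 0 i) (u.2 0 i) (v.2 0 i) => p q r; ring.
have hu i : `|(x - u.2) 0 i| <= Z by rewrite !mxE.
apply: le_trans (_ : _ <= P (\bigcap_(i in [set: 'I_d])
   [set w | (`|B i u.1 w - (x - u.2 : 'rV[R]_d) 0 i| <= e /\ `|B i v.1 w - (x - v.2 : 'rV[R]_d) 0 i| <= e)%R]))%E _; last first.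
  have := hC u.1 v.1 (x - u.2) (x - v.2) e ua va uv e0 hu; rewrite rE => h; apply: le_trans h _.
  rewrite riesz_kernelE gt_eqF ?powR_gt0// -EFinM lee_fin powR_inv1 ?powR_ge0// powR_mulrn ?(ltW r0)//.
have u01 : 0 <= u.1 <= 1 by have /andP[a0 _] := a01; have /andP[h ->] := ua; rewrite (le_trans (ltW a0) h).
have v01 : 0 <= v.1 <= 1 by have /andP[a0 _] := a01; have /andP[h ->] := va; rewrite (le_trans (ltW a0) h).
have mS : measurable S.
  by apply: measurableI; [exact: measurable_near_hit|exact: measurableX].
apply: le_measure; rewrite ?inE.
- by apply: measurableI; exact: measurable_ysection.
- apply: fin_bigcap_measurable => [|i _]; first exact: finite_finset.
  have mBi t : `[0, 1]%classic t -> measurable_fun setT (B i t) by rewrite /= in_itv/=; exact: mB.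
  apply: (process_sigma_measurable mBi); apply: process_sigmaI; apply: process_sigma_ball.
    by rewrite /= in_itv.
  by rewrite /= in_itv.
move=> w [/yS[_ hwu] /yS[_ hwv]] i _ /=; split.
  have := hwu i; rewrite /= clamp01_id// !mxE.
  by congr (`|_| <= _); ring.
have := hwv i; rewrite /= clamp01_id// !mxE.
by congr (`|_| <= _); ring.
Qed.

(** The second moment method for [mu] restricted to a compact set [K], along
   radii [e = 1 / (k + 1)]: the bound [p0] does not depend on [e], because the
   powers of [e] in the two moments cancel. *)
Lemma capacity_pos_hit : (0 < capacity H d%:R (graph_on E f))%E ->
  measurable [set w | exists t, E t /\ \row_i B i t w + f t = x] ->
  (0 < P [set w | exists t, E t /\ (\row_i B i t w + f t)%R = x])%E.
Proof.
move=> cap mN; set N := [set w | _] in mN *.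
have sub01 : E `<=` `[0, 1]%classic by move=> t /E01; rewrite /= !in_itv/= => /andP[/ltW -> ->].
have [mu nG [W W0 enW]] : exists2 mu : probability Xm R, mu.-negligible (~` graph_on E f) &
    exists2 W : R, 0 < W & (energy H d%:R mu <= W%:E)%E.
  have /ereal_inf_lt[_ [mu nG <-] enG] : (ereal_inf [set energy H d%:R mu |
      mu in [set mu : probability Xm R | mu.-negligible (~` graph_on E f)]] < +oo)%E.
    rewrite ltey; apply: contraTneq cap => infE.
    by rewrite /capacity infE invey ltxx.
  exists mu => //; have en0 : (0 <= energy H d%:R mu)%E.
    by apply: integral_ge0 => u _; apply: integral_ge0 => v _; exact: riesz_kernel_ge0.
  exists (fine (energy H d%:R mu) + 1); first by rewrite ltr_wpDl// fine_ge0.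
  rewrite EFinD fineK ?ge0_fin_numE// leeDl//.
pose En (n : nat) := E `&` `[n.+1%:R^-1, 1]%classic.
have mEn n : measurable (En n) by apply: measurableI.
have EnE n : En n `<=` E by move=> t [].
have GE : graph_on E f = \bigcup_n graph_on (En n) f.
  apply/seteqP; split=> [_ [t Et <-]|_ [n _ [t [Et _] <-]]]; last by exists t.
  have := E01 Et; rewrite /= in_itv/= => /andP[t0 t1].
  have [n nt] := exists_inv_lt t0.
  by exists n => //; exists t => //; split=> //; rewrite /= in_itv/= (ltW nt).
have mG n : measurable (graph_on (En n) f : set Xm).
  by apply: measurable_graph => //; exact: subset_trans sub01.
have [n muGn] : exists n, (0 < mu (graph_on (En n) f))%E.
  apply: contrapT => /forallNP h0.
  have nE : mu.-negligible (graph_on E f).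
    rewrite GE; apply: negligible_bigcup => k; exists (graph_on (En k) f); split=> //.
    by apply/eqP; rewrite eq_le measure_ge0 andbT leNgt; apply/negP; exact: h0.
  have := negligibleU nE nG; rewrite setUv => /measure_negligible => /(_ measurableT).
  by rewrite [X in X = _]probability_setT => /eqP; rewrite onee_eq0.
pose a : R := n.+1%:R^-1; have a01 : 0 < a <= 1 by rewrite invr_gt0 ltr0n/= invf_le1 ?ler1n.
have fG : mu (graph_on (En n) f) \is a fin_num by exact: fin_num_measure.
pose m := fine (mu (graph_on (En n) f)) / 2.
have m0 : 0 < m by rewrite divr_gt0// fine_gt0// muGn ltey_eq fG.
have [K [cK KG mK muK]] : exists K : set X, [/\ compact K, K `<=` graph_on (En n) f, measurable (K : set Xm) &
    (mu (graph_on (En n) f) <= mu K + m%:E)%E].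
  apply: (inner_regular mu (mG n) (compact_box (M := M)) _ m0) => _ [t [Et _] <-].
  have := sub01 _ Et; rewrite /= in_itv/= => t01; split=> // i; exact: fM.
have mK' : (m%:E <= mu K)%E.
  have fK : mu K \is a fin_num by exact: fin_num_measure.
  move: muK; rewrite -(fineK fG) -(fineK fK) -EFinD !lee_fin.
  by rewrite {2}/m; move: (fine (mu K)) => kk; rewrite /m; lra.
pose Z := \sum_(i < d) `|x 0 i| + `|M|.
have Z0 : 0 <= Z by rewrite addr_ge0// sumr_ge0.
have hK (u : X) : K u -> a <= u.1 <= 1 /\ forall i, `|x 0 i - u.2 0 i| <= Z.
  move=> /KG[t [Et]]; rewrite /= in_itv/= => at1 <-; split=> //= i.
  have := sub01 _ Et; rewrite /= in_itv/= => t01.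
  apply: le_trans (ler_normB _ _) _; rewrite /Z lerD//.
    by rewrite (bigD1 i)//= lerDl sumr_ge0.
  by apply: le_trans (fM t01 i) _; exact: ler_norm.
have Kinj (u v : X) : K u -> K v -> u.1 = v.1 -> u = v.
  by move=> /KG[s _ <-] /KG[t _ <-] /= ->.
have /andP[a0 a1] := a01.
have [C C0 hC] := two_point_kernel mK a01 Z0 hK Kinj.
have [c c0 hc] := fbm_one_point H01 fB a0 Z0.
pose p0 := (c * m) ^+ 2 / (C * W).
have p00 : 0 < p0 by apply: divr_gt0; [apply: exprn_gt0|]; exact: mulr_gt0.
pose S (k : nat) := near_hit k.+1%:R^-1 `&` (setT `*` K).
have mS k : measurable (S k) by apply: measurableI; [exact: measurable_near_hit|exact: measurableX].
pose A k := [set w | mu (xsection (S k) w) != 0%E].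
have mA k : measurable (A k).
  by have := emeasurable_neq measurableT (measurable_fun_xsection mu (mS k)) 0%E; rewrite setTI.
have PA k : (p0%:E <= P (A k))%E.
  pose e : R := k.+1%:R^-1; have e0 : 0 < e by rewrite invr_gt0.
  have e1 : 0 < e <= 1 by rewrite e0 invf_le1 ?ler1n.
  have ed : 0 < e ^+ d by exact: exprn_gt0.
  have -> : p0 = ((c * e ^+ d) * m) ^+ 2 / ((C * e ^+ (2 * d)) * W).
    rewrite /p0 mulnC (exprM e d 2); move: (e ^+ d) ed => y y0.
    by field; rewrite !gt_eqF.
  apply: (second_moment_bound (mS k) (@measurable_riesz_kernel R d H d%:R) _ mK mK' _ m0 _ W0 _ (hC e e0) enW).
  - by move=> u v; exact: riesz_kernel_ge0.
  - exact: mulr_gt0.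
  - by rewrite mulr_gt0// exprn_gt0.
  move=> u Ku; have [ua uZ] := hK u Ku.
  apply: le_trans (hc u.1 (x - u.2) e ua e1 _) _; first by move=> i; rewrite !mxE.
  have u01 : 0 <= u.1 <= 1 by have /andP[h ->] := ua; rewrite (le_trans (ltW a0) h).
  apply: le_measure; rewrite ?inE; last 1 first.
  - move=> w hw; rewrite /ysection/= inE; split=> // i.
    have := hw i Logic.I; rewrite /= clamp01_id// !mxE.
    by congr (`|_| <= _); ring.
  - apply: fin_bigcap_measurable => [|i _]; first exact: finite_finset.
    have mBi t : `[0, 1]%classic t -> measurable_fun setT (B i t) by rewrite /= in_itv/=; exact: mB.
    by apply: (process_sigma_measurable mBi); apply: process_sigma_ball; rewrite /= in_itv.
  - exact: measurable_ysection.
have ndA : {homo A : k l / (k <= l)%N >-> (l <= k)%O}.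
  move=> k l kl; apply/subsetPset => w; rewrite /A/=; apply: contra => /eqP Ak0.
  rewrite -measure_le0 -Ak0; apply: le_measure; rewrite ?inE; [exact: measurable_xsection|exact: measurable_xsection|].
  move=> u; rewrite /xsection/= !inE => -[hl Ku]; split=> // i; apply: le_trans (hl i) _.
  by rewrite lef_pV2 ?posrE// ler_nat ltnS.
have mAA : measurable (\bigcap_k A k) by exact: bigcapT_measurable.
have PAA : (p0%:E <= P (\bigcap_k A k))%E.
  have PA0 : (P (A 0%N) < +oo)%E by apply: le_lt_trans (probability_le1 P (mA 0%N)) (ltry _).
  have cP := nonincreasing_cvg_mu (mu := P) PA0 mA mAA ndA.
  rewrite -(cvg_lim _ cP)//; apply: lime_ge.
    by apply/cvg_ex; exists (P (\bigcap_k A k)).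
  by apply: nearW => k; exact: PA.
apply: (@lt_le_trans _ _ p0%:E); first by rewrite lte_fin.
apply: le_trans PAA _; apply: le_measure; rewrite ?inE// => w hw.
have [|u Ku hu] := @near_hit_compact K w cK.
  move=> k; have /= Ak := hw k I.
  have /set0P[u] : xsection (S k) w != set0.
    by apply: contra Ak => /eqP ->; rewrite measure0.
  by rewrite /xsection/= inE => -[h [_ Ku]]; exists u.
have [t [Et _] tu] := KG _ Ku; exists t; split=> //; apply/rowP => i; rewrite !mxE.
by have := hu i; rewrite -tu /= clamp01_id//; have := sub01 _ Et; rewrite /= in_itv.
Qed.

End capacity_positive.

(** * Null Hausdorff measure *)

Section hausdorff_null.
Context {R : realType} (d : nat) (H : R).
Hypothesis H01 : 0 < H < 1.

Lemma coord_le_enorm (y : 'rV[R]_d) (i : 'I_d) : `|y 0 i| <= enorm y.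
Proof.
rewrite -sqrtr_sqr /enorm ler_wsqrtr// (bigD1 i)//= lerDl sumr_ge0// => j _.
exact: sqr_ge0.
Qed.

(** The premeasures decrease with the mesh, so each of them bounds the limit
   from below. *)
Lemma hausdorff_pre_le (beta delta : R) (A : set (R * 'rV[R]_d)) : 0 < delta ->
  (hausdorff_pre H beta delta A <= hausdorff H beta A)%E.
Proof.
move=> delta0.
have ni : {in Interval (BRight 0) (BRight delta) &, {homo (hausdorff_pre H beta ^~ A) : m n / m <= n >-> (n <= m)%E}}.
  move=> m n _ _ mn; apply: le_ereal_inf_tmp => _ [c [r [c0 r0 cov ->]]].
  apply: ereal_inf_lbound; exists c, r; split=> // k.
  by have /andP[-> rm] := r0 k; exact: le_trans mn.
have b0 : (BRight 0 < BRight delta)%O by rewrite bnd_simp.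
rewrite /hausdorff (cvg_lim _ (nonincreasing_at_right_cvge _ b0 ni))//.
apply: ereal_sup_ubound; exists delta => //.
by rewrite /= in_itv/= delta0 lexx.
Qed.

Context dT (T : measurableType dT) (P : probability T R).

(** The intersection of covers of probability at most [1 / n] is null. *)
Lemma negligible_small (A : set T) :
  (forall e : R, 0 < e -> exists U, [/\ measurable U, A `<=` U & (P U <= e%:E)%E]) ->
  P.-negligible A.
Proof.
move=> h; have /choice[U hU] : forall n : nat, exists U, [/\ measurable U, A `<=` U &
    (P U <= n.+1%:R^-1%:E)%E].
  by move=> n; apply: h; rewrite invr_gt0.
have mU n : measurable (U n) by case: (hU n).
exists (\bigcap_n U n); split; first exact: bigcapT_measurable.
  apply/eqP; rewrite eq_le measure_ge0 andbT; apply/lee_addgt0Pr => e e0; rewrite add0e.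
  have [n ne] := exists_inv_lt e0.
  have [_ _ Un] := hU n; apply: le_trans (le_trans Un _); last by rewrite lee_fin ltW.
  by apply: le_measure; rewrite ?inE//; [exact: bigcapT_measurable|exact: bigcap_inf].
by move=> w Aw n _; have [_ + _] := hU n; exact.
Qed.

Variable B : 'I_d -> R -> T -> R.
Hypothesis fB : fbm P H `[0, 1] B.
Variables (f : R -> 'rV[R]_d) (M : R).
Hypothesis fM : forall t : R, 0 <= t <= 1 -> forall i, `|f t 0 i| <= M.

(** A parabolic ball that meets the graph restricts the time to a window of
   length [2 r^(1/H)] and the value of the path to a box of radius [r] around
   a bounded point, where the small-window estimate applies; a ball that does
   not meet the graph contributes nothing. *)
Lemma hit_ball (a : R) (E : set R) (x : 'rV[R]_d) : 0 < a <= 1 -> (forall t, E t -> a <= t <= 1) ->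
  exists2 C : R, 0 < C & forall (c : R * 'rV[R]_d) (r : R), 0 < r <= 1 ->
  exists A : set T, [/\ measurable A, (P A <= (C * r ^+ d)%:E)%E &
    forall w t, E t -> rho_ball H c r (t, f t) -> \row_i B i t w + f t = x -> A w].
Proof.
move=> a01 aE; have /andP[a0 a1] := a01; have /andP[H0 H1] := H01.
pose Z := \sum_(i < d) `|x 0 i| + `|M| + 1.
have Z0 : 0 <= Z by rewrite !addr_ge0// sumr_ge0.
have [C C0 hC] := fbm_hit H01 fB a01 Z0.
exists C => // c r r01; have /andP[r0 r1] := r01.
have Cr : (0 <= (C * r ^+ d)%:E)%E by rewrite lee_fin mulr_ge0 ?exprn_ge0 ?ltW.
have [[t0 [Et0 bt0]]|nt] := pselect (exists t, E t /\ rho_ball H c r (t, f t)); last first.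
  by exists set0; rewrite measure0; split=> // w t Et bt; case: nt; exists t.
pose p := r `^ H^-1.
have ptime t : rho_ball H c r (t, f t) -> `|t - c.1| < p.
  move=> [_ /=]; rewrite /rho gt_max distrC => /andP[h _].
  have Hi : 0 < H^-1 by rewrite invr_gt0.
  have := gt0_ltr_powR Hi (_ : _ \is Num.nneg) (_ : _ \is Num.nneg) h.
  by rewrite !nnegrE powR_ge0 (ltW r0) -powRrM mulfV ?gt_eqF// powRr1//; apply.
have pspace t i : rho_ball H c r (t, f t) -> `|c.2 0 i - f t 0 i| < r.
  move=> [_ /=]; rewrite /rho gt_max => /andP[_]; apply: le_lt_trans.
  by have := coord_le_enorm (c.2 - f t) i; rewrite !mxE.
pose l := Num.max a (c.1 - p).
have [|//||A [mA PA hA]] := hC l r (\row_i (x 0 i - c.2 0 i)).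
- have := ptime t0 bt0; have /andP[h1 h2] := aE _ Et0; rewrite ltr_norml => /andP[h3 h4].
  by rewrite le_max lexx ge_max a1/=; lra.
- move=> i; rewrite mxE; have := pspace t0 i bt0.
  have t01 : 0 <= t0 <= 1 by have /andP[h1 h2] := aE _ Et0; rewrite h2 (le_trans (ltW a0) h1).
  have := fM t01 i; have := ler_norm M.
  have : `|x 0 i| <= \sum_(i < d) `|x 0 i| by rewrite (bigD1 i)//= lerDl sumr_ge0.
  rewrite /Z; move: (\sum_(i < d) _) `|M| => S N.
  by move=> hx hM; rewrite !ler_norml ltr_norml; move: hx; rewrite ler_norml; lra.
exists A; split=> // w t Et bt hx; apply: (hA w t).
- have := ptime t bt; have /andP[h1 h2] := aE _ Et; rewrite ltr_norml => /andP[h3 h4].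
  by rewrite ge_max h1/=; lra.
- by have /andP[] := aE _ Et.
- have := ptime t bt; rewrite ltr_norml => /andP[h3 h4].
  have : c.1 - p <= l by rewrite le_max lexx orbT.
  by rewrite -/p; lra.
- move=> i; rewrite mxE -hx !mxE; apply: ltW; have := pspace t i bt.
  by congr (`|_| < _); ring.
Qed.

(** The times of [E] are exhausted by those of [[1 / (m + 1), 1]], on which the
   constants of the one-ball estimate are uniform. *)
Lemma hausdorff_null_hit (E : set R) (x : 'rV[R]_d) : E `<=` `]0, 1] ->
  hausdorff H d%:R (graph_on E f) = 0%E ->
  P.-negligible [set w | exists t, E t /\ \row_i B i t w + f t = x].
Proof.
move=> E01 h0.
pose N (m : nat) := [set w | exists t, (E t /\ m.+1%:R^-1 <= t) /\ \row_i B i t w + f t = x].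
rewrite (_ : [set w | _] = \bigcup_m N m); last first.
  apply/seteqP; split=> [w [t [Et ht]]|w [m _ [t [[Et _] ht]]]]; last by exists t.
  have t0 : 0 < t by have := E01 _ Et; rewrite /= in_itv/= => /andP[].
  have [m mt] := exists_inv_lt t0.
  by exists m => //; exists t; split=> //; split=> //; exact: ltW.
apply: negligible_bigcup => m; apply: negligible_small => e e0.
have a01 : 0 < (m.+1%:R^-1 : R) <= 1 by rewrite invr_gt0 ltr0n/= invf_le1 ?ler1n.
have [|C C0 hC] := @hit_ball _ [set t | E t /\ m.+1%:R^-1 <= t] x a01.
  by move=> t [/E01]; rewrite /= in_itv/= => /andP[_ ->] ->.
have [_ [c [r [c0 r0 cov ->]]]] : exists2 y, [set z | exists (c : nat -> R * 'rV[R]_d) (r : nat -> R),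
    [/\ forall n, 0 <= (c n).1, forall n, 0 < r n <= 1,
        graph_on E f `<=` \bigcup_n rho_ball H (c n) (r n)
      & z = (\sum_(0 <= n <oo) ((2 * r n) `^ d%:R)%:E)%E]] y & (y < (e / C)%:E)%E.
  apply: ereal_inf_lt; rewrite -/(hausdorff_pre _ _ _ _).
  apply: le_lt_trans (hausdorff_pre_le _ _ ltr01) _; rewrite h0 lte_fin.
  exact: divr_gt0.
move=> small.
have /choice[A hA] n := hC (c n) (r n) (r0 n).
have mA n : measurable (A n) by case: (hA n).
have r00 n : 0 < r n by have /andP[] := r0 n.
exists (\bigcup_n A n); split; first exact: bigcupT_measurable.
  move=> w [t [[Et mt] ht]]; have [|n _ bn] := cov (t, f t); first by exists t.
  by exists n => //; have [_ _ /(_ w t)] := hA n; apply.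
apply: le_trans (measure_sigma_subadditive P mA (bigcupT_measurable _ mA) (@subset_refl _ _)) _.
apply: (@le_trans _ _ (\sum_(0 <= n <oo) (C%:E * ((2 * r n) `^ d%:R)%:E))%E).
  apply: lee_nneseries => n; first by move=> _ _; exact: measure_ge0.
  move=> _; have [_ PA _] := hA n; apply: le_trans PA _.
  rewrite -EFinM lee_fin ler_wpM2l ?(ltW C0)// powR_mulrn ?mulr_ge0 ?(ltW (r00 n))//.
  apply: lerXn2r; rewrite ?nnegrE ?mulr_ge0 ?(ltW (r00 n))//.
  by have := r00 n; lra.
rewrite nneseriesZl; last by move=> n _; rewrite lee_fin powR_ge0.
rewrite -(@lee_pdivlMl _ C)//; apply: ltW; apply: lt_le_trans small _.
by rewrite lee_fin mulrC.
Qed.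

End hausdorff_null.

(** * The two inequalities *)

Lemma hausdorff_ge0 (R : realType) (d : nat) (H beta : R) (A : set (R * 'rV[R]_d)) :
  (0 <= hausdorff H beta A)%E.
Proof.
apply: le_trans (hausdorff_pre_le H beta A ltr01).
apply: le_ereal_inf_tmp => _ [c [r [_ _ _ ->]]]; apply: nneseries_ge0 => n _ _.
by rewrite lee_fin powR_ge0.
Qed.

Theorem proposition3p1 (R : realType) (dT : measure_display)
    (T : measurableType dT) (P : probability T R)
    (complete_P : measure_is_complete P)
    (d : nat) (d_gt0 : (0 < d)%N) (H : R) (H01 : 0 < H < 1)
    (B : 'I_d -> R -> T -> R) (fbm_B : fbm P H `[0, 1] B)
    (f : R -> 'rV[R]_d)
    (mf : measurable_fun (`[0, 1] : set R) (f : R -> borel_rV R d))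
    (bf : exists M : R, forall t : R, 0 <= t <= 1 -> enorm (f t) <= M)
    (E : set R) (mE : measurable E) (E01 : E `<=` `]0, 1]) :
  forall x : 'rV[R]_d, exists c : R, 1 <= c /\
    ((c^-1)%:E * capacity H d%:R (graph_on E f)
       <= P [set w | exists t, E t /\ (\row_i B i t w + f t)%R = x]
       <= c%:E * hausdorff H d%:R (graph_on E f))%E.
Proof.
move=> x; have [M fM'] := bf; have /andP[H0 _] := H01.
have fM (t : R) : 0 <= t <= 1 -> forall i, `|f t 0 i| <= M.
  by move=> t01 i; apply: le_trans (coord_le_enorm _ _) (fM' t t01).
have sub01 : E `<=` `[0, 1]%classic by move=> t /E01; rewrite /= !in_itv/= => /andP[/ltW -> ->].
have mN : measurable [set w | exists t, E t /\ (\row_i B i t w + f t)%R = x].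
  apply: measurable_hitting_event complete_P mf _ mE sub01.
  - by move=> i t It; have [[+ _] _ _ _] := fbm_B.1 i; exact.
  - by move=> i w; have [_ _ _ c] := fbm_B.1 i; exact: c.
  - by exists M.
have cap_lty : (capacity H d%:R (graph_on E f) < +oo)%E.
  by apply: (capacity_lty H0 fM mf mE sub01); rewrite ltr0n.
have cap_pos := capacity_pos_hit H01 d_gt0 fbm_B fM mf mE E01 (x := x).
have haus0 := hausdorff_null_hit H01 fbm_B fM x E01.
have haus_ge0 := hausdorff_ge0 H d%:R (graph_on E f).
set N := [set w | _] in mN cap_pos haus0 *.
have fN : P N \is a fin_num by exact: fin_num_measure.
have p0 : 0 <= fine (P N) by rewrite fine_ge0.
have p1 : fine (P N) <= 1 by rewrite -lee_fin fineK// probability_le1.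
move: (capacity _ _ _) (hausdorff _ _ _) cap_lty (fun h => cap_pos h mN) haus_ge0 haus0 => cap h.
move=> cap_lty {}cap_pos h0 {}haus0.
exists (1 + `|fine cap / fine (P N)| + `|(fine h)^-1|).
set c := (1 + _ + _); have c1 : 1 <= c by rewrite /c -addrA lerDl addr_ge0.
have c0 : 0 < c by exact: lt_le_trans c1.
split=> //; apply/andP; split.
- have [cap0|cap0] := leP cap 0%E.
    apply: le_trans (_ : 0 <= _)%E; last exact: measure_ge0.
    by rewrite mule_ge0_le0// lee_fin invr_ge0 ltW.
  have pN := cap_pos cap0.
  have fcap : cap \is a fin_num by rewrite ge0_fin_numE// ltW.
  have pN' : 0 < fine (P N) by rewrite fine_gt0// pN ltey_eq fN.
  rewrite -(fineK fcap) -(fineK fN) -EFinM lee_fin mulrC ler_pdivrMr// mulrC -ler_pdivrMr//.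
  apply: le_trans (ler_norm _) _; rewrite /c [1 + _]addrC -addrA lerDl addr_ge0//.
- have [hE|hn] := eqVneq h 0%E.
    by rewrite hE mule0 (measure_negligible mN (haus0 hE)).
  move: h0 hn; case: h haus0 @c c1 c0 => [h| |] // _ c c1 c0 h0 hn; last first.
    by rewrite mulry gtr0_sg// mul1e leey.
  rewrite -(fineK fN) -EFinM lee_fin; apply: le_trans p1 _.
  have hp : 0 < h by rewrite lt0r -eqe hn.
  rewrite -ler_pdivrMr// div1r /c/=; apply: le_trans (ler_norm _) _.
  by rewrite lerDr addr_ge0.
Qed.
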